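(* Let $\Omega\subseteq\mathbb{R}^n$, $n\geq 2$, be open and connected. Suppose there is a function $u\in C^2(\Omega)$ and two real-valued one-variable functions $f>0$ and $g$ (defined on $u(\Omega)$) such that $$|\nabla u(x)| = f(u(x)),\qquad \Delta u(x) = g(u(x))\qquad\text{for all } x\in\Omega.$$ Then $\mathcal{I} := u(\Omega)\subseteq\mathbb{R}$ is an open interval, $f\in C^1(\mathcal{I})$ and $g\in C(\mathcal{I})$. Moreover, the following hold. (i) If $\Delta_1 u(x_0)=0$ at some point $x_0\in\Omega$, then $$g(t) = f(t)f'(t)\quad\text{for } t\in\mathcal{I},\qquad\text{and}\qquad u(x) = U\big(q^T(x-x_0)\big)\quad\text{for } x\in\Omega,$$ for some constant $q\in\mathbb{R}^n$ of unit length, where $U$ is the inverse of the function $F\colon\mathcal{I}\to\mathbb{R}$ given by $$F(t) := \int_{u(x_0)}^t\frac{ds}{f(s)}.$$ (ii) If $C_1 := \Delta_1 u(x_0)>0$ at some point $x_0\in\Omega$, then, with $F(t) := \int_{u(x_0)}^t\frac{ds}{f(s)}$ for $t\in\mathcal{I}$, there is an integer $2\leq k\leq n$ such that for all $t\in\mathcal{I}$ $$F_k(t) := \frac{k-1}{C_1} + F(t) > 0\qquad\text{and}\qquad g(t) = f(t)\left(f'(t) + \frac{k-1}{F_k(t)}\right).$$ Moreover, there are a constant projection matrix $R_0\in Pr_k(n)$ and a point $x_*\in\mathbb{R}^n$ such that $R_0(x-x_* )\neq 0$ for all $x\in\Omega$ and $$u(x) = U_k\big(|R_0(x-x_* )|\big)\quad\text{for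 all } x\in\Omega,$$ where $U_k$ is the inverse of $F_k$.
   Context: Gradients $\nabla u$ are row vectors and $\mathcal{H}u$ denotes the Hessian matrix of $u$. The normalized infinity-Laplacian and the 1-Laplacian of a $C^2$ function $u$ with non-vanishing gradient are $$\Delta_\infty^N u := |\nabla u|^{-2}\,\nabla u\,\mathcal{H}u\,\nabla u^T,\qquad \Delta_1 u := \frac{\Delta u - \Delta_\infty^N u}{|\nabla u|}.$$ $S(n)$ is the set of real symmetric $n\times n$ matrices and $Pr_k(n) := \{R\in S(n) \mid RR=R,\ \operatorname{tr}R = k\}$ is the set of symmetric projection matrices of rank $k$. *)

(* Defs.v *)
From HB Require Import structures.
From mathcomp Require Import all_boot all_order all_algebra.
From mathcomp Require Import all_classical all_reals all_analysis.

Set Implicit Arguments.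
Unset Strict Implicit.
Unset Printing Implicit Defensive.

Import Order.TTheory GRing.Theory Num.Theory.
Import numFieldNormedType.Exports.

Local Open Scope classical_set_scope.
Local Open Scope ring_scope.

(* Points of R^n are column vectors, gradients are row vectors.  The library
   norm `|v| on matrices is the sup norm, hence a separate Euclidean norm,
   used for both rows and columns. *)
Definition enorm (R : realType) (m n : nat) (v : 'M[R]_(m, n)) : R :=
  Num.sqrt (\sum_i \sum_j v i j ^+ 2).

Section Calculus.
Variables (R : realType) (n : nat).
Implicit Types (D : set 'cV[R]_n) (u : 'cV[R]_n -> R) (x : 'cV[R]_n).

Definition partial (i : 'I_n) u : 'cV[R]_n -> R :=
  fun x => 'D_(delta_mx i 0) u x.

(* Both classes are meant for open D: derivability at x refers to a full
   neighbourhood of x. *)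
Definition C1_on D u : Prop :=
  [/\ {within D, continuous u},
      forall i x, D x -> derivable u x (delta_mx i 0) &
      forall i, {within D, continuous (partial i u)}].

Definition C2_on D u : Prop :=
  C1_on D u /\ forall i, C1_on D (partial i u).

Definition grad u x : 'rV[R]_n := \row_i partial i u x.

Definition hessian u x : 'M[R]_n := \matrix_(i, j) partial i (partial j u) x.

Definition laplacian u x : R := \sum_i partial i (partial i u) x.

Definition infty_laplacian u x : R :=
  (enorm (grad u x)) ^- 2 *
  (grad u x *m hessian u x *m (grad u x)^T) 0 0.

Definition one_laplacian u x : R :=
  (laplacian u x - infty_laplacian u x) / enorm (grad u x).

(* Symmetric projection matrices of rank k. *)
Definition Pr (k : nat) : set 'M[R]_n :=
  [set Q | [/\ Q^T = Q, Q *m Q = Q & \tr Q = k%:R]].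

End Calculus.

(* C^1 for functions of one real variable, again on an open set I. *)
Definition C1_real (R : realType) (I : set R) (f : R -> R) : Prop :=
  (forall t, I t -> derivable f t 1) /\ {within I, continuous (derive1 f)}.

(* The integral from a to b, with the usual sign convention when b < a. *)
Definition oriented_integral (R : realType) (a b : R) (h : R -> R) : R :=
  if a <= b then \int[@lebesgue_measure R]_(s in `[a, b]) h s
  else - \int[@lebesgue_measure R]_(s in `[b, a]) h s.

(* U, restricted to F @` I, is the inverse of F : I -> R; the values of F off I
   and of U off F @` I play no role. *)
Definition inverse_on (R : realType) (I : set R) (F U : R -> R) : Prop :=
  {in I, cancel F U} /\ {in F @` I, cancel U F}.

(* Main.v *)
Require Import Defs.
From HB Require Import structures.
From mathcomp Require Import all_boot all_order all_algebra.
From mathcomp Require Import all_classical all_reals all_analysis.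
From mathcomp Require Import ring lra.
From mathcomp Require complex spectral.

(** With [F' = 1 / f] the function [w = F o u] satisfies [|grad w| = 1], and
    [Delta w = Delta_1 u] is a function of [w]. The unit field [nu = grad w] is
    constant along its own lines, so its Jacobian [H] obeys
    [H (x + t nu) (1 + t H x) = H x]. Since [tr H] is constant on the levels of
    [w], comparing the expansions in [t] shows that so are all [tr (H ^ m)],
    hence the eigenvalues of [H] with their multiplicities, and each nonzero
    eigenvalue [l] satisfies [1 / l = w + c]. The map [x - nu / l] is then a
    gradient whose Jacobian has constant rank; such a map is constant along
    affine pieces, along which the inverse of the nondegenerate part of its
    Jacobian is affine. Taking traces gives Cartan's identity without a third
    derivative of [w], and this leaves room for one nonzero eigenvalue only.
    If [H = 0] then [nu] is constant and [w] is affine. Otherwise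
    [nu nu^T + H / l] is a projection and the Jacobian of [nu / l];
    developability of [nu / l] and of [x - nu / l] makes it constant, and
    [1 / l = |nu / l| = |R0 (x - xs)|] is the distance to an affine subspace. *)

Unset Printing Implicit Defensive.

Import Order.TTheory GRing.Theory Num.Theory.
Import numFieldNormedType.Exports.

Local Open Scope classical_set_scope.
Local Open Scope ring_scope.

Set Implicit Arguments.
Unset Strict Implicit.

(** The obstacle is regularity. [u] is only C^2, so [H] is merely continuous: neither the Riccati
    equation along the lines nor the Codazzi equations, the usual source of Cartan's identity and of
    the integrability of the eigenspaces, can be obtained by differentiating [H]. Every differential
    relation is instead read off from an identity between C^1 maps, by comparing the Jacobians of
    its two sides. For the same reason no eigenvalue or eigenvector is followed from point to point.
    Eigenvalues are named at a single point; elsewhere the spectral projections are fixed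
    polynomials in [H], and matrix identities are checked through traces, because a symmetric [A]
    with [\tr (A *m A) = 0] vanishes. Global statements come from local ones by connectedness. *)

(** * Strict differentiability *)

(* Strict differentiability: the natural class here, since it holds at every
   point exactly for C^1 maps and is stable under local inversion. *)
Definition sdiff (R : realType) (U V : normedModType R) (f : U -> V) (x : U)
    (L : U -> V) : Prop :=
  forall e : R, 0 < e -> exists2 d : R, 0 < d & forall y z : U,
    `|y - x| < d -> `|z - x| < d -> `|f y - f z - L (y - z)| <= e * `|y - z|.

Definition lbounded (R : realType) (U V : normedModType R) (L : U -> V) :=
  linear L /\ exists2 C : R, 0 < C & forall v, `|L v| <= C * `|v|.

Section StrictDifferentiability.
Variable R : realType.
Implicit Types U V W : normedModType R.

Lemma lbounded_linear U V (L : U -> V) : lbounded L -> linear L.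
Proof. by case. Qed.

Lemma linB U V (L : U -> V) : linear L -> forall a b, L (a - b) = L a - L b.
Proof.
by move=> hL a b; rewrite addrC -scaleN1r hL scaleN1r addrC.
Qed.

Lemma lin0 U V (L : U -> V) : linear L -> L 0 = 0.
Proof. by move=> hL; rewrite -[in LHS](subrr 0) (linB hL) subrr. Qed.

Lemma linZ U V (L : U -> V) : linear L -> forall (a : R) v, L (a *: v) = a *: L v.
Proof. by move=> hL a v; rewrite -[a *: v]addr0 hL (lin0 hL) addr0. Qed.

Lemma sdiff_near U V (f g : U -> V) x L :
  (exists2 d : R, 0 < d & forall y, `|y - x| < d -> f y = g y) ->
  sdiff f x L -> sdiff g x L.
Proof.
move=> [d d0 fg] h e /h[d' d'0 {}h]; exists (Num.min d d'); first by rewrite lt_min d0.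
by move=> y z; rewrite !lt_min => /andP[? ?] /andP[? ?]; rewrite -!fg//; exact: h.
Qed.

Lemma sdiff_eqL U V (f : U -> V) x L M : L =1 M -> sdiff f x L -> sdiff f x M.
Proof.
move=> LM h e /h[d d0 {}h]; exists d => // y z hy hz; rewrite -LM; exact: h.
Qed.

Lemma sdiff_lip U V (f : U -> V) x L : lbounded L -> sdiff f x L ->
  exists C d : R, [/\ 0 < C, 0 < d & forall y z, `|y - x| < d -> `|z - x| < d ->
    `|f y - f z| <= C * `|y - z|].
Proof.
move=> [_ [C C0 hC]] /(_ 1 ltr01)[d d0 h]; exists (1 + C), d; split => //.
  by rewrite addr_gt0.
move=> y z hy hz; have h1 := h y z hy hz; have h2 := hC (y - z).
rewrite mulrDl; apply: le_trans (lerD h1 h2).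
by rewrite -{1}(subrK (L (y - z)) (f y - f z)); exact: ler_normD.
Qed.

Lemma near_dist U (x : U) (d : R) : 0 < d -> \forall y \near x, `|y - x| < d.
Proof.
move=> d0; apply/nbhs_ballP; exists d => //= y.
by rewrite -ball_normE /= distrC.
Qed.

Lemma nearE_dist U (x : U) (P : U -> Prop) : (\forall y \near x, P y) <->
  exists2 d : R, 0 < d & forall y, `|y - x| < d -> P y.
Proof.
split=> [/nbhs_ballP[d /= d0 h]|[d d0 h]].
  by exists d => // y; rewrite distrC => hy; apply: h; rewrite -ball_normE.
by have := near_dist x d0; apply: filterS.
Qed.

Lemma continuousE_dist U V (f : U -> V) x : {for x, continuous f} <->
  forall e : R, 0 < e -> exists2 d : R, 0 < d & forall y, `|y - x| < d -> `|f y - f x| <= e.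
Proof.
split=> [/cvgrPdist_le h e /h/nearE_dist[d d0 {}h]|h].
  by exists d => // y /h; rewrite distrC.
apply/cvgrPdist_le => e /h[d d0 {}h]; apply/nearE_dist; exists d => // y /h.
by rewrite distrC.
Qed.

Lemma sdiff_continuous U V (f : U -> V) x L : lbounded L -> sdiff f x L ->
  {for x, continuous f}.
Proof.
move=> hL /(sdiff_lip hL)[C [d [C0 d0 h]]].
apply/cvgrPdist_le => e e0; near=> y.
have yd : `|y - x| < d.
  by near: y; exact: near_dist.
have xd : `|x - x| < d by rewrite subrr normr0.
rewrite distrC (le_trans (h _ _ yd xd))//.
rewrite -ler_pdivlMl// mulrC ltW//; near: y.
by apply: near_dist; rewrite divr_gt0.
Unshelve. all: by end_near. Qed.

Lemma sdiff_cst U V (c : V) (x : U) : sdiff (fun=> c) x (fun=> 0).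
Proof.
move=> e e0; exists 1 => // y z _ _.
by rewrite subrr subr0 normr0 mulr_ge0// ltW.
Qed.

Lemma sdiff_lin U V (L : U -> V) x : linear L -> sdiff L x L.
Proof.
move=> hL e e0; exists 1 => // y z _ _.
by rewrite (linB hL) subrr normr0 mulr_ge0// ltW.
Qed.

Lemma sdiffD U V (f g : U -> V) x L M : sdiff f x L -> sdiff g x M ->
  sdiff (fun y => f y + g y) x (fun v => L v + M v).
Proof.
move=> hf hg e e0; have e2 : 0 < e / 2 by rewrite divr_gt0.
have [d d0 {}hf] := hf _ e2; have [d' d'0 {}hg] := hg _ e2.
exists (Num.min d d'); first by rewrite lt_min d0.
move=> y z; rewrite !lt_min => /andP[? ?] /andP[? ?].
rewrite (splitr e) mulrDl; apply: le_trans (lerD (hf y z _ _) (hg y z _ _)) => //.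
apply: le_trans (ler_normD _ _); rewrite le_eqVlt; apply/orP; left; apply/eqP.
by rewrite !opprD [in RHS]addrACA -[in RHS](addrACA (f y)).
Qed.

Lemma sdiffN U V (f : U -> V) x L : sdiff f x L ->
  sdiff (fun y => - f y) x (fun v => - L v).
Proof.
move=> hf e /hf[d d0 {}hf]; exists d => // y z hy hz.
by rewrite -!opprD normrN; exact: hf.
Qed.

Lemma sdiffB U V (f g : U -> V) x L M : sdiff f x L -> sdiff g x M ->
  sdiff (fun y => f y - g y) x (fun v => L v - M v).
Proof. by move=> hf /sdiffN; exact: sdiffD. Qed.

Lemma sdiff_comp U V W (f : U -> V) (g : V -> W) x L M :
  lbounded L -> lbounded M ->
  sdiff f x L -> sdiff g (f x) M -> sdiff (g \o f) x (M \o L).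
Proof.
move=> hL hM hf hg e e0.
have [C [d1 [C0 d10 flip]]] := sdiff_lip hL hf.
have [linM [K K0 hK]] := hM.
have e1 : 0 < e / 2 / C by rewrite !divr_gt0.
have e2 : 0 < e / 2 / K by rewrite !divr_gt0.
have [d2 d20 {}hg] := hg _ e1; have [d3 d30 {}hf] := hf _ e2.
exists (Num.min d1 (Num.min d3 (d2 / C))); first by rewrite !lt_min d10 d30 divr_gt0.
have fx2 y : `|y - x| < d1 -> `|y - x| < d2 / C -> `|f y - f x| < d2.
  move=> h1 h2; have xd : `|x - x| < d1 by rewrite subrr normr0.
  apply: le_lt_trans (flip _ _ h1 xd) _.
  by rewrite mulrC -ltr_pdivlMr.
move=> y z; rewrite !lt_min => /and3P[y1 y3 y2] /and3P[z1 z3 z2] /=.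
have hg' := hg _ _ (fx2 _ y1 y2) (fx2 _ z1 z2).
have hf' := hf _ _ y3 z3; have lip := flip _ _ y1 z1.
have -> : g (f y) - g (f z) - M (L (y - z)) =
  (g (f y) - g (f z) - M (f y - f z)) + M (f y - f z - L (y - z)).
  by rewrite (linB linM (f y - f z)) addrA subrK.
apply: le_trans (ler_normD _ _) _; rewrite (splitr e) mulrDl; apply: lerD.
  apply: le_trans hg' _; rewrite -mulrA ler_pM2l ?divr_gt0//.
  by rewrite mulrC ler_pdivrMr// mulrC.
apply: le_trans (hK _) _; rewrite mulrC -ler_pdivlMr//.
by apply: le_trans hf' _; rewrite le_eqVlt; apply/orP; left; apply/eqP; ring.
Qed.

Lemma sdiffM U (a f : U -> R) x (A L : U -> R) : lbounded (A : U -> R^o) ->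
  lbounded (L : U -> R^o) -> sdiff (a : U -> R^o) x A -> sdiff (f : U -> R^o) x L ->
  sdiff ((fun y => a y * f y) : U -> R^o) x (fun v => A v * f x + a x * L v).
Proof.
move=> hA hL ha hf e e0.
have [Ca [da [Ca0 da0 alip]]] := sdiff_lip hA ha.
have [Cf [df [Cf0 df0 flip]]] := sdiff_lip hL hf.
pose K := 1 + `|f x| + `|a x|.
have K0 : 0 < K by rewrite /K -addrA ltr_pwDl// addr_ge0.
pose e' := e / 4 / K; have e'0 : 0 < e' by rewrite !divr_gt0.
have eK : e' * K = e / 4 by rewrite /e' divfK// gt_eqF.
have [d1 d10 {}ha] := ha _ e'0; have [d2 d20 {}hf] := hf _ e'0.
pose d := Num.min (Num.min d1 d2) (Num.min (Num.min da df) (e / 4 / Ca / Cf)).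
exists d; first by rewrite !lt_min d10 d20 da0 df0 !divr_gt0.
move=> y z; rewrite !lt_min => /andP[/andP[y1 y2] /andP[/andP[ya yf] y5]].
move=> /andP[/andP[z1 z2] /andP[/andP[za zf] z5]].
have xa : `|x - x| < da by rewrite subrr normr0.
have xf : `|x - x| < df by rewrite subrr normr0.
have E1 := ha _ _ y1 z1; have E2 := hf _ _ y2 z2.
have E3 := alip _ _ ya za; have E4 := flip _ _ yf zf.
have E5 := flip _ _ yf xf; have E6 := alip _ _ za xa.
(* Two linearization errors weighted by values at [x], then two products of increments, which are
   small because one factor is small and the other Lipschitz. Each of the four terms gets a quarter
   of [e]. *)
have -> : a y * f y - a z * f z - (A (y - z) * f x + a x * L (y - z)) =
   (a y - a z - A (y - z)) * f x + a x * (f y - f z - L (y - z)) +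
   ((a y - a z) * (f y - f x) + (a z - a x) * (f y - f z)) by ring.
have h1 : `|(a y - a z - A (y - z)) * f x| <= e / 4 * `|y - z|.
  rewrite normrM mulrC (le_trans (ler_wpM2l (normr_ge0 (f x)) E1))//.
  rewrite mulrA ler_wpM2r// -eK mulrC ler_pM2l// /K.
  by have := normr_ge0 (a x); lra.
have h2 : `|a x * (f y - f z - L (y - z))| <= e / 4 * `|y - z|.
  rewrite normrM (le_trans (ler_wpM2l (normr_ge0 (a x)) E2))//.
  rewrite mulrA ler_wpM2r// -eK mulrC ler_pM2l// /K.
  by have := normr_ge0 (f x); lra.
have h3 : `|(a y - a z) * (f y - f x)| <= e / 4 * `|y - z|.
  rewrite normrM; apply: le_trans (ler_pM _ _ E3 E5) _ => //.
  rewrite mulrAC ler_wpM2r//.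
  rewrite ltr_pdivlMr// ltr_pdivlMr// in y5.
  by rewrite mulrC mulrAC; apply: le_trans (ltW y5); rewrite le_eqVlt; apply/orP; left; apply/eqP; ring.
have h4 : `|(a z - a x) * (f y - f z)| <= e / 4 * `|y - z|.
  rewrite normrM; apply: le_trans (ler_pM _ _ E6 E4) _ => //.
  rewrite mulrA ler_wpM2r//.
  rewrite ltr_pdivlMr// ltr_pdivlMr// in z5.
  by apply: le_trans (ltW z5); rewrite le_eqVlt; apply/orP; left; apply/eqP; ring.
have -> : e * `|y - z| = e / 4 * `|y - z| + e / 4 * `|y - z| + (e / 4 * `|y - z| + e / 4 * `|y - z|) by field.
by do !(apply: le_trans (ler_normD _ _) _; apply: lerD => //).
Qed.

(** A quantitative form of uniqueness, tested on short multiples of [v]. Arbitrarily small [c] gives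
    [sdiff_uniq], small [c] at neighbouring points gives continuity of the Jacobian, and [c = 1/2]
    with [M] the identity gives its invertibility. *)
Lemma sdiff_close U V (f : U -> V) x L M (c : R) : linear L -> linear M ->
  sdiff f x L ->
  (exists2 d : R, 0 < d & forall y z : U, `|y - x| < d -> `|z - x| < d ->
     `|f y - f z - M (y - z)| <= c * `|y - z|) ->
  forall v, `|L v - M v| <= c * `|v|.
Proof.
move=> hL hM fL [d' d'0 fM] v; apply/ler_addgt0Pl => e e0.
pose e' := e / (1 + `|v|).
have v1 : 0 < 1 + `|v| by rewrite ltr_pwDl.
have e'0 : 0 < e' by rewrite !divr_gt0.
have [d d0 {}fL] := fL _ e'0.
pose t := Num.min d d' / (1 + `|v|).
have t0 : 0 < t by rewrite divr_gt0// lt_min d0.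
have tv : `|t *: v| < Num.min d d'.
  rewrite normrZ gtr0_norm// /t mulrAC -mulrA gtr_pMr ?lt_min ?d0//.
  by rewrite ltr_pdivrMr// mul1r ltrDr.
have xx : `|x - x| = 0 by rewrite subrr normr0.
move: tv; rewrite lt_min => /andP[tv tv'].
have := fL (x + t *: v) x; have := fM (x + t *: v) x.
rewrite xx (addrC x) addrK => /(_ tv' d'0) h1 /(_ tv d0) h2.
rewrite (linZ hL) in h2; rewrite (linZ hM) in h1.
have : `|t *: (L v - M v)| <= c * `|t *: v| + e' * `|t *: v|.
  apply: le_trans (lerD h1 h2); apply: le_trans (ler_normB _ _).
  set X := f _ - f _; by rewrite opprB [X in _ <= `|X|]addrC addrA subrK scalerBr.
clearbody t; rewrite !normrZ (gtr0_norm t0) => h3.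
have : t * `|L v - M v| <= t * (c * `|v| + e' * `|v|) by apply: le_trans h3 _; rewrite le_eqVlt; apply/orP; left; apply/eqP; ring.
rewrite ler_pM2l// => /le_trans; apply.
have eE : e' * (1 + `|v|) = e by rewrite /e' divfK// gt_eqF.
clearbody e'; lra.
Qed.

Lemma sdiff_uniq U V (f : U -> V) x L M : linear L -> linear M ->
  sdiff f x L -> sdiff f x M -> L =1 M.
Proof.
move=> hL hM fL fM v; apply/eqP; rewrite -subr_eq0 -normr_le0; apply/ler_addgt0Pl => e e0.
have v1 : 0 < 1 + `|v| by rewrite ltr_pwDl.
have e'0 : 0 < e / (1 + `|v|) by rewrite divr_gt0.
apply: le_trans (sdiff_close hL hM fL (fM _ e'0) v) _.
by rewrite addr0 mulrAC ler_pdivrMr// ler_pM2l// lerDr.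
Qed.

Lemma sdiff_is_derive (f : R -> R) (x a : R) :
  sdiff (f : R^o -> R^o) x (fun h => h * a) -> is_derive x (1 : R) f a.
Proof.
move=> h.
have : h^-1 *: ((f \o shift x) (h *: (1:R)) - f x) @[h --> 0^'] --> a.
  apply/cvgrPdist_le => e e0; have [d d0 {}h] := h _ e0.
  near=> t; have t0 : t != 0 by near: t; exact: nbhs_dnbhs_neq.
  have td : `|t| < d.
    by near: t; exact: dnbhs0_lt.
  rewrite /= [t *: 1]mulr1 distrC.
  have := h (t + x) x; rewrite addrK subrr normr0 => /(_ td d0).
  rewrite -[_^-1 *: _]/(_ * _) => h1.
  rewrite -(ler_pM2l (_ : 0 < `|t|)) ?normr_gt0// -normrM mulrBr mulVKf// mulrC.
  by rewrite (mulrC `|t|) (mulrC a).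
move=> k; apply: DeriveDef; first by apply/cvg_ex; exists a.
exact: (cvg_lim _ k).
Unshelve. all: by end_near. Qed.
End StrictDifferentiability.

(** * Restriction to lines and mean value theorems *)

Section Lines.
Variable R : realType.
Implicit Types U V W : normedModType R.

Lemma lbounded_scale U (v : U) : lbounded (fun h : R^o => h *: v).
Proof.
split; first by move=> a x y; rewrite scalerDl scalerA.
exists (1 + `|v|); first by rewrite ltr_pwDl.
by move=> h; rewrite normrZ mulrC ler_wpM2r// lerDr.
Qed.

Lemma sdiff_line U V (f : U -> V) (p v : U) (s : R) L : lbounded L ->
  sdiff f (p + s *: v) L ->
  sdiff ((fun s => f (p + s *: v)) : R^o -> V) s (fun h => L (h *: v)).
Proof.
move=> hL hf.
have hp : sdiff (fun s : R^o => p + s *: v) s (fun h => 0 + h *: v).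
  apply: sdiffD; first exact: sdiff_cst.
  by apply: sdiff_lin; exact: (lbounded_scale v).1.
have {}hp : sdiff (fun s : R^o => p + s *: v) s (fun h => h *: v).
  by apply: sdiff_eqL hp => h; rewrite add0r.
exact: (sdiff_comp (lbounded_scale v) hL hp hf).
Qed.

Lemma is_derive_line U (f : U -> R) (p v : U) (s : R) (L : U -> R) :
  lbounded (L : U -> R^o) -> sdiff (f : U -> R^o) (p + s *: v) L ->
  is_derive s (1 : R) (fun s => f (p + s *: v)) (L v).
Proof.
move=> hL /(sdiff_line hL) h; apply: sdiff_is_derive.
by apply: sdiff_eqL h => t; rewrite (linZ hL.1).
Qed.

Lemma mvt01 (g dg : R -> R) :
  (forall s : R, 0 <= s <= 1 -> is_derive s (1 : R) g (dg s)) ->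
  exists2 s : R, 0 <= s <= 1 & g 1 - g 0 = dg s.
Proof.
move=> h.
have [||s] := @MVT R g dg 0 1 ltr01.
- by move=> s; rewrite in_itv /= => /andP[s0 s1]; apply: h; rewrite !ltW.
- apply: derivable_within_continuous => s; rewrite in_itv /= => sI.
  by have [] := h s sI.
- rewrite in_itv /= => /andP[s0 s1]; rewrite subr0 mulr1 => ->.
  by exists s; rewrite // !ltW.
Qed.

Lemma mvt_line U (f : U -> R) (p v : U) (dl : R -> R) :
  (forall s : R, 0 <= s <= 1 -> exists L : U -> R^o,
     [/\ lbounded L, sdiff (f : U -> R^o) (p + s *: v) L & L v = dl s]) ->
  exists2 s : R, 0 <= s <= 1 & f (p + v) - f p = dl s.
Proof.
move=> h; have [|s s01] := @mvt01 (fun s => f (p + s *: v)) dl.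
  by move=> s /h[L [hL fL <-]]; exact: is_derive_line.
by rewrite scale1r scale0r addr0; exists s.
Qed.

Lemma sdiff_C1 (f df : R -> R) (t d : R) : 0 < d ->
  (forall s, `|s - t| < d -> is_derive s (1 : R) f (df s)) ->
  {for t, continuous df} -> sdiff (f : R^o -> R^o) t (fun h => h * df t).
Proof.
move=> d0 fd dfc e e0.
have /cvgrPdist_le/(_ _ e0) := dfc; move=> /nbhs_ballP[d' /= d'0 h].
exists (Num.min d d'); first by rewrite lt_min d0.
suff key : forall y z, y < z -> `|y - t| < Num.min d d' -> `|z - t| < Num.min d d' ->
    `|f z - f y - (z - y) * df t| <= e * `|z - y|.
  move=> y z hy hz; have [yz|zy|->] := ltgtP y z; last 2 first.
  - exact: key.
  - by rewrite !subrr mul0r subr0 normr0 mulr0.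
  rewrite -normrN (distrC y z) (_ : - _ = f z - f y - (z - y) * df t); last by ring.
  exact: key.
move=> y z yz hy hz.
have bd s : y <= s <= z -> `|s - t| < Num.min d d'.
  move=> /andP[ys sz]; move: hy hz; rewrite !ltr_norml => /andP[? ?] /andP[? ?].
  by apply/andP; split; lra.
have [||s] := @MVT R f df y z yz.
- move=> s; rewrite in_itv /= => /andP[ys sz]; apply: fd.
  by have := bd s; rewrite lt_min !ltW// => /(_ isT)/andP[].
- apply: derivable_within_continuous => s; rewrite in_itv /= => sI.
  by have := bd s sI; rewrite lt_min => /andP[/fd[]].
- rewrite in_itv /= => /andP[ys sz] ->.
  rewrite mulrC -mulrBr normrM mulrC ler_wpM2r// distrC; apply: h => /=.
  by have := bd s; rewrite lt_min distrC !ltW// => /(_ isT)/andP[].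
Qed.

End Lines.

(** * Matrices in the sup norm *)

Section Matrices.
Variable R : realType.

Lemma le_mx_norm m n (A : 'M[R]_(m, n)) i j : `|A i j| <= `|A|.
Proof.
by rewrite [leRHS]/Num.norm /= mx_normrE; apply: (le_bigmax _ (fun ij => `|A ij.1 ij.2|) (i, j)).
Qed.

Lemma mx_norm_le m n (A : 'M[R]_(m, n)) c : 0 <= c ->
  (forall i j, `|A i j| <= c) -> `|A| <= c.
Proof.
by move=> c0 h; rewrite [leLHS]/Num.norm /= mx_normrE; apply/bigmax_leP; split.
Qed.

Lemma mx_normM m n p (A : 'M[R]_(m, n)) (B : 'M[R]_(n, p)) :
  `|A *m B| <= n%:R * `|A| * `|B|.
Proof.
apply: mx_norm_le => [|i j]; first by rewrite !mulr_ge0.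
rewrite mxE; apply: le_trans (ler_norm_sum _ _ _) _.
apply: (@le_trans _ _ (\sum_(k < n) `|A| * `|B|)).
  by apply: ler_sum => k _; rewrite normrM ler_pM// le_mx_norm.
by rewrite sumr_const card_ord -[leLHS]mulr_natl mulrA.
Qed.

Lemma lbounded_mulmx m n p (J : 'M[R]_(m, n)) :
  lbounded (mulmx J : 'M[R]_(n, p) -> 'M[R]_(m, p)).
Proof.
split; first by move=> a x y; rewrite mulmxDr -scalemxAr.
exists (1 + n%:R * `|J|); first by rewrite ltr_pwDl// mulr_ge0.
move=> v; apply: le_trans (mx_normM _ _) _.
by rewrite ler_wpM2r// lerDr.
Qed.

Definition rowlin n (p : 'rV[R]_n) : 'cV[R]_n -> R^o := fun v => (p *m v) 0 0.

Lemma lbounded_rowlin n (p : 'rV[R]_n) : lbounded (rowlin p).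
Proof.
split; first by move=> a x y; rewrite /rowlin mulmxDr -scalemxAr !mxE.
exists (1 + n%:R * `|p|); first by rewrite ltr_pwDl// mulr_ge0.
move=> v; apply: le_trans (le_mx_norm _ _ _) _; apply: le_trans (mx_normM _ _) _.
by rewrite ler_wpM2r// lerDr.
Qed.

Lemma sdiff_mxP m n (U : normedModType R) (f : U -> 'M[R]_(m, n)) x (L : U -> 'M[R]_(m, n)) :
  (forall i j, sdiff ((fun y => f y i j) : U -> R^o) x (fun v => L v i j)) ->
  sdiff f x L.
Proof.
move=> h e e0.
pose P (ij : 'I_m * 'I_n) d := 0 < d /\ forall y z, `|y - x| < d -> `|z - x| < d ->
  `|f y ij.1 ij.2 - f z ij.1 ij.2 - L (y - z) ij.1 ij.2| <= e * `|y - z|.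
have /boolp.choice[d hd] : forall ij, exists d, P ij d.
  by move=> [i j]; have [d d0 ?] := h i j e e0; exists d.
exists (\big[Num.min/1]_ij d ij).
  by elim/big_ind : _ => // [a b a0 b0|ij _]; [rewrite lt_min a0|case: (hd ij)].
move=> y z hy hz; apply: mx_norm_le => [|i j]; first by rewrite mulr_ge0// ltW.
rewrite !mxE; apply: (hd (i, j)).2.
  by apply: lt_le_trans hy _; exact: bigmin_le_cond.
by apply: lt_le_trans hz _; exact: bigmin_le_cond.
Qed.

Lemma sdiff_coord m n (U : normedModType R) (f : U -> 'M[R]_(m, n)) x (L : U -> 'M[R]_(m, n)) i j :
  sdiff f x L -> sdiff ((fun y => f y i j) : U -> R^o) x (fun v => L v i j).
Proof.
move=> h e /h[d d0 {}h]; exists d => // y z hy hz.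
have := h y z hy hz; apply: le_trans; apply: le_trans (le_mx_norm _ i j).
by rewrite !mxE.
Qed.

End Matrices.

(** * From continuous partial derivatives to strict differentiability *)

Section C1.
Variable R : realType.

Lemma mvt_between (g dg : R -> R) (a b : R) :
  (forall s : R, Num.min a b <= s <= Num.max a b -> is_derive s (1 : R) g (dg s)) ->
  exists2 s : R, Num.min a b <= s <= Num.max a b & g b - g a = dg s * (b - a).
Proof.
wlog ab : a b / a <= b => [wl h|].
  have [ab|ba] := orP (le_total a b); first exact: wl.
  have [||s hs e] := wl b a => //.
    by move=> s hs; apply: h; rewrite minC maxC.
  exists s; first by rewrite minC maxC.
  by rewrite -opprB e -mulrN opprB.
rewrite (min_idPl ab) (max_idPr ab) => h.
have [||s hs e] := @MVT_segment R g dg a b ab.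
- by move=> s; rewrite in_itv /= => /andP[s0 s1]; apply: h; rewrite !ltW.
- by apply: derivable_within_continuous => s; rewrite in_itv /= => /h[].
- by exists s => //; move: hs; rewrite in_itv.
Qed.

Lemma derivable_is_derive_line (U : normedModType R) (u : U -> R) (p v : U) (s : R) :
  derivable u (p + s *: v) v ->
  is_derive s (1 : R) (fun s => u (p + s *: v)) ('D_v u (p + s *: v)).
Proof.
move=> h.
have E : (fun h : R => h^-1 *: (((fun s => u (p + s *: v)) \o shift s) (h *: (1 : R)) -
     u (p + s *: v))) = (fun h => h^-1 *: ((u \o shift (p + s *: v)) (h *: v) - u (p + s *: v))).
  apply/funext => k /=; rewrite [k *: 1]mulr1 scalerDl; congr (_ *: (u _ - _)).
  by rewrite addrCA.
by apply: DeriveDef; rewrite /derivable /derive E.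
Qed.

(** The corners of a path from [z] to [y] that changes one coordinate at a time. *)
Definition mixc n (y z : 'cV[R]_n) (k : nat) : 'cV[R]_n :=
  \col_i (if (i < k)%N then y i 0 else z i 0).

(** Along the corner path each step involves one partial derivative, to which the mean value theorem
    applies; the steps telescope. *)
Lemma C1_sdiff n (D : set 'cV[R]_n) (u : 'cV[R]_n -> R) x :
  open D -> C1_on D u -> D x -> sdiff (u : 'cV[R]_n -> R^o) x (rowlin (grad u x)).
Proof.
move=> Do [_ hd hc] Dx e e0.
have pc i : {for x, continuous (partial i u)}.
  by have := hc i; rewrite continuous_open_subspace// => /(_ x); apply; rewrite inE.
(* Each of the [n] steps costs at most [e' * |y - z|]; [n.+1] avoids a division by zero when
   [n = 0]. *)
pose e' := e / n.+1%:R; have e'0 : 0 < e' by rewrite divr_gt0.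
have [d0 d00 hD] : exists2 d0 : R, 0 < d0 & forall y, `|y - x| < d0 -> D y.
  have /nbhs_ballP[d0 /= d00 h] := open_nbhs_nbhs (conj Do Dx).
  by exists d0 => // y; rewrite distrC => hy; apply: h; rewrite -ball_normE.
pose P i d := 0 < d /\ forall y, `|y - x| < d -> `|partial i u y - partial i u x| <= e'.
have /boolp.choice[d hP] : forall i, exists d, P i d.
  move=> i; have /cvgrPdist_le/(_ _ e'0) := pc i; move=> /nbhs_ballP[d /= d'0 h].
  exists d; split=> // y; rewrite distrC => hy; rewrite distrC; apply: h.
  by rewrite -ball_normE.
pose dm := \big[Num.min/d0]_i d i.
have dmi i y : `|y - x| < dm -> `|partial i u y - partial i u x| <= e'.
  by move=> hy; apply: (hP i).2; apply: lt_le_trans hy _; exact: bigmin_le_cond.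
have dmD y : `|y - x| < dm -> D y.
  by move=> hy; apply: hD; apply: lt_le_trans hy _; exact: bigmin_le_id.
have dm0 : 0 < dm.
  by rewrite /dm; elim/big_ind : _ => // [a b a0 b0|ij _]; [rewrite lt_min a0|case: (hP ij)].
exists dm => // y z hy hz.
pose c i := y i 0 - z i 0.
have step (k : 'I_n) : `|u (mixc y z k.+1) - u (mixc y z k) - partial k u x * c k| <= e' * `|y - z|.
  (* In the sup norm the box spanned by [y] and [z] lies no farther from [x] than its two corners
     do, so the path stays in the ball. *)
  have ball s : Num.min 0 (c k) <= s <= Num.max 0 (c k) ->
      `|mixc y z k + s *: delta_mx k 0 - x| < dm.
    move=> hs; have {}hs : Num.min (y k 0) (z k 0) <= z k 0 + s <= Num.max (y k 0) (z k 0).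
      move: hs; rewrite /c; case: (leP 0 (y k 0 - z k 0)); case: (leP (y k 0) (z k 0)) => h1 h2; lra.
    set M := Num.max `|y - x| `|z - x|.
    have M0 : 0 <= M by rewrite le_max normr_ge0.
    apply: (@le_lt_trans _ _ M); last by rewrite gt_max hy.
    apply: mx_norm_le => // i j.
    have hyi l : - M <= y l 0 - x l 0 <= M.
      by rewrite -ler_norml; have := le_mx_norm (y - x) l 0; rewrite !mxE /M le_max => ->.
    have hzi l : - M <= z l 0 - x l 0 <= M.
      by rewrite -ler_norml; have := le_mx_norm (z - x) l 0; rewrite !mxE /M le_max orbC => ->.
    rewrite !mxE (ord1 j) eqxx andbT ler_norml.
    have [->|ik] := eqVneq i k; last first.
      by rewrite mulr0 addr0; case: ifP => _.
    rewrite ltnn mulr1; have := hyi k; have := hzi k; clearbody M.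
    by move: hs; case: (leP (y k 0) (z k 0)) => ? /andP[? ?] /andP[? ?] /andP[? ?]; apply/andP; split; lra.
  have [|s hs] := @mvt_between (fun s => u (mixc y z k + s *: delta_mx k 0))
     (fun s => partial k u (mixc y z k + s *: delta_mx k 0)) 0 (c k).
    by move=> s hs; apply: derivable_is_derive_line; apply: hd; apply: dmD; exact: ball.
  rewrite scale0r addr0 subr0.
  have -> : mixc y z k + c k *: delta_mx k 0 = mixc y z k.+1.
    apply/matrixP => i j; rewrite !mxE (ord1 j) eqxx andbT ltnS.
    have [->|ik] := eqVneq i k; first by rewrite ltnn leqnn mulr1 /c addrC subrK.
    rewrite -val_eqE /= in ik.
    by rewrite mulr0 addr0 [in RHS]leq_eqVlt (negbTE ik).
  move=> ->; rewrite -mulrBl normrM; apply: ler_pM => //.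
    by apply: dmi; exact: ball.
  by have := le_mx_norm (y - z) k 0; rewrite !mxE.
have -> : u y - u z = \sum_(k < n) (u (mixc y z k.+1) - u (mixc y z k)).
  rewrite -(big_mkord xpredT (fun k => u (mixc y z k.+1) - u (mixc y z k))) telescope_sumr//.
  by congr (u _ - u _); apply/matrixP => i j; rewrite !mxE (ord1 j) ?ltn_ord.
have -> : rowlin (grad u x) (y - z) = \sum_(k < n) partial k u x * c k.
  by rewrite /rowlin mxE; apply: eq_bigr => k _; rewrite !mxE.
rewrite -sumrB; apply: le_trans (ler_norm_sum _ _ _) _.
apply: le_trans (ler_sum _ (fun k _ => step k)) _.
rewrite sumr_const card_ord -[leLHS]mulr_natl mulrA ler_wpM2r// /e'.
by rewrite mulrCA; apply: ler_piMr; [exact: ltW|rewrite ler_pdivrMr// mul1r ler_nat].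
Qed.

End C1.

(** * Inverse functions *)

Section InverseFunction.
Variable R : realType.

Lemma unitmx_inj n (A : 'M[R]_n) : (forall v : 'cV[R]_n, A *m v = 0 -> v = 0) ->
  A \in unitmx.
Proof.
move=> h; rewrite -unitmx_tr -row_free_unit; apply: inj_row_free => v hv.
by apply: trmx_inj; rewrite trmx0; apply: h; rewrite -[A]trmxK -trmx_mul hv trmx0.
Qed.

(** The strict estimate at [x] holds on a ball, hence also around each nearby [y], where
    [sdiff_close] turns it into a bound on [J y - J x]. *)
Lemma jacobian_continuous m n (f : 'cV[R]_n -> 'cV[R]_m) (J : 'cV[R]_n -> 'M[R]_(m, n)) x :
  (exists2 d : R, 0 < d & forall y, `|y - x| < d -> sdiff f y (mulmx (J y))) ->
  {for x, continuous J}.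
Proof.
move=> [d d0 h]; apply/continuousE_dist => e e0.
have xx : `|x - x| < d by rewrite subrr normr0.
have [d' d'0 h'] := h _ xx e e0.
exists (Num.min d d'); first by rewrite lt_min d0.
move=> y; rewrite lt_min => /andP[yd yd'].
have key := @sdiff_close _ _ _ f y _ (mulmx (J x)) e (lbounded_linear (lbounded_mulmx 1 (J y))) (lbounded_linear (lbounded_mulmx 1 (J x))) (h _ yd).
apply: mx_norm_le => [|i j]; first exact: ltW.
have := key _ (delta_mx j 0); rewrite -mulmxBl => {}key.
have dn : `|delta_mx j 0 : 'cV[R]_n| <= 1.
  by apply: mx_norm_le => // a b; rewrite !mxE; case: (_ && _); rewrite ?normr1 ?normr0.
have : `|(J y - J x) *m (delta_mx j 0 : 'cV[R]_n)| <= e * 1.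
  apply: (@le_trans _ _ (e * `|delta_mx j 0 : 'cV[R]_n|)); last by rewrite ler_pM2l.
  apply: key; exists (d' - `|y - x|); first by rewrite subr_gt0.
  move=> a b ha hb; apply: h'.
    by rewrite -(subrKA y); apply: le_lt_trans (ler_normD _ _) _; rewrite -ltrBrDr.
  by rewrite -(subrKA y); apply: le_lt_trans (ler_normD _ _) _; rewrite -ltrBrDr.
rewrite mulr1; apply: le_trans.
by have := le_mx_norm ((J y - J x) *m (delta_mx j 0 : 'cV[R]_n)) i 0; rewrite -colE !mxE.
Qed.

(* The completeness and the norm of matrices are not joined in the library. *)
HB.instance Definition _ (n : nat) :=
  Uniform_isComplete.Build 'cV[R]_n (@mx_complete R n 1).

(** A solution is a fixed point of [y - F y + eta], a contraction of factor 1/2; the bound on [eta]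
    keeps it inside the closed ball. *)
Lemma near_id_surj n (F : 'cV[R]_n -> 'cV[R]_n) x (r : R) eta : 0 < r ->
  (forall y z, `|y - x| <= r -> `|z - x| <= r ->
     `|F y - F z - (y - z)| <= 2^-1 * `|y - z|) ->
  `|eta - F x| <= r / 2 -> exists2 y, `|y - x| <= r & F y = eta.
Proof.
move=> r0 h he; pose U : set 'cV[R]_n := [set y | `|y - x| <= r].
pose T y := y - F y + eta.
have TU : set_fun U U T.
  move=> y Uy; rewrite /U /T /=.
  have xx : `|x - x| <= r by rewrite subrr normr0 ltW.
  have -> : y - F y + eta - x = - (F y - F x - (y - x)) + (eta - F x).
    by apply/matrixP => i j; rewrite !mxE; ring.
  apply: le_trans (ler_normD _ _) _; rewrite normrN (splitr r); apply: lerD => //.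
  apply: le_trans (h _ _ Uy xx) _; rewrite mulrC ler_pM2r ?invr_gt0//.
pose f : {fun U >-> U} := HB.pack T (isFun.Build _ _ _ _ _ TU).
have [|||p Up pE] := @banach_fixed_point R _ U f.
- have q0 : 0 <= 2^-1 :> R by rewrite invr_ge0.
  exists (NngNum q0); split; first by rewrite /= invf_lt1// ltr1n.
  move=> [y z] [/= Uy Uz]; rewrite /f /= /T.
  have -> : y - F y + eta - (z - F z + eta) = - (F y - F z - (y - z)).
    by apply/matrixP => i j; rewrite !mxE; ring.
  by rewrite normrN; exact: h.
- have -> : U = closed_ball x r.
    by rewrite closed_ballE//; apply/funext => y; rewrite /U /closed_ball_/= distrC.
  exact: closed_ball_closed.
- by exists x; rewrite /U /= subrr normr0 ltW.
exists p => //; move: pE; rewrite /f /= /T => /(congr1 (fun z => z - p + F p)).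
rewrite subrr add0r => ->; apply/matrixP => i j; rewrite !mxE; ring.
Qed.
End InverseFunction.

Section InverseFunction2.
Variable R : realType.

Lemma mulmx_bound m n p (A : 'M[R]_(m, n)) :
  exists2 C : R, 0 < C & forall v : 'M[R]_(n, p), `|A *m v| <= C * `|v|.
Proof. exact: (lbounded_mulmx p A).2. Qed.

(** After composition with [invmx (J x)] the map is close to the identity. The inverse is strictly
    differentiable at every point of a ball, not only at [G x], so its own Jacobian can be compared
    between points. *)
Lemma inverse_function n (G : 'cV[R]_n -> 'cV[R]_n) (J : 'cV[R]_n -> 'M[R]_n) x (d0 : R) :
  0 < d0 -> (forall y, `|y - x| < d0 -> sdiff G y (mulmx (J y))) ->
  J x \in unitmx ->
  exists (Z : 'cV[R]_n -> 'cV[R]_n) (r d : R), [/\ 0 < r, 0 < d,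
    (forall z, `|z - G x| < r -> [/\ `|Z z - x| < d0, G (Z z) = z,
       J (Z z) \in unitmx & sdiff Z z (mulmx (invmx (J (Z z))))]) &
    forall y, `|y - x| < d -> [/\ `|y - x| < d0, `|G y - G x| < r & Z (G y) = y]].
Proof.
move=> d00 hG Ju; have xx (e : R) : 0 < e -> `|x - x| < e by rewrite subrr normr0.
pose F y := invmx (J x) *m G y.
have [CA CA0 hCA] := mulmx_bound 1 (invmx (J x)).
have [d1 d10 hF] : exists2 d1 : R, 0 < d1 & forall y z, `|y - x| < d1 -> `|z - x| < d1 ->
    `|F y - F z - (y - z)| <= 2^-1 * `|y - z|.
  have e0 : 0 < 2^-1 / CA :> R by rewrite divr_gt0.
  have [d d'0 h] := hG _ (xx _ d00) _ e0; exists d => // y z hy hz.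
  have -> : F y - F z - (y - z) = invmx (J x) *m (G y - G z - J x *m (y - z)).
    by rewrite [in RHS]mulmxBr mulKmx// mulmxBr.
  apply: le_trans (hCA _) _; rewrite mulrC -ler_pdivlMr//.
  by apply: le_trans (h _ _ hy hz) _; rewrite mulrAC.
have Finj y z : `|y - x| < d1 -> `|z - x| < d1 -> `|y - z| <= 2 * `|F y - F z|.
  move=> hy hz; have := hF y z hy hz.
  have : `|y - z| <= `|F y - F z| + `|F y - F z - (y - z)|.
    by rewrite -[X in `|X| <= _](subKr (F y - F z)); exact: ler_normB.
  lra.
pose r0 := Num.min d0 d1 / 2.
have r00 : 0 < r0 by rewrite divr_gt0// lt_min d00.
have [r0d0 r0d1] : r0 < d0 /\ r0 < d1.
  have m0 : 0 < Num.min d0 d1 by rewrite lt_min d00.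
  have : r0 < Num.min d0 d1 by rewrite /r0; lra.
  by rewrite lt_min => /andP[].
(* Chosen so that [invmx (J x)] maps a displacement below [r] to one of size at most [r0 / 2], as
   [near_id_surj] requires. *)
pose r := r0 / 2 / CA; have rpos : 0 < r by do 2 apply: divr_gt0 => //.
(* The default value [x] is never taken on the ball of radius [r] around [G x], by [hZ]. *)
pose Z z := xget x [set y | `|y - x| <= r0 /\ G y = z].
have Ginj y z : `|y - x| < d1 -> `|z - x| < d1 -> G y = G z -> y = z.
  move=> hy hz e; apply/eqP; rewrite -subr_eq0 -normr_le0.
  by apply: le_trans (Finj _ _ hy hz) _; rewrite /F e subrr normr0 mulr0.
have hZ z : `|z - G x| < r -> `|Z z - x| <= r0 /\ G (Z z) = z.
  move=> hz; rewrite /Z; case: xgetP => [y _ //|abs]; exfalso.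
  have [||y hy Fy] := @near_id_surj _ _ F x r0 (invmx (J x) *m z) r00.
  - by move=> y y' hy hy'; apply: hF; [exact: le_lt_trans hy r0d1|exact: le_lt_trans hy' r0d1].
  - rewrite /F -mulmxBr; apply: le_trans (hCA _) _; rewrite mulrC -ler_pdivlMr//.
    exact: ltW.
  - apply: (abs y); split => //.
    by have /(congr1 (mulmx (J x))) := Fy; rewrite /F !mulKVmx.
have ZG y : `|y - x| <= r0 -> `|G y - G x| < r -> Z (G y) = y.
  move=> hy /hZ[hz e]; by apply: Ginj => //; [exact: le_lt_trans hz r0d1|exact: le_lt_trans hy r0d1].
have Zlip z z' : `|z - G x| < r -> `|z' - G x| < r -> `|Z z - Z z'| <= 2 * CA * `|z - z'|.
  move=> /hZ[h1 e1] /hZ[h2 e2].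
  apply: le_trans (Finj _ _ (le_lt_trans h1 r0d1) (le_lt_trans h2 r0d1)) _.
  by rewrite -mulrA ler_pM2l// /F e1 e2 -mulmxBr.
have [C [d2 [C0 d20 Glip]]] := sdiff_lip (lbounded_mulmx 1 (J x)) (hG _ (xx _ d00)).
exists Z, r, (Num.min r0 (Num.min d2 (r / C))); split => //.
- by rewrite !lt_min r00 d20 divr_gt0.
- move=> z hz; have [h1 e1] := hZ z hz.
  have Zd0 := le_lt_trans h1 r0d0; have Zd1 := le_lt_trans h1 r0d1.
  (* The Jacobian of [F] at [Z z] is within 1/2 of the identity, so a kernel vector [v] satisfies
     [|v| <= |v| / 2]. *)
  have uJ : J (Z z) \in unitmx.
    apply: unitmx_inj => v Jv.
    have hF' : sdiff F (Z z) (mulmx (invmx (J x)) \o mulmx (J (Z z))).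
      apply: (sdiff_comp (f := G) (lbounded_mulmx 1 _) (lbounded_mulmx 1 _)); first exact: hG.
      by apply: sdiff_lin; exact: (lbounded_mulmx 1 _).1.
    have linJ : linear (mulmx (invmx (J x)) \o mulmx (J (Z z)) : 'cV[R]_n -> 'cV[R]_n).
      by move=> a b c; rewrite /= !mulmxDr -!scalemxAr.
    have linid : linear (id : 'cV[R]_n -> 'cV[R]_n) by [].
    have := sdiff_close (c := 2^-1) linJ linid hF' _ v; rewrite /= Jv mulmx0 sub0r normrN.
    move=> key; apply/eqP; rewrite -normr_le0.
    have : `|v| <= 2^-1 * `|v|; last by lra.
    apply: key; exists (d1 - `|Z z - x|); first by rewrite subr_gt0.
    move=> a b ha hb; apply: hF.
      by rewrite -(subrKA (Z z)); apply: le_lt_trans (ler_normD _ _) _; rewrite -ltrBrDr.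
    by rewrite -(subrKA (Z z)); apply: le_lt_trans (ler_normD _ _) _; rewrite -ltrBrDr.
  split => // e e0.
  have [K K0 hK] := mulmx_bound 1 (invmx (J (Z z))).
  have e'0 : 0 < e / K / (2 * CA) by rewrite !divr_gt0// mulr_gt0.
  have [d3 d30 h3] := hG _ Zd0 _ e'0.
  pose d4 := Num.min (r - `|z - G x|) (d3 / (2 * CA)).
  have d40 : 0 < d4 by rewrite lt_min subr_gt0 hz divr_gt0// mulr_gt0.
  have aux a : `|a - z| < d4 -> `|a - G x| < r /\ `|Z a - Z z| < d3.
    rewrite lt_min => /andP[ha1 ha2].
    have ha : `|a - G x| < r.
      by rewrite -(subrKA z); apply: le_lt_trans (ler_normD _ _) _; rewrite -ltrBrDr.
    split => //; apply: le_lt_trans (Zlip _ _ ha hz) _.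
    by rewrite mulrC -ltr_pdivlMr// mulr_gt0.
  exists d4 => // a b /aux[ha1 ha2] /aux[hb1 hb2].
  have := h3 _ _ ha2 hb2; rewrite (hZ _ ha1).2 (hZ _ hb1).2 => h.
  have -> : Z a - Z b - invmx (J (Z z)) *m (a - b) =
     - (invmx (J (Z z)) *m (a - b - J (Z z) *m (Z a - Z b))).
    by rewrite [in RHS]mulmxBr mulKmx// opprB.
  rewrite normrN; apply: le_trans (hK _) _; rewrite mulrC -ler_pdivlMr//.
  apply: le_trans h _.
  apply: (@le_trans _ _ (e / K / (2 * CA) * (2 * CA * `|a - b|))).
    by rewrite ler_pM2l//; exact: Zlip.
  by rewrite mulrA divfK ?gt_eqF ?mulr_gt0// mulrAC.
- move=> y; rewrite !lt_min => /and3P[y1 y2 y3].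
  have Gy : `|G y - G x| < r.
    apply: le_lt_trans (Glip _ _ y2 (xx _ d20)) _.
    by rewrite mulrC -ltr_pdivlMr.
  by split => //; [exact: lt_trans y1 r0d0|apply: ZG => //; exact: ltW].
Qed.

(** A level set of [f] is open and closed in [D]. An arbitrary codomain lets truth values, matrices
    and numbers be treated alike. *)
Lemma locally_constant_connected (U : normedModType R) (T : Type) (D : set U) (f : U -> T) :
  open D -> connected D ->
  (forall x, D x -> exists2 d : R, 0 < d & forall y, `|y - x| < d -> D y -> f y = f x) ->
  forall x y, D x -> D y -> f x = f y.
Proof.
move=> Do Dc h x y Dx Dy.
pose B := D `&` [set z | f z = f x].
have opn (C : set T) : open (D `&` [set z | C (f z)]).
  rewrite openE => z [Dz Cz]; have [d d0 hd] := h z Dz.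
  have [d' d'0 hD] : exists2 d : R, 0 < d & forall y, `|y - z| < d -> D y.
    by apply/nearE_dist; apply: open_nbhs_nbhs.
  apply/nearE_dist; exists (Num.min d d'); first by rewrite lt_min d0.
  by move=> w; rewrite lt_min => /andP[w1 w2]; split => /=; [exact: hD|rewrite hd//; exact: hD].
have /Dc BD : B !=set0 by exists x.
have : B = D.
  apply: BD; first by exists B => //; [exact: opn (eq^~ (f x))|rewrite /B setIA setIid].
  exists (~` (D `&` [set z | f z <> f x])); first by apply: open_closedC; exact: opn (fun t => t <> f x).
  rewrite /B; apply/seteqP; split => z [Dz /= hz]; split => //.
    by case.
  by apply: contrapT => k; apply: hz.
by move=> /seteqP[_ /(_ y Dy)[]].
Qed.

Lemma open_dist (U : normedModType R) (D : set U) x : open D -> D x ->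
  exists2 d : R, 0 < d & forall y, `|y - x| < d -> D y.
Proof. by move=> Do Dx; apply/nearE_dist; exact: open_nbhs_nbhs. Qed.

End InverseFunction2.

(** * Developable maps *)

Section Developability.
Variable R : realType.

Lemma mulmx_cV_inj m n (A B : 'M[R]_(m, n)) :
  (forall v : 'cV[R]_n, A *m v = B *m v) -> A = B.
Proof.
by move=> h; apply: trmx_inj; apply/row_matrixP => j; rewrite -!tr_col !colE h.
Qed.

Lemma sdiff_mulmx_uniq m n (f : 'cV[R]_n -> 'cV[R]_m) x (A B : 'M[R]_(m, n)) :
  sdiff f x (mulmx A) -> sdiff f x (mulmx B) -> A = B.
Proof.
move=> hA hB; apply: mulmx_cV_inj => v.
exact: (sdiff_uniq (lbounded_mulmx 1 A).1 (lbounded_mulmx 1 B).1 hA hB v).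
Qed.

Lemma sdiff_comp_mulmx l m n (g : 'cV[R]_m -> 'cV[R]_l) (f : 'cV[R]_n -> 'cV[R]_m) x A B :
  sdiff g (f x) (mulmx A) -> sdiff f x (mulmx B) ->
  sdiff (fun y => g (f y)) x (mulmx (A *m B)).
Proof.
move=> hg hf; have := sdiff_comp (lbounded_mulmx 1 B) (lbounded_mulmx 1 A) hf hg.
by apply: sdiff_eqL => v; rewrite /= mulmxA.
Qed.

Lemma sdiffD_mulmx m n (f g : 'cV[R]_n -> 'cV[R]_m) x A B :
  sdiff f x (mulmx A) -> sdiff g x (mulmx B) ->
  sdiff (fun y => f y + g y) x (mulmx (A + B)).
Proof.
by move=> hf hg; have := sdiffD hf hg; apply: sdiff_eqL => v; rewrite mulmxDl.
Qed.

Lemma sdiffB_mulmx m n (f g : 'cV[R]_n -> 'cV[R]_m) x A B :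
  sdiff f x (mulmx A) -> sdiff g x (mulmx B) ->
  sdiff (fun y => f y - g y) x (mulmx (A - B)).
Proof.
by move=> hf hg; have := sdiffB hf hg; apply: sdiff_eqL => v; rewrite mulmxBl.
Qed.

Lemma sdiff_mulmxl m n (A : 'M[R]_(m, n)) x : sdiff (mulmx A : 'cV[R]_n -> 'cV[R]_m) x (mulmx A).
Proof. by apply: sdiff_lin; exact: (lbounded_mulmx 1 A).1. Qed.

Lemma sdiff_id n (x : 'cV[R]_n) : sdiff (fun y : 'cV[R]_n => y) x (mulmx 1%:M).
Proof.
by apply: sdiff_near (sdiff_mulmxl 1%:M x); exists 1 => // y _; rewrite mul1mx.
Qed.

Lemma sdiff_translate n (v : 'cV[R]_n) x : sdiff (fun y : 'cV[R]_n => y + v) x (mulmx 1%:M).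
Proof.
have h := sdiffD (sdiff_mulmxl 1%:M x) (sdiff_cst v x).
have {}h : sdiff (fun y : 'cV[R]_n => 1%:M *m y + v) x (mulmx 1%:M).
  by apply: sdiff_eqL h => w; rewrite addr0.
by apply: sdiff_near h; exists 1 => // y _; rewrite mul1mx.
Qed.

(** The Jacobian may vary along the segment; only its value on [v] has to be constant. The mean
    value theorem can then be used coordinate by coordinate, although the intermediate points
    differ. *)
Lemma line_increment m n (f : 'cV[R]_n -> 'cV[R]_m) p v c :
  (forall s : R, 0 <= s <= 1 -> exists2 J : 'M[R]_(m, n), sdiff f (p + s *: v) (mulmx J) & J *m v = c) ->
  f (p + v) = f p + c.
Proof.
move=> h; apply/matrixP => i j; rewrite (ord1 j) mxE.
have [|s _ e] := @mvt_line R 'cV[R]_n (fun y => f y i 0) p v (fun=> c i 0).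
  move=> s /h[J fJ Jv]; exists (fun w => (J *m w) i 0); split; last by rewrite Jv.
  - split; first by move=> a w w'; rewrite mulmxDr -scalemxAr !mxE.
    have [C C0 hC] := mulmx_bound 1 J; exists C => // w; apply: le_trans (hC w).
    exact: le_mx_norm.
  - exact: sdiff_coord fJ.
by rewrite -e addrC subrK.
Qed.

Lemma unit_near1 n (Q : 'M[R]_n) (c : R) : c < 1 ->
  (forall v : 'cV[R]_n, `|(Q - 1%:M) *m v| <= c * `|v|) -> Q \in unitmx.
Proof.
move=> c1 h; apply: unitmx_inj => v Qv; have := h v.
rewrite mulmxBl Qv mul1mx sub0r normrN => {}h; apply/eqP; rewrite -normr_le0.
have := normr_ge0 v; nra.
Qed.

Section Algebra.
Variables (n : nat) (Pi S T E : 'M[R]_n).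
Hypotheses (PiT : Pi^T = Pi) (PiPi : Pi *m Pi = Pi) (ST : S^T = S).
Let J := Pi + (1%:M - Pi) *m S.
Hypotheses (JT : J *m T = 1%:M) (TJ : T *m J = 1%:M) (SE : S *m E = 0)
  (Qu : Pi *m E *m Pi + (1%:M - Pi) \in unitmx).

(** [J *m E = Pi *m E] because [S *m E = 0], so [T] sends the image of [Pi *m E] into that of [E],
    which [S] kills; by [Qu] this image fills that of [Pi]. Since [S *m T] is the Jacobian of [Phi]
    in the chart inverse to [G], there [Phi] does not depend on the [Pi] directions. *)
Lemma developable_STPi : S *m T *m Pi = 0.
Proof.
have JE : J *m E = Pi *m E.
  by rewrite /J (mulmxDl Pi) -mulmxA SE mulmx0 addr0.
have TPE : T *m (Pi *m E) = E by rewrite -JE mulmxA TJ mul1mx.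
have e0 : S *m T *m Pi *m (Pi *m E *m Pi) = 0.
  by rewrite -!mulmxA (mulmxA Pi Pi) PiPi (mulmxA Pi E Pi) (mulmxA T) TPE mulmxA SE mul0mx.
have e1 : S *m T *m Pi *m (1%:M - Pi) = 0.
  by rewrite mulmxBr mulmx1 -(mulmxA _ Pi Pi) PiPi subrr.
by apply: (can_inj (mulmxK Qu)); rewrite mul0mx mulmxDr e0 e1 addr0.
Qed.

Lemma developable_PiT : Pi *m T = Pi.
Proof.
have PJ : Pi *m J = Pi by rewrite /J mulmxDr PiPi mulmxA mulmxBr mulmx1 PiPi subrr mul0mx addr0.
by rewrite -[in LHS]PJ -mulmxA JT mulmx1.
Qed.

(** The symmetry of [S] enters here: it makes [T *m Pi] a function of [S *m T], so constancy of the
    latter along a direction passes to the former. *)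
Lemma developable_TPi : T *m Pi = Pi - (Pi *m (S *m T))^T.
Proof.
have e1 : T^T *m S *m (1%:M - Pi) = 1%:M - Pi.
  have : T^T *m J^T = 1%:M by rewrite -trmx_mul JT trmx1.
  rewrite /J linearD /= trmx_mul linearB /= trmx1 PiT ST (mulmxDr T^T) mulmxA => /eqP.
  rewrite [X in X == _]addrC eq_sym -subr_eq => /eqP <-.
  by rewrite -[X in T^T *m X]PiT -trmx_mul developable_PiT PiT.
have e2 : T *m Pi = Pi + (1%:M - Pi) *m (T *m Pi).
  by rewrite mulmxBl mul1mx mulmxA developable_PiT PiPi addrC subrK.
have e3 : T^T *m S *m Pi + (1%:M - Pi) *m (T *m Pi) = 0.
  rewrite -[X in _ + X *m _]e1 -[T^T *m S *m _ *m _]mulmxA -mulmxDr.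
  by rewrite -e2 -!mulmxA (mulmxA S) developable_STPi mulmx0.
rewrite {1}e2; congr (_ + _); rewrite !trmx_mul ST PiT.
by apply/eqP; rewrite -addr_eq0 addrC e3.
Qed.
End Algebra.

Lemma unit_near_proj n (Pi : 'M[R]_n) (E : 'cV[R]_n -> 'M[R]_n) x :
  Pi *m Pi = Pi -> E x = Pi -> {for x, continuous E} ->
  exists2 d : R, 0 < d & forall y, `|y - x| < d ->
    Pi *m E y *m Pi + (1%:M - Pi) \in unitmx.
Proof.
move=> PiPi Ex /continuousE_dist cE.
have [C C0 hC] := mulmx_bound 1 Pi.
(* With this [c] the compression of [E y - Pi] by [Pi] has operator norm at most 1/2. *)
pose c := (2 * C * C * n.+1%:R)^-1 : R.
have c0 : 0 < c by rewrite invr_gt0 !mulr_gt0.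
have [d d0 h] := cE c c0; exists d => // y /h hy.
apply: (@unit_near1 _ _ (2^-1)); first by lra.
move=> v.
have -> : Pi *m E y *m Pi + (1%:M - Pi) - 1%:M = Pi *m (E y - Pi) *m Pi.
  by rewrite mulmxBr mulmxBl PiPi PiPi -addrA; congr (_ + _); rewrite addrAC subrr sub0r.
rewrite -!mulmxA; apply: le_trans (hC _) _.
apply: (@le_trans _ _ (C * (n%:R * c * (C * `|v|)))).
  rewrite ler_pM2l//; apply: le_trans (mx_normM _ _) _.
  rewrite Ex in hy; by apply: ler_pM => //; exact: ler_wpM2l.
have -> : C * (n%:R * c * (C * `|v|)) = (C * C * n%:R * c) * `|v| by ring.
rewrite ler_wpM2r//; apply: (@le_trans _ _ (C * C * n.+1%:R * c)).
  by rewrite ler_pM2r// ler_pM2l ?mulr_gt0// ler_nat.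
have : 2 * C * C * n.+1%:R * c = 1 by rewrite /c divff// gt_eqF// !mulr_gt0.
lra.
Qed.

(* Hartman-Nirenberg in C^1 form: a symmetric Jacobian of constant rank is
   constant along the affine pieces parallel to its kernel, and the inverse of
   its nondegenerate part is affine along them. *)
Lemma developable n (Phi : 'cV[R]_n -> 'cV[R]_n) (S E : 'cV[R]_n -> 'M[R]_n)
    (Pi : 'M[R]_n) x (d0 : R) : 0 < d0 ->
  (forall y, `|y - x| < d0 ->
     [/\ sdiff Phi y (mulmx (S y)), (S y)^T = S y & S y *m E y = 0]) ->
  {for x, continuous E} -> E x = Pi ->
  Pi^T = Pi -> Pi *m Pi = Pi -> S x *m Pi = 0 -> Pi + S x \in unitmx ->
  exists2 d : R, 0 < d &
    (forall y v, `|y - x| < d -> `|v| < d -> Pi *m v = v -> S y *m Pi = 0 ->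
       Phi (y + v) = Phi y /\ S (y + v) *m Pi = 0) /\
    (forall v, `|v| < d -> Pi *m v = v ->
       [/\ Pi + S (x + v) \in unitmx, Pi + S (x - v) \in unitmx &
        invmx (Pi + S (x + v)) + invmx (Pi + S (x - v)) = invmx (Pi + S x) *+ 2]).
Proof.
move=> d00 hS cE Ex PiT PiPi SPi uPS.
(* A chart that keeps the coordinates along the kernel and replaces the others by those of [Phi].
   Its Jacobian at [x] is [Pi + S x]. *)
pose G y := Pi *m y + (1%:M - Pi) *m Phi y.
pose J y := Pi + (1%:M - Pi) *m S y.
have JE y : (S y)^T = S y -> S y *m Pi = 0 -> J y = Pi + S y.
  move=> sy sp; rewrite /J mulmxBl mul1mx.
  have -> : Pi *m S y = 0 by apply: trmx_inj; rewrite trmx_mul sy PiT sp trmx0.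
  by rewrite subr0.
have xx (e : R) : 0 < e -> `|x - x| < e by rewrite subrr normr0.
have [_ Sx _] := hS x (xx _ d00).
have [dq dq0 hq] := unit_near_proj PiPi Ex cE.
pose d1 := Num.min d0 dq.
have d10 : 0 < d1 by rewrite lt_min d00.
have hG y : `|y - x| < d1 -> sdiff G y (mulmx (J y)).
  rewrite lt_min => /andP[/hS[hP _ _] _].
  apply: sdiffD_mulmx; first exact: sdiff_mulmxl.
  by apply: (sdiff_comp_mulmx (g := mulmx (1%:M - Pi)) _ hP); exact: sdiff_mulmxl.
have Jx : J x \in unitmx by rewrite JE.
have [Z [r [d2 [r0 d20 hZ hd2]]]] := inverse_function d10 hG Jx.
pose T z := invmx (J (Z z)).
have facts z : `|z - G x| < r ->
    [/\ S (Z z) *m T z *m Pi = 0, T z *m Pi = Pi - (Pi *m (S (Z z) *m T z))^T,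
        sdiff Z z (mulmx (T z)) & sdiff (fun z => Phi (Z z)) z (mulmx (S (Z z) *m T z))].
  move=> /hZ[hz Gz uJ sZ]; have := hz; rewrite lt_min => /andP[/hS[hP sS SE] /hq uQ].
  have JT : J (Z z) *m T z = 1%:M by exact: mulmxV.
  have TJ : T z *m J (Z z) = 1%:M by exact: mulVmx.
  split=> //; last exact: sdiff_comp_mulmx.
    exact: (developable_STPi PiPi TJ SE uQ).
  exact: (developable_TPi PiT PiPi sS JT TJ SE uQ).
have seg z v (s : R) : `|z - G x| < r / 2 -> `|v| < r / 2 -> 0 <= s <= 1 ->
    `|z + s *: v - G x| < r.
  move=> hz hv /andP[s0 s1]; rewrite addrAC; apply: le_lt_trans (ler_normD _ _) _.
  rewrite normrZ ger0_norm//; have := normr_ge0 v; nra.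
have PhiZ z v : `|z - G x| < r / 2 -> `|v| < r / 2 -> Pi *m v = v ->
    Phi (Z (z + v)) = Phi (Z z).
  move=> hz hv Pv; rewrite -[RHS]addr0.
  apply: (@line_increment _ _ (fun z => Phi (Z z))) => s s01.
  have [e1 _ _ e2] := facts _ (seg z v s hz hv s01).
  by exists (S (Z (z + s *: v)) *m T (z + s *: v)) => //; rewrite -[X in _ *m X = _]Pv mulmxA e1 mul0mx.
have one z v : `|z - G x| < r / 2 -> `|v| < r / 2 -> `|z + v - G x| < r.
  by move=> hz hv; have := seg z v 1 hz hv; rewrite scale1r; apply; rewrite ler01 lexx.
have zro z : `|z - G x| < r / 2 -> `|z - G x| < r by move=> h; lra.
(* The constancy of [Phi \o Z] under translation by [v] holds for all nearby [z], hence may be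
   differentiated in [z]. *)
have STc z v : `|z - G x| < r / 2 -> `|v| < r / 2 -> Pi *m v = v ->
    S (Z (z + v)) *m T (z + v) = S (Z z) *m T z.
  move=> hz hv Pv; have [_ _ _ e1] := facts _ (one z v hz hv).
  have [_ _ _ e2] := facts _ (zro z hz).
  have e3 := sdiff_comp_mulmx (f := fun z => z + v) e1 (sdiff_translate v z).
  rewrite mulmx1 in e3; apply: sdiff_mulmx_uniq _ e2.
  apply: sdiff_near e3; exists (r / 2 - `|z - G x|); first by rewrite subr_gt0.
  move=> y hy; apply: PhiZ => //; rewrite -(subrKA z).
  by apply: le_lt_trans (ler_normD _ _) _; rewrite -ltrBrDr.
(* This makes the derivative of [Z] in the [Pi] directions constant along them, so [Z] is affine
   there. *)
have TPc z v : `|z - G x| < r / 2 -> `|v| < r / 2 -> Pi *m v = v ->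
    T (z + v) *m Pi = T z *m Pi.
  move=> hz hv Pv; have [_ -> _ _] := facts _ (one z v hz hv).
  by have [_ -> _ _] := facts _ (zro z hz); rewrite STc.
have Zaff z v : `|z - G x| < r / 2 -> `|v| < r / 2 -> Pi *m v = v ->
    Z (z + v) = Z z + T z *m v.
  move=> hz hv Pv; apply: line_increment => s s01.
  have [_ _ e1 _] := facts _ (seg z v s hz hv s01).
  exists (T (z + s *: v)) => //; rewrite -[X in _ *m X = _]Pv mulmxA TPc//.
  - by rewrite -mulmxA Pv.
  - move: s01 => /andP[s0 s1]; rewrite normrZ ger0_norm//.
    by apply: le_lt_trans hv; rewrite ler_piMl.
  - by rewrite -scalemxAr Pv.
have [C [d3 [C0 d30 Glip]]] := sdiff_lip (lbounded_mulmx 1 (J x)) (hG _ (xx _ d10)).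
pose d := Num.min (Num.min d2 d3) (Num.min (r / 2 / C) (r / 4)).
have dpos : 0 < d by rewrite !lt_min d20 d30 !divr_gt0.
have dG y : `|y - x| < d -> [/\ `|G y - G x| < r / 2, Z (G y) = y & `|y - x| < d0].
  rewrite !lt_min => /andP[/andP[y2 y3] /andP[y4 _]].
  have [y0 _ ZG] := hd2 y y2; split => //.
    apply: le_lt_trans (Glip _ _ y3 (xx _ d30)) _.
    by rewrite mulrC -ltr_pdivlMr.
  by move: y0; rewrite lt_min => /andP[].
exists d => //; split.
  move=> y v hy hv Pv Sy.
  have vr : `|v| < r / 2.
    by move: hv; rewrite !lt_min => /andP[_ /andP[_]] ?; lra.
  have [Gy ZGy yd0] := dG y hy.
  have [_ symS _] := hS y yd0.
  have [_ _ uJ _] := hZ _ (zro _ Gy).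
  (* Where [S y] kills [Pi], the chart does not turn the direction [v]: the affine piece through [y]
     is [y + v]. *)
  have TPi : T (G y) *m Pi = Pi.
    rewrite /T ZGy -[in LHS](_ : J y *m Pi = Pi); last by rewrite JE// mulmxDl PiPi Sy addr0.
    by rewrite mulKmx// -ZGy.
  have Zyv : Z (G y + v) = y + v by rewrite Zaff// ZGy -[X in _ *m X]Pv mulmxA TPi Pv.
  split; first by rewrite -Zyv PhiZ// ZGy.
  have [e1 _ _ _] := facts _ (one _ v Gy vr).
  by rewrite -Zyv -TPi -(TPc _ v Gy vr Pv) mulmxA.
move=> v hv Pv.
have hG0 : `|G x - G x| < r / 2 by rewrite subrr normr0 divr_gt0.
have [_ ZGx _] := dG x (xx _ dpos).
have vr : `|v| < r / 4 by move: hv; rewrite !lt_min => /andP[_ /andP[_]].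
have TPi : T (G x) *m Pi = Pi.
  rewrite /T ZGx -[in LHS](_ : J x *m Pi = Pi); last by rewrite JE// mulmxDl PiPi SPi addr0.
  by rewrite mulKmx.
have key w : `|w| < r / 4 -> Pi *m w = w ->
    Pi + S (x + w) \in unitmx /\ T (G x + w) = invmx (Pi + S (x + w)).
  move=> hw Pw; have hw2 : `|w| < r / 2 by lra.
  have Zw : Z (G x + w) = x + w by rewrite Zaff// ZGx -[X in _ *m X]Pw mulmxA TPi Pw.
  have [hz _ uJ _] := hZ _ (one _ _ hG0 hw2).
  have [e1 _ _ _] := facts _ (one _ _ hG0 hw2).
  have Sw : S (x + w) *m Pi = 0 by rewrite -Zw -TPi -(TPc _ w hG0 hw2 Pw) mulmxA.
  rewrite Zw in uJ hz; move: hz; rewrite lt_min => /andP[/hS[_ symS _] _].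
  by rewrite /T Zw; rewrite JE// in uJ *.
have PNv : Pi *m (- v) = - v by rewrite mulmxN Pv.
have vrN : `|- v| < r / 4 by rewrite normrN.
have [u1 T1] := key _ vr Pv; have [u2 T2] := key _ vrN PNv.
have n0 : `|0 : 'cV[R]_n| < r / 4 by rewrite normr0 divr_gt0.
have [_ T0] := key 0 n0 (mulmx0 _ _); rewrite !addr0 in T0.
split => //; rewrite -T1 -T2 -T0.
have v2 : `|v| < r / 2 by lra.
have v2N : `|- v| < r / 2 by rewrite normrN.
have [_ _ e0 _] := facts _ (zro _ hG0).
have [_ _ e1 _] := facts _ (one _ _ hG0 v2).
have [_ _ e2 _] := facts _ (one _ _ hG0 v2N).
have e3 := sdiff_comp_mulmx (f := fun z => z + v) e1 (sdiff_translate v (G x)).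
have e4 := sdiff_comp_mulmx (f := fun z => z - v) e2 (sdiff_translate (- v) (G x)).
rewrite !mulmx1 in e3 e4.
(* Affinity gives [Z (z + v) + Z (z - v) = 2 * Z z] for [z] near [G x]; its Jacobians at [G x] form
   the claimed relation between the inverses. *)
apply: sdiff_mulmx_uniq (sdiffD_mulmx e3 e4) _.
rewrite mulr2n; apply: sdiff_near (sdiffD_mulmx e0 e0).
exists (r / 4); first by rewrite divr_gt0.
move=> z hz; have hz2 : `|z - G x| < r / 2 by lra.
rewrite !Zaff// mulmxN; apply/matrixP => i j; rewrite !mxE; ring.
Qed.

End Developability.

(** * Unit gradient fields *)

Section MoreCalculus.
Variable R : realType.

Lemma sdiff_sum (U : normedModType R) (I : finType) (f L : I -> U -> R) x :
  (forall i, sdiff (f i : U -> R^o) x (L i)) ->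
  sdiff ((fun y => \sum_i f i y) : U -> R^o) x (fun v => \sum_i L i v).
Proof.
move=> h; elim: (index_enum I) => [|i r ih].
  move=> e e0; exists 1 => // y z _ _.
  by rewrite !big_nil !subr0 normr0 mulr_ge0// ltW.
have hs := sdiffD (h i) ih.
have {}hs : sdiff ((fun y => f i y + \sum_(j <- r) f j y) : U -> R^o) x
   (fun v => \sum_(j <- i :: r) L j v).
  by apply: sdiff_eqL hs => v; rewrite big_cons.
by apply: sdiff_near hs; exists 1 => // y _; rewrite big_cons.
Qed.

Lemma lbounded_coord m n (J : 'M[R]_(m, n)) i :
  lbounded ((fun v : 'cV[R]_n => (J *m v) i 0) : 'cV[R]_n -> R^o).
Proof.
split; first by move=> a b c; rewrite mulmxDr -scalemxAr !mxE.
have [C C0 hC] := mulmx_bound 1 J; exists C => // b; apply: le_trans (hC b).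
exact: le_mx_norm.
Qed.

Lemma sdiff_sqnorm m n (f : 'cV[R]_n -> 'cV[R]_m) x J : sdiff f x (mulmx J) ->
  sdiff ((fun y => \sum_i f y i 0 ^+ 2) : 'cV[R]_n -> R^o) x (rowlin ((f x)^T *m J *+ 2)).
Proof.
move=> hf.
have d k : sdiff ((fun y => f y k 0 * f y k 0) : 'cV[R]_n -> R^o) x
    (fun v => (J *m v) k 0 * f x k 0 + f x k 0 * (J *m v) k 0).
  by apply: sdiffM; [exact: lbounded_coord|exact: lbounded_coord|exact: sdiff_coord hf|exact: sdiff_coord hf].
have := sdiff_sum d; apply: sdiff_eqL => v.
rewrite /rowlin mulr2n mulmxDl mxE -mulmxA !mxE big_split /=.
by congr (_ + _); apply: eq_bigr => k _; rewrite [in RHS]mxE// mulrC.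
Qed.

(** The integrating factor [expR (- C * s)] makes the product nonincreasing, so the mean value
    theorem suffices. *)
Lemma gronwall01 (g dg : R -> R) (C : R) :
  (forall s : R, 0 <= s <= 1 -> is_derive s (1 : R) g (dg s)) ->
  (forall s : R, 0 <= s <= 1 -> dg s <= C * g s) -> g 0 = 0 -> 0 <= g 1 -> g 1 = 0.
Proof.
move=> h hle g0 g1.
have [|s s01] := @mvt01 R (fun s => expR (- C * s) * g s)
   (fun s => expR (- C * s) * dg s + g s * (expR (- C * s) * (- C))).
  move=> s s01; have gd := h s s01.
  have e1 : is_derive s (1 : R) (fun s : R => - C * s) (- C).
    have : is_derive s (1 : R) (fun s : R => - C * s) (- C *: 1) by exact: is_deriveZ.
    by rewrite [- C *: 1]mulr1.
  have e2 : is_derive s (1 : R) (fun s => expR (- C * s)) (expR (- C * s) * (- C)).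
    exact: (@is_derive1_comp _ (@expR R) (fun s => - C * s) s).
  exact: (@is_deriveM _ _ (fun s => expR (- C * s)) g).
rewrite g0 !mulr0 subr0 mulr1 => e; apply/eqP; rewrite eq_le g1 andbT.
rewrite -(pmulr_rle0 _ (expR_gt0 (- C))) e.
rewrite (_ : _ + _ = expR (- C * s) * (dg s - C * g s)); last by ring.
by rewrite pmulr_rle0 ?expR_gt0// subr_le0 hle.
Qed.

End MoreCalculus.

(* A C^1 unit field [nu] which is the gradient of [w]; its Jacobian [H] is the
   Hessian of [w], whose trace is assumed to be constant on the levels of [w]. *)
Record eikonal (R : realType) (n : nat) (Omega : set 'cV[R]_n) (w : 'cV[R]_n -> R)
    (nu : 'cV[R]_n -> 'cV[R]_n) (H : 'cV[R]_n -> 'M[R]_n) : Prop := Eikonal {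
  eik_open : open Omega;
  eik_w : forall x, Omega x -> sdiff (w : 'cV[R]_n -> R^o) x (rowlin (nu x)^T);
  eik_nu : forall x, Omega x -> sdiff nu x (mulmx (H x));
  eik_sym : forall x, Omega x -> (H x)^T = H x;
  eik_unit : forall x, Omega x -> (nu x)^T *m nu x = 1%:M;
  eik_tr : forall x y, Omega x -> Omega y -> w x = w y -> \tr (H x) = \tr (H y) }.

Section Eikonal.
Variables (R : realType) (n : nat) (Omega : set 'cV[R]_n.+1).
Variables (w : 'cV[R]_n.+1 -> R) (nu : 'cV[R]_n.+1 -> 'cV[R]_n.+1)
  (H : 'cV[R]_n.+1 -> 'M[R]_n.+1).
Hypothesis eik : eikonal Omega w nu H.
Let Omega_open := eik_open eik.
Let hw := eik_w eik.
Let hnu := eik_nu eik.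
Let hsym := eik_sym eik.
Let hunit := eik_unit eik.

Lemma nu_sqr x : Omega x -> \sum_i nu x i 0 ^+ 2 = 1.
Proof.
move=> Ox; have e : ((nu x)^T *m nu x) 0 0 = 1 by rewrite hunit// mxE eqxx.
rewrite -[RHS]e mxE; by apply: eq_bigr => i _; rewrite mxE expr2.
Qed.

(** Differentiating [|nu|^2 = 1] gives [(nu x)^T *m H x = 0]; symmetry moves [nu] to the other
    side. *)
Lemma hessian_nu x : Omega x -> H x *m nu x = 0.
Proof.
move=> Ox.
suff h : (nu x)^T *m H x = 0.
  by apply: trmx_inj; rewrite trmx_mul hsym// h trmx0.
have [r r0 hr] := open_dist Omega_open Ox.
have d0 : sdiff ((fun y => \sum_k nu y k 0 ^+ 2) : 'cV[R]_n.+1 -> R^o) x (rowlin 0).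
  apply: sdiff_near; last first.
    by apply: sdiff_eqL (sdiff_cst (1 : R^o) x) => v; rewrite /rowlin mul0mx mxE.
  by exists r => // y /hr Oy; rewrite nu_sqr.
have := sdiff_uniq (lbounded_rowlin _).1 (lbounded_rowlin _).1 (sdiff_sqnorm (hnu Ox)) d0.
move=> e; apply: mulmx_cV_inj => v; rewrite mul0mx; apply/matrixP => i j.
have := e v; rewrite (ord1 i) (ord1 j) /rowlin mulr2n mulmxDl mul0mx !mxE.
lra.
Qed.

Lemma nu_norm x : Omega x -> `|nu x| <= 1.
Proof.
move=> Ox; apply: mx_norm_le => // i j; rewrite (ord1 j).
have : `|nu x i 0| ^+ 2 <= 1 ^+ 2.
  rewrite expr1n -(nu_sqr Ox) real_normK ?num_real// (bigD1 i)//= lerDl.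
  by apply: sumr_ge0 => k _; rewrite sqr_ge0.
by rewrite ler_sqr// nnegrE.
Qed.

Lemma H_continuous x : Omega x -> {for x, continuous H}.
Proof.
move=> Ox; apply: (@jacobian_continuous _ _ _ nu).
by have [d d0 h] := open_dist Omega_open Ox; exists d => // y /h/hnu.
Qed.

(** No integral curve is constructed. On the straight segment from [y] in direction [nu y], the
    defect [ph z = nu z - nu y] satisfies [H z *m nu y = - (H z *m ph z)], since [H z] kills [nu z].
    So [|ph|^2] obeys a linear differential inequality with initial value 0. Then [w] grows at unit
    rate because its gradient is the direction of the line. *)
Lemma nu_line x : Omega x -> exists2 d : R, 0 < d & forall y t, `|y - x| < d -> `|t| < d ->
  [/\ Omega y, Omega (y + t *: nu y), nu (y + t *: nu y) = nu y &
   w (y + t *: nu y) = w y + t].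
Proof.
move=> Ox; have [d1 d10 hO] := open_dist Omega_open Ox.
have /continuousE_dist/(_ 1 ltr01)[d2 d20 hH] := H_continuous Ox.
pose K := `|H x| + 1.
pose d := Num.min d1 d2 / 2.
have m0 : 0 < Num.min d1 d2 by rewrite lt_min d10.
suff main (y : 'cV[R]_n.+1) (t : R) : `|y - x| < d -> `|t| < d ->
    [/\ Omega y, Omega (y + t *: nu y) & nu (y + t *: nu y) = nu y].
  exists d => [|y t hy ht]; first by rewrite divr_gt0.
  have [Oy Oyt e] := main y t hy ht; split => //.
  have [|s s01 ws] := @mvt_line R _ w y (t *: nu y) (fun=> t).
    move=> s /andP[s0 s1].
    have hst : `|s * t| < d by rewrite normrM ger0_norm//; apply: le_lt_trans ht; rewrite ler_piMl.
    have [_ Oz ez] := main y (s * t) hy hst; rewrite -scalerA in Oz ez.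
    exists (rowlin (nu (y + s *: (t *: nu y)))^T); split.
    - exact: lbounded_rowlin.
    - exact: hw.
    - by rewrite ez /rowlin -scalemxAr hunit// !mxE eqxx mulr1.
  by apply/eqP; rewrite [X in _ == X]addrC -subr_eq ws.
move=> hy ht; have hm : d + d = Num.min d1 d2 by rewrite /d; lra.
have dp : 0 < d by rewrite divr_gt0.
have yO : Omega y.
  apply: hO; apply: lt_le_trans hy _.
  have h1 : d + d <= d1 by rewrite hm ge_min lexx.
  lra.
have near (s : R) : 0 <= s <= 1 -> Omega (y + s *: (t *: nu y)) /\ `|H (y + s *: (t *: nu y))| <= K.
  move=> /andP[s0 s1].
  have hz : `|y + s *: (t *: nu y) - x| < d + d.
    rewrite addrAC; apply: le_lt_trans (ler_normD _ _) _; rewrite ltr_leD//.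
    rewrite !normrZ ger0_norm//; apply: le_trans (ltW ht).
    have := nu_norm yO; have := normr_ge0 t; have := normr_ge0 (nu y) => a1 a2 a3.
    apply: (@le_trans _ _ (1 * (`|t| * 1))); last by rewrite mulr1 mul1r.
    by apply: ler_pM => //; apply: ler_pM.
  split; first by apply: hO; apply: lt_le_trans hz _; rewrite hm ge_min lexx.
  have := hH (y + s *: (t *: nu y)); rewrite /K => /(_ _) h.
  have {}h : `|H (y + s *: (t *: nu y)) - H x| <= 1.
    by apply: h; apply: lt_le_trans hz _; rewrite hm ge_min lexx orbT.
  rewrite -[X in `|X| <= _](subrK (H x)) addrC.
  by apply: le_trans (ler_normD _ _) _; rewrite lerD2l.
pose ph z : 'cV[R]_n.+1 := nu z - nu y.
pose g s := \sum_i ph (y + s *: (t *: nu y)) i 0 ^+ 2.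
pose dg s := rowlin ((ph (y + s *: (t *: nu y)))^T *m H (y + s *: (t *: nu y)) *+ 2) (t *: nu y).
have gd (s : R) : 0 <= s <= 1 -> is_derive s (1 : R) g (dg s).
  move=> /near[Oz _]; apply: (@is_derive_line _ _ (fun z => \sum_i ph z i 0 ^+ 2)).
    exact: lbounded_rowlin.
  apply: sdiff_sqnorm.
  have := sdiffB (hnu Oz) (sdiff_cst (nu y) (y + s *: (t *: nu y))).
  by apply: sdiff_eqL => v; rewrite subr0.
have gle (s : R) : 0 <= s <= 1 -> dg s <= 2 * d * n.+1%:R * (n.+1%:R * K) * g s.
  move=> /near[Oz hK]; rewrite /dg /g; set z := y + s *: (t *: nu y) in Oz hK *.
  have E1 : H z *m nu y = - (H z *m ph z) by rewrite /ph mulmxBr hessian_nu// sub0r opprK.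
  rewrite /rowlin mulr2n mulmxDl mxE -mulmxA -scalemxAr E1.
  have -> : (ph z)^T *m (t *: - (H z *m ph z)) = - t *: ((ph z)^T *m (H z *m ph z)).
    by rewrite scalerN -scaleNr -scalemxAr.
  have q0 : 0 <= \sum_i ph z i 0 ^+ 2 by apply: sumr_ge0 => i _; rewrite sqr_ge0.
  have nph : `|ph z| ^+ 2 <= \sum_i ph z i 0 ^+ 2.
    have [z0|ne0] := eqVneq `|ph z| 0; first by rewrite z0 expr0n.
    have [[i j] /= e] := mx_norm_neq0 ne0; rewrite (ord1 j) in e.
    rewrite -[`|ph z|]/(mx_norm (ph z)) e.
    rewrite real_normK ?num_real// (bigD1 i)//= lerDl.
    by apply: sumr_ge0 => k _; rewrite sqr_ge0.
  have bd : `|((ph z)^T *m (H z *m ph z)) 0 0| <= n.+1%:R * (n.+1%:R * K) * \sum_i ph z i 0 ^+ 2.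
    apply: le_trans (le_mx_norm _ _ _) _; apply: le_trans (mx_normM _ _) _.
    have -> : `|(ph z)^T| = `|ph z|.
      apply/eqP; rewrite eq_le; apply/andP; split; apply: mx_norm_le => // i j.
        by rewrite mxE; exact: le_mx_norm.
      by have := le_mx_norm (ph z)^T j i; rewrite mxE.
    apply: (@le_trans _ _ (n.+1%:R * `|ph z| * (n.+1%:R * K * `|ph z|))).
      rewrite ler_wpM2l ?mulr_ge0//; apply: le_trans (mx_normM _ _) _.
      by rewrite ler_wpM2r// ler_wpM2l.
    rewrite (_ : _ * _ = n.+1%:R * (n.+1%:R * K) * `|ph z| ^+ 2); last by ring.
    by rewrite ler_wpM2l// !mulr_ge0// addr_ge0.
  rewrite mxE -mulr2n; apply: (le_trans (ler_norm _)).
  rewrite normrMn normrM normrN.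
  have -> : 2 * d * n.+1%:R * (n.+1%:R * K) * \sum_i ph z i 0 ^+ 2 =
    (d * (n.+1%:R * (n.+1%:R * K) * \sum_i ph z i 0 ^+ 2)) *+ 2 by ring.
  by rewrite lerMn2r /= ler_pM// ltW.
have g0 : g 0 = 0.
  by rewrite /g big1// => i _; rewrite /ph scale0r addr0 subrr mxE expr0n.
have g1 : g 1 = 0.
  apply: (gronwall01 gd gle g0); rewrite /g.
  by apply: sumr_ge0 => i _; rewrite sqr_ge0.
have [Oz _] := near 1 (introT andP (conj ler01 (lexx 1))).
rewrite scale1r in Oz; split => //.
apply/eqP; rewrite -subr_eq0; apply/eqP; apply/matrixP => i j; rewrite (ord1 j) [RHS]mxE.
move: g1; rewrite /g scale1r => /psumr_eq0P g1.
by apply/eqP; rewrite -sqrf_eq0; apply/eqP; apply: g1 => // k _; exact: sqr_ge0.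
Qed.

(* Differentiating [nu (y + t *: nu y) = nu y] in [y] gives the Riccati flow of
   the Hessian along the lines in integrated form. *)
Lemma eikonal_flow x : Omega x -> exists2 d : R, 0 < d & forall y t, `|y - x| < d -> `|t| < d ->
  [/\ Omega y, Omega (y + t *: nu y), nu (y + t *: nu y) = nu y,
   w (y + t *: nu y) = w y + t & H (y + t *: nu y) *m (1%:M + t *: H y) = H y].
Proof.
move=> /nu_line[d d0 h]; exists d => // y t hy ht; have [Oy Oz e1 e2] := h y t hy ht.
split => //.
have s1 : sdiff (fun z => z + t *: nu z) y (mulmx (1%:M + t *: H y)).
  have k1 := sdiff_id y.
  have k2 : sdiff (fun z => t *: nu z) y (mulmx (t *: H y)).
    have := sdiff_comp_mulmx (sdiff_mulmxl t%:M (nu y)) (hnu Oy).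
    rewrite mul_scalar_mx; apply: sdiff_near; exists 1 => // z _.
    by rewrite mul_scalar_mx.
  exact: sdiffD_mulmx k1 k2.
have s2 := sdiff_comp_mulmx (f := fun z => z + t *: nu z) (hnu Oz) s1.
apply: sdiff_mulmx_uniq s2 _; apply: sdiff_near (hnu Oy).
exists (d - `|y - x|); first by rewrite subr_gt0.
move=> z hz; have hzx : `|z - x| < d.
  by rewrite -(subrKA y); apply: le_lt_trans (ler_normD _ _) _; rewrite -ltrBrDr.
by have [_ _ -> _] := h z t hzx ht.
Qed.

(** Each point near [x] is slid along its own line to the level of [x], where the traces of powers
    of [H] are those at [x]; the flow identity carries the information back to [y]. *)
Lemma pullback x : Omega x -> exists2 d : R, 0 < d & forall y, `|y - x| < d ->
  let t := w y - w x in let y0 := y - t *: nu y in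
  [/\ Omega y, Omega y0, w y0 = w x, nu y0 = nu y & H y *m (1%:M + t *: H y0) = H y0].
Proof.
move=> Ox; have [d d0 h] := eikonal_flow Ox.
have cw := sdiff_continuous (lbounded_rowlin _) (hw Ox).
have m0 : 0 < Num.min (d / 2) (d / 2 / 2) by rewrite lt_min !divr_gt0.
have /continuousE_dist/(_ (d / 4)) := cw.
case; first by rewrite divr_gt0.
move=> d1 d10 hw1; exists (Num.min d1 (d / 2)); first by rewrite lt_min d10 divr_gt0.
move=> y; rewrite lt_min => /andP[y1 y2] /=; set t := w y - w x.
have ht : `|t| < d by apply: le_lt_trans (hw1 y y1) _; lra.
have htN : `|- t| < d by rewrite normrN.
have yd : `|y - x| < d by lra.
have [Oy Oy0 e1 e2 _] := h y (- t) yd htN; rewrite !scaleNr in Oy0 e1 e2.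
have y0d : `|y - t *: nu y - x| < d.
  rewrite addrAC; apply: le_lt_trans (ler_normB _ _) _; rewrite normrZ.
  have := nu_norm Oy; have := hw1 y y1; rewrite -/t.
  have := normr_ge0 t; have := normr_ge0 (nu y); nra.
have [_ _ _ _] := h _ t y0d ht.
by rewrite e1 subrK e2 /t; split => //; rewrite opprB addrC subrK.
Qed.

End Eikonal.

(** * Traces of powers of the Hessian on the levels *)

Section PowerTraces.
Variables (R : realType) (n : nat).

Lemma mxtrace_norm (A : 'M[R]_n) : `|\tr A| <= n%:R * `|A|.
Proof.
apply: le_trans (ler_norm_sum _ _ _) _.
apply: (@le_trans _ _ (\sum_(i < n) `|A|)); first by apply: ler_sum => i _; exact: le_mx_norm.
by rewrite sumr_const card_ord -[leLHS]mulr_natl.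
Qed.

(** The trace is the sum of the squares of all entries. *)
Lemma sym_sqr_tr0 (A : 'M[R]_n) : A^T = A -> \tr (A *m A) = 0 -> A = 0.
Proof.
move=> sA; have -> : \tr (A *m A) = \sum_i \sum_j A i j ^+ 2.
  apply: eq_bigr => i _; rewrite mxE; apply: eq_bigr => j _.
  by rewrite expr2 -{2}sA mxE.
move=> /psumr_eq0P h; apply/matrixP => i j; rewrite [RHS]mxE.
have /psumr_eq0P : \sum_j A i j ^+ 2 = 0.
  by apply: h => // k _; apply: sumr_ge0 => l _; exact: sqr_ge0.
move=> h'; apply/eqP; rewrite -sqrf_eq0; apply/eqP; apply: h' => // l _.
exact: sqr_ge0.
Qed.

End PowerTraces.

Section EikonalTraces.
Variables (R : realType) (n : nat) (Omega : set 'cV[R]_n.+1).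
Variables (w : 'cV[R]_n.+1 -> R) (nu : 'cV[R]_n.+1 -> 'cV[R]_n.+1)
  (H : 'cV[R]_n.+1 -> 'M[R]_n.+1).
Hypothesis eik : eikonal Omega w nu H.

Lemma line_trace_continuous x (A : 'M[R]_n.+1) : Omega x ->
  forall e : R, 0 < e -> exists2 d : R, 0 < d & forall t, `|t| < d ->
    `|\tr (A *m H (x + t *: nu x)) - \tr (A *m H x)| <= e.
Proof.
move=> Ox e e0; have [C C0 hC] := mulmx_bound n.+1 A.
have e'0 : 0 < e / n.+1%:R / C by rewrite !divr_gt0.
have /continuousE_dist/(_ _ e'0)[d d0 h] := H_continuous eik Ox.
exists d => // t ht; rewrite -linearB /= -mulmxBr.
apply: le_trans (mxtrace_norm _) _; rewrite mulrC -ler_pdivlMr//.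
apply: le_trans (hC _) _; rewrite mulrC -ler_pdivlMr//; apply: h.
rewrite addrAC subrr add0r normrZ; apply: le_lt_trans ht.
by apply: ler_piMr => //; exact: (nu_norm eik Ox).
Qed.

(* Along the line through [x], [H x *m H (x + t nu x)] is the difference
   quotient of [H], so [\tr (H ^+ m)] determines [\tr (H ^+ m.+1)]. *)
Lemma level_trace_line x y m : Omega x -> Omega y -> w x = w y ->
  exists2 d : R, 0 < d & forall t, `|t| < d ->
    \tr (H x ^+ m *m H (x + t *: nu x)) = \tr (H y ^+ m *m H (y + t *: nu y)).
Proof.
move=> Ox Oy wxy.
have [d1 d10 h1] := eikonal_flow eik Ox; have [d2 d20 h2] := eikonal_flow eik Oy.
have x0 : `|x - x| < d1 by rewrite subrr normr0.
have y0 : `|y - y| < d2 by rewrite subrr normr0.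
elim: m => [|m [d d0 ih]].
  exists (Num.min d1 d2) => [|t]; first by rewrite lt_min d10.
  rewrite lt_min => /andP[t1 t2]; rewrite !expr0 !mul1mx.
  have [_ Ox' _ wx' _] := h1 x t x0 t1; have [_ Oy' _ wy' _] := h2 y t y0 t2.
  by apply: (eik_tr eik) => //; rewrite wx' wy' wxy.
pose d' := Num.min d (Num.min d1 d2).
have d'0 : 0 < d' by rewrite !lt_min d0 d10.
(* The transposed flow identity, solved for the product of the two Hessians. *)
have comm z (t : R) : Omega z -> Omega (z + t *: nu z) ->
    H (z + t *: nu z) *m (1%:M + t *: H z) = H z ->
    t *: (H z *m H (z + t *: nu z)) = H z - H (z + t *: nu z).
  move=> Oz Oz' /(congr1 trmx); rewrite trmx_mul linearD /= linearZ /= trmx1.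
  rewrite !(eik_sym eik)// mulmxDl mul1mx -scalemxAl => /eqP.
  by rewrite addrC eq_sym -subr_eq => /eqP ->.
have key z (t : R) : t != 0 -> Omega z -> Omega (z + t *: nu z) ->
    H (z + t *: nu z) *m (1%:M + t *: H z) = H z ->
    \tr (H z ^+ m.+1 *m H (z + t *: nu z)) =
    (\tr (H z ^+ m *m H z) - \tr (H z ^+ m *m H (z + t *: nu z))) / t.
  move=> t0 Oz Oz' e; apply: (canRL (mulfK t0)).
  by rewrite mulrC -linearZ /= -linearB /= -mulmxBr -comm// -scalemxAr exprSr mulmxA.
have n0 : forall t : R, t != 0 -> `|t| < d' ->
    \tr (H x ^+ m.+1 *m H (x + t *: nu x)) = \tr (H y ^+ m.+1 *m H (y + t *: nu y)).
  move=> t t0; rewrite !lt_min => /and3P[td t1 t2].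
  have [_ Ox' _ _ ex] := h1 x t x0 t1; have [_ Oy' _ _ ey] := h2 y t y0 t2.
  rewrite !key// ih//; have := ih 0; rewrite !scale0r !addr0 normr0 => -> //.
exists d' => // t td; have [->|t0] := eqVneq t 0; last exact: n0.
(* The difference quotient says nothing at [t = 0]; that value is recovered by continuity from a
   small [s > 0]. *)
rewrite !scale0r !addr0; apply/eqP; rewrite -subr_eq0 -normr_le0.
apply/ler_addgt0Pl => e e0; rewrite addr0.
have e2 : 0 < e / 2 by rewrite divr_gt0.
have [a a0 ha] := line_trace_continuous (H x ^+ m.+1) Ox e2.
have [b b0 hb] := line_trace_continuous (H y ^+ m.+1) Oy e2.
pose s := Num.min d' (Num.min a b) / 2.
have m0 : 0 < Num.min d' (Num.min a b) by rewrite !lt_min d0 d10 d20 a0.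
have s0 : 0 < s by rewrite divr_gt0.
have : s < Num.min d' (Num.min a b) by rewrite /s; lra.
rewrite lt_min [X in _ && X]lt_min -(gtr0_norm s0) => /and3P[sd /ha hx /hb hy].
have E := n0 s (lt0r_neq0 s0) sd.
rewrite E in hx.
rewrite (splitr e); apply: le_trans (lerD hx hy).
rewrite (distrC _ (\tr (H x ^+ _ *m _))); apply: le_trans (ler_normD _ _).
by rewrite addrA subrK distrC distrC.
Qed.

Lemma level_trace_exp x y m : Omega x -> Omega y -> w x = w y ->
  \tr (H x ^+ m) = \tr (H y ^+ m).
Proof.
move=> Ox Oy wxy; case: m => [|m]; first by rewrite !expr0.
have [d d0 h] := level_trace_line m Ox Oy wxy.
by have := h 0; rewrite normr0 !scale0r !addr0 !exprSr => /(_ d0).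
Qed.

Lemma horner_mx_sum (A : 'M[R]_n.+1) p : horner_mx A p = \sum_(i < size p) p`_i *: A ^+ i.
Proof.
rewrite -[in LHS](coefK p) poly_def linear_sum /=; apply: eq_bigr => i _.
by rewrite linearZ /= rmorphXn /= horner_mx_X.
Qed.

Lemma level_trace_horner x y p : Omega x -> Omega y -> w x = w y ->
  \tr (horner_mx (H x) p) = \tr (horner_mx (H y) p).
Proof.
move=> Ox Oy wxy; rewrite !horner_mx_sum !linear_sum; apply: eq_bigr => i _.
by rewrite !linearZ /= (level_trace_exp i Ox Oy wxy).
Qed.

Lemma horner_mx_sym (A : 'M[R]_n.+1) p : A^T = A -> (horner_mx A p)^T = horner_mx A p.
Proof.
move=> sA; rewrite horner_mx_sum linear_sum; apply: eq_bigr => i _.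
rewrite linearZ /=; congr (_ *: _); elim: (i : nat) => [|m ih]; first by rewrite expr0 trmx1.
by rewrite {1}exprS exprSr trmx_mul ih sA.
Qed.

(** Apply equality of traces to [p * p]: every polynomial identity satisfied by [H x] holds on the
    whole level. This replaces any comparison of eigenvalues. *)
Lemma level_horner0 x y p : Omega x -> Omega y -> w x = w y ->
  horner_mx (H x) p = 0 -> horner_mx (H y) p = 0.
Proof.
move=> Ox Oy wxy e; apply: sym_sqr_tr0; first by apply: horner_mx_sym; exact: (eik_sym eik).
have <- : horner_mx (H y) (p * p) = horner_mx (H y) p *m horner_mx (H y) p.
  by rewrite rmorphM.
by rewrite -(level_trace_horner (p * p) Ox Oy wxy) rmorphM /= e mul0r linear0.
Qed.

End EikonalTraces.

(** * Spectral theorem and Cartan's identity *)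

Section SpectralReal.
Import complex spectral.
Local Open Scope complex_scope.
Variable R : realType.


(** Over the complex numbers [A] is Hermitian, hence unitarily diagonalizable with real spectrum. A
    real similarity is enough below, as polynomials in [A] and their traces are all that is computed
    from it. *)
Lemma real_sym_diag n (A : 'M[R]_n) : A^T = A ->
  exists (P : 'M[R]_n) (d : 'rV[R]_n), P \in unitmx /\ A = invmx P *m diag_mx d *m P.
Proof.
move=> sA; pose f := complex.real_complex R.
have real_f m p (B : 'M[R]_(m, p)) : map_mx f B \is a mxOver Num.real.
  by apply/mxOverP => i j; rewrite mxE; apply/complex_realP; exists (B i j).
have real_inv m p (B : 'M[R[i]]_(m, p)) : B \is a mxOver Num.real ->
    exists B', B = map_mx f B'.
  move=> /mxOverP h; exists (map_mx (@complex.Re R) B); apply/matrixP => i j.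
  by rewrite !mxE /f RRe_real.
pose Ac := map_mx f A.
have symA : Ac \is symmetricmx.
  by apply/is_hermitianmxP; rewrite expr0 scale1r; apply/matrixP => i j; rewrite !mxE -{1}sA mxE.
have hA := realsym_hermsym symA (real_f _ _ A).
have /orthomx_spectralP e := hermitian_normalmx hA.
have dreal := hermitian_spectral_diag_real hA.
move: e dreal (spectral_unit Ac); set P := spectralmx Ac; set d := spectral_diag Ac => e dreal Pu.
(* Real matrices that are similar over the complex numbers are similar over the reals. *)
have [|||Q] := @real_similar _ n Ac (diag_mx d).
- exists P => //; apply/(similarP Pu).
  by rewrite {1}e !mulmxA mulmxV// mul1mx.
- exact: real_f.
- apply/mxOverP => i j; rewrite mxE; case: (i == j); last by rewrite mulr0n.
  by rewrite mulr1n; move/mxOverP: dreal; apply.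
move=> /andP[/= Qr Qu] /(similarP Qu) eQ.
have [Q' QE] := real_inv _ _ _ Qr; have [d' dE] := real_inv _ _ _ dreal.
have Qu' : Q' \in unitmx by rewrite -(map_unitmx f) -QE.
exists Q', d'; split => //.
have : Q' *m A = diag_mx d' *m Q'.
  apply: (map_mx_inj (f := f)); rewrite !map_mxM /= -QE map_diag_mx -dE.
  exact: eQ.
by move=> eq; rewrite -mulmxA -eq mulKmx.
Qed.

End SpectralReal.

Section FunctionalCalculus.
Variables (R : realType) (n : nat).

(** Functions of a diagonalizable matrix become polynomials in it, so they depend continuously on
    the matrix and are governed by [level_horner0]. *)
Lemma interpolation (d : 'rV[R]_n) (phi : R -> R) :
  exists p : {poly R}, forall i, p.[d 0 i] = phi (d 0 i).
Proof.
have [p hp] : exists p : {poly R}, forall x, x \in [seq d 0 i | i : 'I_n] -> p.[x] = phi x.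
  elim: [seq _ | _ : _] => [|a s [p hp]]; first by exists 0.
  have [as_|ans] := boolP (a \in s).
    by exists p => x; rewrite inE => /orP[/eqP->|]; exact: hp.
  pose q := \prod_(b <- s) ('X - b%:P).
  have qa : q.[a] != 0.
    by rewrite -[_ == 0]/(root q a) root_prod_XsubC.
  exists (p + ((phi a - p.[a]) / q.[a])%:P * q) => x; rewrite inE hornerD hornerM hornerC.
  have [-> _|xa /= xs] := eqVneq x a; first by rewrite divfK// addrC subrK.
  have /eqP -> : q.[x] == 0 by rewrite -[_ == 0]/(root q x) root_prod_XsubC.
  by rewrite mulr0 addr0 hp.
by exists p => i; apply: hp; rewrite map_f// mem_enum.
Qed.

End FunctionalCalculus.

(** * Continuity and product rules for matrix-valued maps *)

Section MatrixContinuity.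
Variable R : realType.

Lemma continuous_mulmx (U : normedModType R) m n p (A : U -> 'M[R]_(m, n))
    (B : U -> 'M[R]_(n, p)) x :
  {for x, continuous A} -> {for x, continuous B} ->
  {for x, continuous (fun y => A y *m B y)}.
Proof.
move=> /continuousE_dist cA /continuousE_dist cB; apply/continuousE_dist => e e0.
pose a := e / 2 / (n.+1%:R * (1 + `|B x|)).
pose b := e / 2 / (n.+1%:R * (1 + `|A x|)).
have B1 : 0 < 1 + `|B x| by rewrite ltr_pwDl.
have A1 : 0 < 1 + `|A x| by rewrite ltr_pwDl.
have a0 : 0 < a by rewrite !divr_gt0// mulr_gt0.
have b0 : 0 < b by rewrite !divr_gt0// mulr_gt0.
have [d1 d10 hA] := cA a a0; have [d2 d20 hB] := cB b b0; have [d3 d30 hB1] := cB 1 ltr01.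
exists (Num.min d1 (Num.min d2 d3)); first by rewrite !lt_min d10 d20.
move=> y; rewrite !lt_min => /and3P[/hA yA /hB yB /hB1 yB1].
have -> : A y *m B y - A x *m B x = (A y - A x) *m B y + A x *m (B y - B x).
  by rewrite mulmxBl mulmxBr addrA subrK.
apply: le_trans (ler_normD _ _) _; rewrite (splitr e); apply: lerD.
  apply: le_trans (mx_normM _ _) _.
  have yB2 : `|B y| <= 1 + `|B x|.
    rewrite -[X in `|X| <= _](subrK (B x)); apply: le_trans (ler_normD _ _) _.
    by rewrite lerD2r.
  have <- : n.+1%:R * a * (1 + `|B x|) = e / 2.
    by rewrite mulrAC mulrC /a divfK// gt_eqF// mulr_gt0.
  apply: ler_pM => //; apply: ler_pM => //; rewrite ler_nat//.
apply: le_trans (mx_normM _ _) _.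
have <- : n.+1%:R * (1 + `|A x|) * b = e / 2.
  by rewrite mulrC /b divfK// gt_eqF// mulr_gt0.
by apply: ler_pM => //; apply: ler_pM => //; rewrite ?ler_nat ?lerDr.
Qed.

Lemma continuous_addmx (U : normedModType R) m n (A B : U -> 'M[R]_(m, n)) x :
  {for x, continuous A} -> {for x, continuous B} ->
  {for x, continuous (fun y => A y + B y)}.
Proof. by move=> cA cB; exact: continuousD. Qed.

Lemma continuous_trmx (U : normedModType R) m n (A : U -> 'M[R]_(m, n)) x :
  {for x, continuous A} -> {for x, continuous (fun y => (A y)^T)}.
Proof.
move=> /continuousE_dist cA; apply/continuousE_dist => e /cA[d d0 h]; exists d => // y /h hy.
apply: mx_norm_le => [|i j]; first exact: le_trans hy.
by have := le_trans (le_mx_norm _ j i) hy; rewrite !mxE.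
Qed.

Lemma continuous_entry (U : normedModType R) m n (A : U -> 'M[R]_(m, n)) i j x :
  {for x, continuous A} -> {for x, continuous (fun y => A y i j)}.
Proof.
move=> /continuousE_dist cA; apply/(@continuousE_dist R _ R^o) => e /cA[d d0 h].
by exists d => // y /h; apply: le_trans; have := le_mx_norm (A y - A x) i j; rewrite !mxE.
Qed.

Lemma continuous_horner_mx (U : normedModType R) n (A : U -> 'M[R]_n.+1) (p : {poly R}) x :
  {for x, continuous A} -> {for x, continuous (fun y => horner_mx (A y) p)}.
Proof.
move=> cA; elim/poly_ind: p => [|p c ih].
  rewrite (_ : (fun _ => _) = fun=> 0); first exact: cst_continuous.
  by apply/funext => y; rewrite rmorph0.
rewrite (_ : (fun _ => _) = fun y => horner_mx (A y) p *m A y + c%:M).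
  by apply: continuous_addmx; [exact: continuous_mulmx|exact: cst_continuous].
by apply/funext => y; rewrite rmorphD rmorphM /= horner_mx_X horner_mx_C.
Qed.

Lemma sdiff_scale m n (a : 'cV[R]_n -> R) (f : 'cV[R]_n -> 'cV[R]_m) x (p : 'rV[R]_n) J :
  sdiff (a : 'cV[R]_n -> R^o) x (rowlin p) -> sdiff f x (mulmx J) ->
  sdiff (fun y => a y *: f y) x (mulmx (f x *m p + a x *: J)).
Proof.
move=> ha hf; apply: sdiff_mxP => i j; rewrite (ord1 j).
have := sdiffM (lbounded_rowlin p) (lbounded_coord J i) ha (sdiff_coord i 0 hf).
move=> h; have : sdiff ((fun y => a y * f y i 0) : 'cV[R]_n -> R^o) x
    (fun v => ((f x *m p + a x *: J) *m v) i 0).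
  apply: sdiff_eqL h => v; rewrite mulmxDl -mulmxA -scalemxAl.
  rewrite [RHS]mxE [X in _ = _ + X]mxE; congr (_ + _).
  by rewrite [RHS]mxE big_ord1 mulrC.
by apply: sdiff_near; exists 1 => // y _; rewrite mxE.
Qed.

Lemma sdiff_shift_cst (U : normedModType R) (a : U -> R) x L (c : R) :
  sdiff (a : U -> R^o) x L -> sdiff ((fun y => c + a y) : U -> R^o) x L.
Proof.
move=> h; have := sdiffD (sdiff_cst (c : R^o) x) h.
by apply: sdiff_eqL => v; rewrite add0r.
Qed.

End MatrixContinuity.

(** * Matrix algebra behind Cartan's identity *)

Section CartanAlgebra.
Variables (R : realType) (n : nat).
Variables (N L M h K : 'M[R]_n) (a r0 t : R).
Let r := r0 + t.
Hypotheses (NN : N *m N = N) (NL : N *m L = 0) (LN : L *m N = 0) (KN : K *m N = 0).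
Hypotheses (LL : L *m L = L) (LM : L *m M = 0) (hL : h *m L = a *: L)
  (hM : (1%:M - r0 *: h) *m M = h - a *: L) (ra : r0 * a = 1).
Hypotheses (Kh : K *m (1%:M + t *: h) = h) (hK : h *m K = K *m h).

(** In the application [h] is the Hessian at the foot point on the level, [K] the Hessian at
    distance [t] along the line, [N] the projection on the normal, [L] the spectral projection of
    [h] at [a], and [M] has the eigenvalue [1 / (1 / l - r0)] where [h] has an [l] other than 0 and
    [a], and 0 elsewhere. *)
Lemma cartan_unit : (1%:M + t *: h) *m (1%:M - t *: K) = 1%:M.
Proof.
rewrite mulmxDl mul1mx mulmxBr mulmx1 -!scalemxAl -!scalemxAr hK.
have e : K = h - t *: (K *m h) by rewrite -[X in X - _]Kh mulmxDr mulmx1 -scalemxAr addrK.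
rewrite {1}e scalerBr opprB; apply/matrixP => i j; rewrite !mxE; ring.
Qed.

(** An eigenvalue [l] of [h] becomes [1 / (1 / l + t)] for [K]; for [l = a] this is [1 / r]. *)
Lemma cartan_KL : r *: (K *m L) = L.
Proof.
have e : (1 + t * a) *: (K *m L) = a *: L.
  have : K *m (1%:M + t *: h) *m L = a *: L by rewrite Kh hL.
  rewrite -mulmxA mulmxDl mul1mx -scalemxAl hL scalerA => <-.
  by rewrite scalemxAr scalerDl scale1r.
have -> : r = r0 * (1 + t * a) by rewrite /r mulrDr mulr1 mulrCA ra mulr1.
by rewrite -scalerA e scalerA ra scale1r.
Qed.

Lemma cartan_SE : (1%:M - N - r *: K) *m (N + L) = 0.
Proof.
rewrite mulmxDr !mulmxBl !mul1mx NN NL subrr -!scalemxAl KN scaler0 !subr0 add0r.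
by rewrite cartan_KL subrr.
Qed.

Lemma cartan_EE : (N + L) *m (N + L) = N + L.
Proof. by rewrite mulmxDr !mulmxDl NN NL LN LL addr0 add0r. Qed.

(** On an eigenvector with [l] other than 0 and [a], the first factor acts as [1 - r / (1 / l + t) =
    (1 / l - r0) / (1 / l + t)], whose inverse is [1 + r / (1 / l - r0)]. The only dependence on [t]
    is through the factor [r]. *)
Lemma cartan_inv : (1%:M - N - r *: K + (N + L)) *m (1%:M + r *: M) = 1%:M.
Proof.
have -> : 1%:M - N - r *: K + (N + L) = 1%:M + L - r *: K.
  by apply/matrixP => i j; rewrite !mxE; ring.
have Ku : (1%:M - t *: K) *m (1%:M + t *: h) = 1%:M by apply: mulmx1C; exact: cartan_unit.
have e : (1%:M + t *: h) *m ((1%:M + L - r *: K) *m (1%:M + r *: M)) = 1%:M + t *: h.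
  have Kh' : (1%:M + t *: h) *m K = h.
    by rewrite mulmxDl mul1mx -scalemxAl hK scalemxAr -{1}(mulmx1 K) -mulmxDr.
  have e1 : (1%:M + t *: h) *m (1%:M + L - r *: K) = 1%:M - r0 *: h + (1 + t * a) *: L.
    rewrite mulmxBr -scalemxAr Kh' mulmxDr mulmx1 mulmxDl mul1mx -scalemxAl hL.
    by rewrite /r; apply/matrixP => i j; rewrite !mxE; ring.
  rewrite mulmxA e1 mulmxDr mulmx1 -scalemxAr mulmxDl hM -scalemxAl LM scaler0 addr0.
  have : (r0 * a) *: L = L by rewrite ra scale1r.
  move=> /matrixP eL; rewrite /r; apply/matrixP => i j; have := eL i j; rewrite !mxE => eij.
  by move: ((i == j)%:R) (h i j) (L i j) eij => d x y eij; lra.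
by rewrite -[LHS]mul1mx -[X in X *m _]Ku -mulmxA e Ku.
Qed.
End CartanAlgebra.

(** * Cartan's identity *)

Section Cartan.
Variables (R : realType) (n : nat) (Omega : set 'cV[R]_n.+1).
Variables (w : 'cV[R]_n.+1 -> R) (nu : 'cV[R]_n.+1 -> 'cV[R]_n.+1)
  (H : 'cV[R]_n.+1 -> 'M[R]_n.+1).
Hypothesis eik : eikonal Omega w nu H.
Variables (x0 : 'cV[R]_n.+1) (Ox0 : Omega x0).

Let N y := nu y *m (nu y)^T.

Lemma nu_proj_idem y : Omega y -> N y *m N y = N y.
Proof. by move=> Oy; rewrite /N mulmxA -[_ *m nu y]mulmxA (eik_unit eik)// mulmx1. Qed.

Lemma nu_proj_sym y : (N y)^T = N y.
Proof. by rewrite /N trmx_mul trmxK. Qed.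

Lemma hessian_nu_proj y : Omega y -> H y *m N y = 0.
Proof. by move=> Oy; rewrite /N mulmxA (hessian_nu eik Oy) mul0mx. Qed.

Lemma nu_proj_hessian y : Omega y -> N y *m H y = 0.
Proof.
by move=> Oy; apply: trmx_inj; rewrite trmx_mul nu_proj_sym (eik_sym eik Oy) hessian_nu_proj// trmx0.
Qed.

Lemma mxtrace_nu_proj y : Omega y -> \tr (N y) = 1.
Proof. by move=> Oy; rewrite /N mxtrace_mulC (eik_unit eik Oy) mxtrace1. Qed.

Lemma sdiff_focal (r0 : R) y : Omega y ->
  sdiff (fun y : 'cV[R]_n.+1 => y - (r0 + (w y - w x0)) *: nu y) y
    (mulmx (1%:M - N y - (r0 + (w y - w x0)) *: H y)).
Proof.
move=> Oy; have h1 := sdiff_id y.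
have h2 : sdiff ((fun z => r0 + (w z - w x0)) : 'cV[R]_n.+1 -> R^o) y (rowlin (nu y)^T).
  have h := sdiff_shift_cst (r0 - w x0) (eik_w eik Oy).
  by apply: sdiff_near h; exists 1 => // z _; ring.
have := sdiffB_mulmx h1 (sdiff_scale h2 (eik_nu eik Oy)).
by apply: sdiff_eqL => v; rewrite opprD addrA.
Qed.

Lemma pullback_continuous : {for x0, continuous (fun y : 'cV[R]_n.+1 => H (y - (w y - w x0) *: nu y))}.
Proof.
have /continuousE_dist cH := H_continuous eik Ox0.
have /continuousE_dist cw := sdiff_continuous (lbounded_rowlin _) (eik_w eik Ox0).
have [r rr0 hr] := open_dist (eik_open eik) Ox0.
apply/continuousE_dist => e /cH[d d0 h].
have d4 : 0 < d / 4 by rewrite divr_gt0.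
have [d1 d10 hw] := cw _ d4.
exists (Num.min r (Num.min d1 (d / 4))); first by rewrite !lt_min rr0 d10.
move=> y; rewrite !lt_min => /and3P[/hr Oy /hw yw yd].
rewrite /= (_ : x0 - _ = x0); last by rewrite subrr scale0r subr0.
apply: h; rewrite addrAC; apply: le_lt_trans (ler_normB _ _) _; rewrite normrZ.
have := nu_norm eik Oy; have := normr_ge0 (w y - w x0); have := normr_ge0 (nu y); nra.
Qed.

(* A C^1 form of Cartan's identity for isoparametric hypersurfaces of R^n. With
   [1 / l = w + c_l] the nondegenerate part of the Jacobian of [Phi] has an
   inverse of trace [n + 1 + r * T0], with [T0] the sum of the
   [1 / (1 / l - 1 / a)] over the eigenvalues [l] other than [0] and [a]. By
   developability it is affine along a line on which [Phi] is constant, whereas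
   [r] is not, so [T0 = 0]; maximality of [1 / a] gives all terms one sign. *)
Lemma hessian_one_eigenvalue : exists a : R, H x0 *m H x0 = a *: H x0.
Proof.
have [P [d [Pu HE]]] := real_sym_diag (eik_sym eik Ox0).
have fcE p : horner_mx (H x0) p = invmx P *m diag_mx (map_mx (horner p) d) *m P.
  by rewrite HE horner_mx_uconjC// horner_mx_diag.
have eqp p q : (forall i, p.[d 0 i] = q.[d 0 i]) -> horner_mx (H x0) p = horner_mx (H x0) q.
  move=> pq; rewrite !fcE; congr (_ *m diag_mx _ *m _).
  by apply/matrixP => i j; rewrite !mxE (ord1 i).
have trp p : \tr (horner_mx (H x0) p) = \sum_i p.[d 0 i].
  rewrite fcE mxtrace_mulC mulmxA mulmxV// mul1mx mxtrace_diag.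
  by apply: eq_bigr => i _; rewrite mxE.
have lev y p q : Omega y -> w y = w x0 -> (forall i, p.[d 0 i] = q.[d 0 i]) ->
    horner_mx (H y) p = horner_mx (H y) q.
  move=> Oy wy pq; apply/eqP; rewrite -subr_eq0 -rmorphB; apply/eqP.
  apply: (level_horner0 eik Ox0 Oy) => //.
  by rewrite rmorphB /= (eqp _ _ pq) subrr.
have [d0|/existsP[i0 di0]] := boolP [forall i, d 0 i == 0].
  exists 0; rewrite scale0r HE (_ : d = 0) ?linear0 ?mulmx0 ?mul0mx//.
  by apply/matrixP => i j; rewrite (ord1 i) [RHS]mxE; apply/eqP; exact: (forallP d0).
have [i1 di1 imax] := @arg_maxP _ _ _ i0 (fun i => d 0 i != 0) (fun i => (d 0 i)^-1) di0.
set a := d 0 i1 in di1 imax; pose r0 := a^-1.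
have ra : r0 * a = 1 by rewrite /r0 mulVf.
have [pL hpL] := interpolation d (fun l => (l == a)%:R).
(* The terms of Cartan's sum, with 0 for the two eigenvalues that it omits. *)
pose phi l := if (l == 0) || (l == a) then 0 else (l^-1 - r0)^-1.
have [pM hpM] := interpolation d phi.
have phi_le i : phi (d 0 i) <= 0.
  rewrite /phi; case: ifPn => //; rewrite negb_or => /andP[l0 la].
  by rewrite invr_le0 subr_le0; exact: imax.
have phi0 i : phi (d 0 i) = 0 -> (d 0 i == 0) || (d 0 i == a).
  rewrite /phi; case: ifPn => //; rewrite negb_or => /andP[l0 la] /eqP.
  by rewrite invr_eq0 subr_eq0 => /eqP/invr_inj e; rewrite e eqxx in la.
pose T0 := \sum_i phi (d 0 i).
suff T00 : T0 = 0.
  exists a; have : horner_mx (H x0) ('X * 'X) = horner_mx (H x0) (a%:P * 'X).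
    apply: eqp => i; rewrite !hornerE.
    have /phi0/orP[/eqP->|/eqP->] : phi (d 0 i) = 0; rewrite ?mulr0//.
    have : \sum_i - phi (d 0 i) = 0 by rewrite sumrN -/T0 T00 oppr0.
    move=> /psumr_eq0P h; apply/eqP; rewrite -oppr_eq0; apply/eqP; apply: h => // j _.
    by rewrite oppr_ge0.
  by rewrite !rmorphM /= horner_mx_X horner_mx_C => e; rewrite -[LHS]/(H x0 * H x0) e -mul_scalar_mx.
pose L y := horner_mx (H y) pL; pose M y := horner_mx (H y) pM.
have alg y : Omega y -> w y = w x0 ->
    [/\ L y *m L y = L y, L y *m M y = 0, H y *m L y = a *: L y,
        (1%:M - r0 *: H y) *m M y = H y - a *: L y & L y *m H y = a *: L y].
  move=> Oy wy.
  have key p q : (forall i, p.[d 0 i] = q.[d 0 i]) -> horner_mx (H y) p = horner_mx (H y) q.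
    by move=> pq; exact: lev.
  have phia : phi a = 0 by rewrite /phi eqxx orbT.
  have aL : a *: L y = horner_mx (H y) (a%:P * pL).
    by rewrite rmorphM /= horner_mx_C -mul_scalar_mx.
  split.
  - rewrite -[LHS]/(L y * L y) /L -rmorphM; apply: key => i.
    by rewrite hornerM hpL; case: eqP => _; rewrite ?mulr1 ?mulr0.
  - rewrite -[LHS]/(L y * M y) /L /M -rmorphM -(rmorph0 (horner_mx (H y))); apply: key => i.
    by rewrite hornerM hpL hpM horner0; case: eqP => [->|_]; rewrite ?phia ?mul0r ?mulr0.
  - rewrite aL (_ : H y *m L y = horner_mx (H y) ('X * pL)); last by rewrite rmorphM /= horner_mx_X.
    by apply: key => i; rewrite !hornerE hpL; case: eqP => [->|_]; rewrite ?mulr0.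
  - rewrite aL (_ : _ *m M y = horner_mx (H y) ((1 - a^-1%:P * 'X) * pM)); last first.
      by rewrite !(rmorphM, rmorphB, rmorph1) /= horner_mx_X horner_mx_C -mul_scalar_mx.
    rewrite -[X in _ = X - _]horner_mx_X -rmorphB /=; apply: key.
    move=> i; rewrite !hornerE hpL hpM.
    have [->|da] := eqVneq (d 0 i) a; first by rewrite phia mulr0 mulr1 subrr.
    rewrite mulr0 subr0 /phi (negbTE da) orbF.
    have [->|dn0] := eqVneq (d 0 i) 0; first by rewrite mulr0.
    have l0 : (d 0 i)^-1 - r0 != 0.
      by rewrite subr_eq0; apply: contraNneq da => /invr_inj ->.
    rewrite -[X in X - r0 * _](mulVf dn0) -mulrBl mulrAC mulfV// mul1r.
    by [].
  - rewrite aL (_ : L y *m H y = horner_mx (H y) (pL * 'X)); last by rewrite rmorphM /= horner_mx_X.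
    by apply: key => i; rewrite !hornerE hpL; case: eqP => [->|_]; rewrite ?mulr0 ?mul0r// mulrC.
have [dp dp0 hpull] := pullback eik Ox0.
(* [b y] is the foot point of [y] on the level of [x0]. Taking [L] there lets one polynomial [pL]
   serve for all [y], although the eigenvalue itself changes with [w]. *)
pose t y := w y - w x0; pose b y := y - t y *: nu y; pose r y := r0 + t y.
pose S y := 1%:M - N y - r y *: H y.
pose E y := N y + L (b y).
pose Phi y := y - r y *: nu y.
have Lnu y : Omega y -> w y = w x0 -> L y *m nu y = 0.
  move=> Oy wy; have [_ _ _ _ Lh] := alg y Oy wy.
  have : a *: (L y *m nu y) = 0 by rewrite scalemxAl -Lh -mulmxA (hessian_nu eik Oy) mulmx0.
  by move/eqP; rewrite scaler_eq0 (negbTE di1) => /eqP.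
have Lsym y : Omega y -> (L y)^T = L y.
  by move=> Oy; apply: horner_mx_sym; exact: (eik_sym eik).
have loc y : `|y - x0| < dp -> [/\ Omega y, S y *m E y = 0, (E y)^T = E y, E y *m E y = E y &
    (S y + E y) *m (1%:M + r y *: M (b y)) = 1%:M].
  move=> /hpull; rewrite -/(t y) -/(b y) => -[Oy Ob wb nb Kh].
  have [LL LM hL hM Lh] := alg _ Ob wb.
  have LN : L (b y) *m N y = 0 by rewrite /N -nb mulmxA Lnu// mul0mx.
  have NL : N y *m L (b y) = 0.
    by apply: trmx_inj; rewrite trmx_mul nu_proj_sym Lsym// LN trmx0.
  have hK : H (b y) *m H y = H y *m H (b y).
    have e1 : (1%:M + t y *: H (b y)) *m H y = H (b y).
      by rewrite -[RHS](eik_sym eik)// -{2}Kh trmx_mul linearD /= linearZ /= trmx1 !(eik_sym eik).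
    have : (1%:M + t y *: H (b y)) *m H y = H y *m (1%:M + t y *: H (b y)) by rewrite e1 Kh.
    rewrite mulmxDl mulmxDr mul1mx mulmx1 -scalemxAl -scalemxAr => /addrI.
    have [t0|tn0] := eqVneq (t y) 0; last exact: scalerI.
    by rewrite /b t0 !scale0r subr0.
  split => //.
  - exact: (cartan_SE (nu_proj_idem Oy) NL (hessian_nu_proj Oy) hL ra Kh).
  - by rewrite /E linearD /= nu_proj_sym Lsym.
  - exact: (cartan_EE (nu_proj_idem Oy) NL LN LL).
  - exact: (cartan_inv (N y) LM hL hM ra Kh hK).
have bx0 : b x0 = x0 by rewrite /b /t subrr scale0r subr0.
have rx0 : r x0 = r0 by rewrite /r /t subrr addr0.
have xx (e : R) : 0 < e -> `|x0 - x0| < e by rewrite subrr normr0.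
have [_ SE0 Esym0 EE0 inv0] := loc x0 (xx _ dp0).
have cE : {for x0, continuous E}.
  have cN : {for x0, continuous nu}.
    by apply: (sdiff_continuous (lbounded_mulmx 1 (H x0))); exact: (eik_nu eik).
  have cNN := continuous_mulmx cN (continuous_trmx cN).
  exact: (continuous_addmx cNN (continuous_horner_mx (p := pL) pullback_continuous)).
have unitE y : `|y - x0| < dp -> S y + E y \in unitmx.
  by move=> /loc[_ _ _ _ e]; exact: (mulmx1_unit e).1.
have [|||dd dd0 [devA devB]] := @developable R _ Phi S E (E x0) x0 dp dp0 _ cE erefl Esym0 EE0.
- move=> y hy; have [Oy SE _ _ _] := loc y hy; split => //.
    exact: sdiff_focal.
  by rewrite /S !linearB /= linearZ /= trmx1 nu_proj_sym (eik_sym eik).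
- exact: SE0.
- by rewrite addrC; apply: unitE; exact: xx.
set Pi := E x0 in devA devB Esym0 EE0 SE0 inv0.
have LE0 : L (b x0) = L x0 by rewrite bx0.
have [LL0 _ _ _ _] := alg x0 Ox0 erefl.
(* A tangent direction in the eigenspace of [a]; it lies in the kernel of the Jacobian of [Phi] and
   is orthogonal to [nu x0]. *)
have [e [ene0 Le]] : exists e : 'cV[R]_n.+1, e != 0 /\ L x0 *m e = e.
  have trL : \tr (L x0) != 0.
    rewrite trp (bigD1 i1)//= hpL eqxx lt0r_neq0// ltr_pwDl//.
    by apply: sumr_ge0 => i _; rewrite hpL.
  apply: contrapT => /forallNP h; move/eqP: trL; apply.
  rewrite (_ : L x0 = 0) ?linear0//; apply: mulmx_cV_inj => v; rewrite mul0mx.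
  apply/eqP; apply: contrapT => /negP Lv.
  by apply: (h (L x0 *m v)); split => //; rewrite mulmxA LL0.
have nue : (nu x0)^T *m e = 0.
  rewrite -Le mulmxA -(Lsym _ Ox0) -trmx_mul Lnu// trmx0 mul0mx//.
have Pie : Pi *m e = e by rewrite /Pi /E LE0 mulmxDl /N -mulmxA nue mulmx0 add0r Le.
(* The image of [Pi] is contained in that of [E y], and equal traces make the two projections
   coincide. *)
have EP y : `|y - x0| < dp -> S y *m Pi = 0 -> E y = Pi.
  move=> hy SPi; have [Oy SE Esym EE _] := loc y hy.
  have EPi : E y *m Pi = Pi.
    apply/eqP; rewrite -subr_eq0; apply/eqP; apply: (can_inj (mulKmx (unitE y hy))).
    by rewrite mulmx0 mulmxBr !(mulmxDl (S y)) SPi add0r !mulmxA SE mul0mx add0r EE subrr.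
  have PiE : Pi *m E y = Pi by apply: trmx_inj; rewrite trmx_mul Esym Esym0 EPi.
  have trE : \tr (E y - Pi) = 0.
    have [_ Ob wb _ _] := hpull y hy.
    have t1 : \tr (E y) = 1 + \tr (L (b y)) by rewrite /E linearD /= mxtrace_nu_proj.
    have t2 : \tr Pi = 1 + \tr (L x0) by rewrite /Pi /E LE0 linearD /= mxtrace_nu_proj.
    have t3 : \tr (L (b y)) = \tr (L x0) by exact: (level_trace_horner eik pL Ob Ox0).
    by rewrite linearB /= t1 t2 t3 subrr.
  apply/eqP; rewrite -subr_eq0; apply/eqP; apply: sym_sqr_tr0.
    by rewrite linearB /= Esym Esym0.
  by rewrite mulmxBl !mulmxBr EE EPi PiE EE0 subrr subr0.
have trT y : `|y - x0| < dp -> S y *m Pi = 0 ->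
    \tr (invmx (Pi + S y)) = n.+1%:R + r y * T0.
  move=> hy SPi; have [_ _ _ _ inv] := loc y hy; have [_ Ob wb _ _] := hpull y hy.
  have -> : invmx (Pi + S y) = 1%:M + r y *: M (b y).
    have := mulKmx (unitE y hy) (1%:M + r y *: M (b y)).
    by rewrite inv mulmx1 (EP y hy SPi) [S y + Pi]addrC.
  rewrite linearD linearZ /= mxtrace1 (level_trace_horner eik pM Ob Ox0)// trp.
  by congr (_ + _ * _); apply: eq_bigr => i _; rewrite hpM.
pose mm := Num.min dd dp; have mm0 : 0 < mm by rewrite lt_min dd0.
have e1 : 0 < 1 + `|e| by rewrite ltr_pwDl.
pose s := mm / (1 + `|e|); have s0 : 0 < s by rewrite divr_gt0.
pose v := s *: e.
have vm : `|v| < mm.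
  by rewrite normrZ gtr0_norm// /s mulrAC -mulrA gtr_pMr// ltr_pdivrMr// mul1r ltrDr.
move: (vm); rewrite lt_min => /andP[vdd vdp].
have Piv : Pi *m v = v by rewrite -scalemxAr Pie.
have [_ _ eqT] := devB v vdd Piv.
(* Along the affine piece the focal point [y - r y *: nu y] is fixed, so the vector [r nu] is
   translated by [z]. *)
have near (z : 'cV[R]_n.+1) : `|z| = `|v| -> Pi *m z = z ->
    [/\ `|x0 + z - x0| < dp, S (x0 + z) *m Pi = 0 & r (x0 + z) *: nu (x0 + z) = r0 *: nu x0 + z].
  move=> zv Piz; have hz : `|x0 + z - x0| < dp by rewrite addrAC subrr add0r zv.
  have zdd : `|z| < dd by rewrite zv.
  have [ePhi eS] := devA x0 z (xx _ dd0) zdd Piz SE0.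
  split => //; move: ePhi; rewrite /Phi rx0 => /eqP; rewrite subr_eq => /eqP ez.
  move: (r _ *: nu _) ez => X ez; apply: (addrI (x0 - r0 *: nu x0)).
  by rewrite -ez addrA subrK.
have PivN : Pi *m (- v) = - v by rewrite mulmxN Piv.
have [hp Sp rp] := near v erefl Piv; have [hm Sm rm] := near (- v) (normrN v) PivN.
have q0 : (e^T *m e) 0 0 != 0.
  apply: contra ene0 => /eqP; rewrite mxE.
  have -> : \sum_j e^T 0 j * e j 0 = \sum_j e j 0 ^+ 2 by apply: eq_bigr => j _; rewrite mxE expr2.
  move=> /psumr_eq0P h; apply/eqP/matrixP => i j; rewrite (ord1 j) [RHS]mxE.
  by apply/eqP; rewrite -sqrf_eq0; apply/eqP; apply: h => // k _; exact: sqr_ge0.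
pose q := s ^+ 2 * (e^T *m e) 0 0.
have qn0 : q != 0 by rewrite mulf_neq0// expf_neq0// gt_eqF.
(* Pythagoras: [r ^+ 2] is the same at [x0 + v] and [x0 - v] and strictly larger than [r0 ^+ 2]. *)
have sq (c k : R) (z : 'cV[R]_n.+1) : Omega z -> c *: nu z = r0 *: nu x0 + k *: e ->
    c ^+ 2 = r0 ^+ 2 + k ^+ 2 * (e^T *m e) 0 0.
  move=> Oz ecz; have eT : e^T *m nu x0 = 0.
    by apply: trmx_inj; rewrite trmx_mul trmxK nue trmx0.
  have t1 : ((c *: nu z)^T *m (c *: nu z)) 0 0 = c ^+ 2.
    have -> : (c *: nu z)^T = c *: (nu z)^T by rewrite linearZ.
    by rewrite -scalemxAl -scalemxAr (eik_unit eik)// !mxE eqxx mulr1 expr2.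
  rewrite -t1 ecz.
  have -> : (r0 *: nu x0 + k *: e)^T = r0 *: (nu x0)^T + k *: e^T by rewrite linearD !linearZ.
  rewrite mulmxDl !(mulmxDr (_ *: _)) -!scalemxAl -!scalemxAr nue eT (eik_unit eik)//.
  by rewrite !scaler0 !mxE eqxx !expr2 mulr1n; move: (\sum_(_ < _) _) => S0; ring.
have [Op _ _ _ _] := loc _ hp; have [Om _ _ _ _] := loc _ hm.
have sp := sq _ _ _ Op rp; have sm : r (x0 - v) ^+ 2 = r0 ^+ 2 + (- s) ^+ 2 * (e^T *m e) 0 0.
  by apply: sq Om _; rewrite rm scaleNr.
rewrite sqrrN in sm; rewrite -/q in sp sm.
apply: contraTeq isT => T0n0.
(* Affinity of the trace. If [T0] were nonzero, the two radii would average to [r0]; having equal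
   squares, both would be [r0], against [qn0]. *)
have : (r (x0 + v) + r (x0 - v) - 2 * r0) * T0 = 0.
  have := congr1 (fun A => \tr A) eqT.
  rewrite linearD /= mulr2n linearD /= (trT _ hp Sp) (trT _ hm Sm) (trT _ (xx _ dp0) SE0) rx0.
  by move: (n.+1%:R : R) => k; lra.
move/eqP; rewrite mulf_eq0 (negbTE T0n0) orbF => /eqP sumr.
have r0n0 : r0 != 0 by rewrite /r0 invr_eq0.
have rE : r (x0 + v) = 2 * r0 - r (x0 - v) by lra.
have : r0 * (r0 - r (x0 - v)) = 0.
  by rewrite rE in sp; move: sp sm; rewrite !expr2; lra.
move/eqP; rewrite mulf_eq0 (negbTE r0n0) /= subr_eq0 => /eqP re.
exfalso; rewrite -re in sm; move/eqP: qn0; apply; lra.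
Qed.
End Cartan.

(** * Constancy of the normal projection *)

Section Constancy.
Variable R : realType.

Lemma sdiff_scalar_mx n (a : 'cV[R]_n -> R) x (p : 'rV[R]_n) :
  sdiff (a : 'cV[R]_n -> R^o) x (rowlin p) ->
  sdiff (fun y => (a y)%:M : 'cV[R]_1) x (mulmx p).
Proof.
move=> h; apply: sdiff_mxP => i j; rewrite (ord1 i) (ord1 j).
by apply: sdiff_near h; exists 1 => // y _; rewrite mxE eqxx mulr1n.
Qed.

Lemma sdiff0_constant m n (D : set 'cV[R]_n) (f : 'cV[R]_n -> 'cV[R]_m) :
  open D -> connected D -> (forall x, D x -> sdiff f x (mulmx 0)) ->
  forall x y, D x -> D y -> f x = f y.
Proof.
move=> Do Dc h; apply: (locally_constant_connected Do Dc) => x Dx.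
have [d d0 hd] := open_dist Do Dx; exists d => // y hy _.
rewrite -[y](subrK x) addrC -[RHS]addr0; apply: line_increment => s /andP[s0 s1].
exists 0; last by rewrite mul0mx.
apply: h; apply: hd; rewrite addrAC subrr add0r normrZ ger0_norm//.
by apply: le_lt_trans hy; rewrite ler_piMl.
Qed.

(** [A - B] is symmetric and its square is [A - B] itself, of trace 0. *)
Lemma proj_eq n (A B : 'M[R]_n) : A^T = A -> B^T = B -> A *m A = A -> B *m B = B ->
  A *m B = B -> \tr A = \tr B -> A = B.
Proof.
move=> sA sB AA BB AB tAB; apply/eqP; rewrite -subr_eq0; apply/eqP; apply: sym_sqr_tr0.
  by rewrite linearB /= sA sB.
have BA : B *m A = B by apply: trmx_inj; rewrite trmx_mul sA sB AB.
by rewrite mulmxBl !mulmxBr AA AB BA BB subrr subr0 linearB /= tAB subrr.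
Qed.

End Constancy.

(* [H x] has at most one nonzero eigenvalue, given here by a quotient of traces
   (with the junk value 0 when [H x = 0]). *)
Definition principal_curvature (R : realType) n (H : 'cV[R]_n -> 'M[R]_n) x : R :=
  \tr (H x *m H x) / \tr (H x).

Definition focal_radius (R : realType) n (H : 'cV[R]_n -> 'M[R]_n) x : R :=
  (principal_curvature H x)^-1.

Definition normal_projection (R : realType) n (nu : 'cV[R]_n -> 'cV[R]_n)
    (H : 'cV[R]_n -> 'M[R]_n) x : 'M[R]_n :=
  nu x *m (nu x)^T + focal_radius H x *: H x.

(** * Curvature and focal radius over the connected domain *)

Section GlobalStructure.
Variables (R : realType) (n : nat) (Omega : set 'cV[R]_n.+1).
Variables (w : 'cV[R]_n.+1 -> R) (nu : 'cV[R]_n.+1 -> 'cV[R]_n.+1)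
  (H : 'cV[R]_n.+1 -> 'M[R]_n.+1).
Hypothesis eik : eikonal Omega w nu H.
Hypothesis Omega_conn : connected Omega.

(** A single nonzero eigenvalue cannot cancel in the trace: [\tr (H x *m H x)] is a multiple of
    [\tr (H x)]. *)
Lemma hessian_trace_eq0 x : Omega x -> \tr (H x) = 0 -> H x = 0.
Proof.
move=> Ox t0; have [a ea] := hessian_one_eigenvalue eik Ox.
by apply: sym_sqr_tr0; [exact: (eik_sym eik)|rewrite ea linearZ /= t0 mulr0].
Qed.

(** By [pullback], [H y] vanishes exactly when it vanishes at the foot point of [y], where the trace
    is that at [x]; so vanishing is a locally constant property. *)
Lemma hessian_eq0_global x y : Omega x -> Omega y -> H x = 0 -> H y = 0.
Proof.
move=> Ox Oy Hx.
have := @locally_constant_connected R _ bool Omega (fun z => H z == 0) (eik_open eik) Omega_conn _ _ _ Ox Oy.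
rewrite Hx eqxx => h; apply/eqP; rewrite -h// => {Hx Ox Oy h x y} x Ox.
have [d d0 hp] := pullback eik Ox; exists d => // y hy _.
have [Oy Oy0 wy0 _ e] := hp y hy; move: Oy0 wy0 e; set t := w y - w x; set y0 := y - _ => Oy0 wy0 e.
have tr0 : \tr (H y0) = \tr (H x) by exact: (eik_tr eik).
apply/eqP/eqP => [Hy|Hx].
  by apply: hessian_trace_eq0 => //; rewrite -tr0 -e Hy mul0mx linear0.
have Hy0 : H y0 = 0 by apply: hessian_trace_eq0 => //; rewrite tr0 Hx linear0.
by move: e; rewrite Hy0 scaler0 addr0 mulmx1.
Qed.

Lemma affine_case x0 : Omega x0 -> \tr (H x0) = 0 -> forall x, Omega x ->
  w x - w x0 = ((nu x0)^T *m (x - x0)) 0 0 /\ H x = 0.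
Proof.
move=> Ox0 /(hessian_trace_eq0 Ox0) H0 x Ox.
have HH y (Oy : Omega y) : H y = 0 := hessian_eq0_global Ox0 Oy H0.
split; last exact: HH.
have nuc y (Oy : Omega y) : nu y = nu x0.
  apply: (sdiff0_constant (eik_open eik) Omega_conn) => // z Oz.
  by rewrite -(HH z Oz); exact: (eik_nu eik).
pose f y : 'cV[R]_1 := (w y)%:M - (nu x0)^T *m y.
have fc : f x = f x0.
  apply: (sdiff0_constant (eik_open eik) Omega_conn) => // z Oz.
  rewrite -(subrr (nu x0)^T); apply: sdiffB_mulmx; last exact: sdiff_mulmxl.
  by apply: sdiff_scalar_mx; rewrite -(nuc z Oz); exact: (eik_w eik).
move/matrixP: fc => /(_ 0 0); rewrite /f mulmxBr !mxE eqxx !mulr1n; lra.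
Qed.

Section Positive.
Variables (x0 : 'cV[R]_n.+1) (Ox0 : Omega x0) (tr0 : \tr (H x0) != 0).

Lemma hessian_trace_neq0 x : Omega x -> \tr (H x) != 0.
Proof.
move=> Ox; apply: contra tr0 => /eqP/(hessian_trace_eq0 Ox)/(hessian_eq0_global Ox Ox0) ->.
by rewrite linear0.
Qed.

Let a := principal_curvature H.
Let rad := focal_radius H.
Let Q := normal_projection nu H.

Lemma hessian_sqr x : Omega x -> H x *m H x = a x *: H x.
Proof.
move=> Ox; have [b eb] := hessian_one_eigenvalue eik Ox.
by rewrite /a /principal_curvature eb linearZ /= mulfK// hessian_trace_neq0.
Qed.

Lemma principal_curvature_neq0 x : Omega x -> a x != 0.
Proof.
move=> Ox; rewrite /a /principal_curvature mulf_neq0 ?invr_eq0 ?hessian_trace_neq0//.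
apply: contra (hessian_trace_neq0 Ox) => /eqP/(sym_sqr_tr0 (eik_sym eik Ox)) ->.
by rewrite linear0.
Qed.

(** At the foot point [y0] the curvature is that at [x], and the flow rescales [H y0] by
    [1 / (1 + t * a x)]. Hence [1 / a] gains exactly [t], while its product with the trace of the
    Hessian is unchanged. *)
Lemma focal_radius_local x : Omega x -> exists2 d : R, 0 < d & forall y, `|y - x| < d -> Omega y ->
  rad y = rad x + (w y - w x) /\ \tr (Q y) = \tr (Q x).
Proof.
move=> Ox; have [d d0 hp] := pullback eik Ox; exists d => // y hy Oy.
have [_ Oh wh _ e] := hp y hy; move: Oh wh e; set t := w y - w x.
set y0 := y - _ => Oh wh e.
have tr1 : \tr (H y0) = \tr (H x) by exact: (eik_tr eik).
have tr2 : \tr (H y0 *m H y0) = \tr (H x *m H x).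
  by have := level_trace_exp eik 2 Oh Ox wh; rewrite !expr2.
have aa : a y0 = a x by rewrite /a /principal_curvature tr1 tr2.
have hh := hessian_sqr Oh; have a0 := principal_curvature_neq0 Ox; rewrite aa in hh.
have key : (1 + t * a x) *: (H y *m H y0) = a x *: H y0.
  have : H y *m (1%:M + t *: H y0) *m H y0 = a x *: H y0 by rewrite e hh.
  rewrite -mulmxA mulmxDl mul1mx -scalemxAl hh scalerA => <-.
  by rewrite scalemxAr scalerDl scale1r.
(* Otherwise the trace of [key] would be [a x * \tr (H y0) = 0]. *)
have ta0 : 1 + t * a x != 0.
  apply/eqP => z; have := congr1 mxtrace key; rewrite z scale0r linear0 linearZ /= => /esym/eqP.
  by rewrite mulf_eq0 (negbTE a0) tr1 (negbTE (hessian_trace_neq0 Ox)).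
have Hy : H y = (1 + t * a x)^-1 *: H y0.
  have e1 : H y *m H y0 = (1 + t * a x)^-1 *: (a x *: H y0).
    by rewrite -key scalerA mulVf// scale1r.
  have : H y = H y0 - t *: (H y *m H y0).
    by rewrite -[X in X - _]e mulmxDr mulmx1 -scalemxAr addrK.
  rewrite e1 !scalerA => ->; rewrite -{1}[H y0]scale1r -scalerBl; congr (_ *: _).
  by field.
have ay : rad y = rad x + t.
  rewrite /rad /focal_radius -/(a x) {1}/principal_curvature Hy -scalemxAl -scalemxAr hh !linearZ /=.
  have := hessian_trace_neq0 Oh; move: (\tr (H y0)) => T T0; field.
  by rewrite T0 ta0 a0.
split => //; rewrite /Q /normal_projection !linearD /= !(mxtrace_mulC _ (_^T)) !(eik_unit eik)//; congr (_ + _).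
rewrite -/(rad y) ay Hy !linearZ /= tr1 mulrA; congr (_ * _); rewrite /rad /focal_radius -/(a x); field.
by rewrite ta0 a0.
Qed.

Lemma focal_radius_global x : Omega x -> rad x = rad x0 + (w x - w x0).
Proof.
move=> Ox; have : rad x - w x = rad x0 - w x0; last by lra.
apply: (@locally_constant_connected _ _ _ Omega (fun z => rad z - w z)) => //.
  exact: (eik_open eik).
move=> z Oz; have [d d0 h] := focal_radius_local Oz; exists d => // y hy Oy.
have [-> _] := h y hy Oy; lra.
Qed.

Lemma focal_radius_neq0 x : Omega x -> rad x != 0.
Proof. by move=> Ox; rewrite invr_eq0; exact: principal_curvature_neq0. Qed.

(** The radius varies continuously with [w] and never vanishes, so its sign is locally constant. *)
Lemma focal_radius_gt0 x : 0 < rad x0 -> Omega x -> 0 < rad x.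
Proof.
move=> r0 Ox; suff e : (0 < rad x) = (0 < rad x0) by rewrite e.
apply: (@locally_constant_connected _ _ _ Omega (fun z => 0 < rad z)) => //.
  exact: (eik_open eik).
move=> z Oz; have [d1 d10 h1] := focal_radius_local Oz.
have rz : 0 < `|rad z| / 2 by rewrite divr_gt0// normr_gt0 focal_radius_neq0.
have /(@continuousE_dist R _ R^o)/(_ _ rz)[d2 d20 h2] :=
  sdiff_continuous (lbounded_rowlin _) (eik_w eik Oz).
exists (Num.min d1 d2); first by rewrite lt_min d10.
move=> y; rewrite lt_min => /andP[/h1 y1 /h2 y2] Oy; have [e _] := y1 Oy.
move: y2; rewrite (_ : w y - w z = rad y - rad z); last by rewrite e [RHS]addrC addKr.
have := focal_radius_neq0 Oz; move: (rad z) (rad y) => a1 a2 a10.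
have [a1p|a1n] := ltP 0 a1.
  by rewrite (gtr0_norm a1p) ler_norml => /andP[? ?]; lra.
have a1n' : a1 < 0 by rewrite lt_neqAle a10.
by rewrite (ltr0_norm a1n') ler_norml => /andP[? ?]; apply/negbTE; rewrite -leNgt; lra.
Qed.

Lemma normal_projection_sym x : Omega x -> (Q x)^T = Q x.
Proof. by move=> Ox; rewrite /Q /normal_projection linearD linearZ /= (nu_proj_sym nu) (eik_sym eik). Qed.

Lemma normal_projection_idem x : Omega x -> Q x *m Q x = Q x.
Proof.
move=> Ox; rewrite /Q /normal_projection mulmxDl !mulmxDr (nu_proj_idem eik Ox) -!scalemxAl -!scalemxAr.
rewrite (hessian_nu_proj eik Ox) (nu_proj_hessian eik Ox) !scaler0 addr0 add0r hessian_sqr// !scalerA.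
by congr (_ + _ *: _); rewrite /focal_radius mulfVK// principal_curvature_neq0.
Qed.

Lemma normal_projection_trace x : Omega x -> \tr (Q x) = 1 + rad x * \tr (H x).
Proof. by move=> Ox; rewrite /Q /normal_projection linearD linearZ /= (mxtrace_nu_proj eik Ox). Qed.

(** [rad] differs from [w] by a constant, hence has gradient [nu]; the product rule then yields
    [Q]. *)
Lemma sdiff_focal_vector x : Omega x -> sdiff (fun y => rad y *: nu y) x (mulmx (Q x)).
Proof.
move=> Ox; have h2 : sdiff (rad : 'cV[R]_n.+1 -> R^o) x (rowlin (nu x)^T).
  have h := sdiff_shift_cst (rad x0 - w x0) (eik_w eik Ox).
  have [d d0 hd] := open_dist (eik_open eik) Ox.
  by apply: sdiff_near h; exists d => // z /hd Oz; rewrite (focal_radius_global Oz); ring.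
exact: (sdiff_scale h2 (eik_nu eik Ox)).
Qed.

Lemma normal_projection_continuous x : Omega x -> {for x, continuous Q}.
Proof.
move=> Ox.
have cN : {for x, continuous nu}.
  by apply: (sdiff_continuous (lbounded_mulmx 1 (H x))); exact: (eik_nu eik).
have cNN := continuous_mulmx cN (continuous_trmx cN).
have cr : {for x, continuous (fun y => (rad y)%:M : 'M[R]_n.+1)}.
  have [d d0 h] := focal_radius_local Ox.
  have /continuousE_dist cw := sdiff_continuous (lbounded_rowlin _) (eik_w eik Ox).
  have [d2 d20 hO] := open_dist (eik_open eik) Ox.
  apply/continuousE_dist => e /cw[d1 d10 hw].
  exists (Num.min d (Num.min d1 d2)); first by rewrite !lt_min d0 d10.
  move=> y; rewrite !lt_min => /and3P[y0 y1 /hO Oy].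
  apply: le_trans (hw y y1); apply: mx_norm_le => // i j; rewrite !mxE.
  have [-> _] := h y y0 Oy; case: (i == j); rewrite ?mulr1n ?mulr0n ?subrr ?normr0//.
  by rewrite addrAC subrr add0r.
have cH := continuous_mulmx cr (H_continuous eik Ox).
have := continuous_addmx cNN cH; congr (continuous_at _ _).
by apply/funext => y; rewrite /Q /normal_projection mul_scalar_mx.
Qed.

(* For [psi y = rad y *: nu y] both [id - psi] and [psi], with Jacobians [1 - Q]
   and [Q], are developable:
   [Q] is constant first in the directions of one factor, then of the other. *)
Lemma normal_projection_local x : Omega x -> exists2 d : R, 0 < d & forall y, `|y - x| < d -> Omega y -> Q y = Q x.
Proof.
move=> Ox; have [dO dO0 hO] := open_dist (eik_open eik) Ox.
have Qx := normal_projection_idem Ox; have Qs := normal_projection_sym Ox.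
have C1 : (1%:M - Q x)^T = 1%:M - Q x by rewrite linearB /= trmx1 Qs.
have C2 : (1%:M - Q x) *m (1%:M - Q x) = 1%:M - Q x.
  by rewrite mulmxBr mulmx1 mulmxBl mul1mx Qx subrr subr0.
have cC : {for x, continuous (fun y => 1%:M - Q y)}.
  have := continuousB (@cst_continuous _ _ (1%:M : 'M[R]_n.+1) x) (normal_projection_continuous Ox).
  by [].
have [|||d1 d10 [dev1 _]] := @developable R _ (fun y => y - rad y *: nu y)
   (fun y => 1%:M - Q y) Q (Q x) x dO dO0 _ (normal_projection_continuous Ox) erefl Qs Qx.
- move=> y /hO Oy; split.
  + have h1 := sdiff_id y.
    exact: sdiffB_mulmx h1 (sdiff_focal_vector Oy).
  + by rewrite linearB /= trmx1 normal_projection_sym.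
  + by rewrite mulmxBl mul1mx normal_projection_idem// subrr.
- by rewrite mulmxBl mul1mx Qx subrr.
- by rewrite addrC subrK unitmx1.
have [|||d2 d20 [dev2 _]] := @developable R _ (fun y => rad y *: nu y)
   Q (fun y => 1%:M - Q y) (1%:M - Q x) x dO dO0 _ cC erefl C1 C2.
- move=> y /hO Oy; split.
  + exact: sdiff_focal_vector.
  + exact: normal_projection_sym.
  + by rewrite mulmxBr mulmx1 normal_projection_idem// subrr.
- by rewrite mulmxBr mulmx1 Qx subrr.
- by rewrite subrK unitmx1.
have [d3 d30 ha] := focal_radius_local Ox.
have [K1 K10 hK1] := mulmx_bound 1 (Q x).
have [K2 K20 hK2] := mulmx_bound 1 (1%:M - Q x).
pose m := Num.min (Num.min d1 d2) (Num.min d3 dO).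
have m0 : 0 < m by rewrite !lt_min d10 d20 d30.
have [m1 m2 m3 mO] : [/\ m <= d1, m <= d2, m <= d3 & m <= dO].
  by split; rewrite /m !ge_min lexx ?orbT.
clearbody m.
pose d := Num.min m (Num.min (m / K1) (m / K2)).
exists d; first by rewrite !lt_min m0 !divr_gt0.
move=> y; rewrite !lt_min => /and3P[ym yK1 yK2] Oy.
pose v := Q x *m (y - x); pose v' := (1%:M - Q x) *m (y - x).
have vm : `|v| < m by apply: le_lt_trans (hK1 _) _; rewrite mulrC -ltr_pdivlMr.
have v'm : `|v'| < m by apply: le_lt_trans (hK2 _) _; rewrite mulrC -ltr_pdivlMr.
have Qv : Q x *m v = v by rewrite /v mulmxA Qx.
have Qv' : (1%:M - Q x) *m v' = v' by rewrite /v' mulmxA C2.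
have xx : `|x - x| < m by rewrite subrr normr0.
(* First along the kernel of [Q x], then along its image. The second move starts at [x + v'], for
   which the first conclusion of [developable] allows base points other than the centre. *)
have yE : y = x + v' + v.
  by rewrite -addrA /v /v' -mulmxDl subrK mul1mx addrC subrK.
have xv'm : `|x + v' - x| < m by rewrite addrAC subrr add0r.
have Ov' : Omega (x + v') by apply: hO; exact: lt_le_trans xv'm mO.
have Qxv' : Q (x + v') = Q x.
  have [|_ e] := dev2 x v' (lt_le_trans xx m2) (lt_le_trans v'm m2) Qv'.
    by rewrite mulmxBr mulmx1 Qx subrr.
  apply/esym; apply: proj_eq => //; [exact: normal_projection_sym|exact: normal_projection_idem| |].
    move: e; rewrite mulmxBr mulmx1 => /eqP; rewrite subr_eq0 => /eqP e.
    by apply: trmx_inj; rewrite trmx_mul Qs normal_projection_sym.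
  by have [_ ->] := ha _ (lt_le_trans xv'm m3) Ov'.
have [|_ e] := dev1 (x + v') v (lt_le_trans xv'm m1) (lt_le_trans vm m1) Qv.
  by rewrite Qxv' mulmxBl mul1mx Qx subrr.
move: e; rewrite -yE mulmxBl mul1mx => /eqP; rewrite subr_eq0 => /eqP e.
apply: proj_eq => //; [exact: normal_projection_sym|exact: normal_projection_idem|].
by have [_ ->] := ha _ (lt_le_trans ym m3) Oy.
Qed.

Lemma normal_projection_global x : Omega x -> Q x = Q x0.
Proof.
move=> Ox; apply: (@locally_constant_connected _ _ _ Omega Q) => //.
  exact: (eik_open eik).
by move=> z Oz; exact: normal_projection_local.
Qed.

(** The difference from the linear map [Q x0] has zero Jacobian. Its constant value lies in the
    image of [Q x0], because [Q x0] fixes [nu x0], so it can be absorbed into the centre [xs]. *)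
Lemma focal_vector_affine : exists xs : 'cV[R]_n.+1, forall x, Omega x ->
  rad x *: nu x = Q x0 *m (x - xs).
Proof.
pose f y := rad y *: nu y - Q x0 *m y.
have fc x : Omega x -> f x = f x0.
  move=> Ox; apply: (sdiff0_constant (eik_open eik) Omega_conn) => // z Oz.
  rewrite -(subrr (Q x0)); apply: sdiffB_mulmx; last exact: sdiff_mulmxl.
  by rewrite -(normal_projection_global Oz); exact: sdiff_focal_vector.
have Qnu : Q x0 *m nu x0 = nu x0.
  rewrite /Q /normal_projection mulmxDl -mulmxA (eik_unit eik)// mulmx1 -scalemxAl (hessian_nu eik Ox0).
  by rewrite scaler0 addr0.
exists (- f x0) => x Ox; rewrite opprK mulmxDr.
have -> : Q x0 *m f x0 = f x0.
  by rewrite /f mulmxBr mulmxA normal_projection_idem// -scalemxAr Qnu.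
by rewrite -(fc x Ox) /f addrC subrK.
Qed.

(** If [m] is the multiplicity of the nonzero eigenvalue [a], then [k = m.+1], the normal adding one
    dimension, and [\tr (H x0) = m * a]. This is the origin of the constant [(k - 1) / C1] as
    [1 / a]. *)
Lemma normal_projection_rank : 0 < \tr (H x0) -> exists k : nat,
  [/\ (2 <= k <= n.+1)%N, \tr (Q x0) = k%:R & rad x0 = (k%:R - 1) / \tr (H x0)].
Proof.
move=> tpos; have [P [d [Pu HE]]] := real_sym_diag (eik_sym eik Ox0).
have hh := hessian_sqr Ox0; have a0 := principal_curvature_neq0 Ox0.
have mxtrace_H : \tr (H x0) = \sum_i d 0 i.
  by rewrite HE mxtrace_mulC mulmxA mulmxV// mul1mx mxtrace_diag.
have da i : d 0 i = (d 0 i != 0)%:R * a x0.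
  have : diag_mx d *m diag_mx d = a x0 *: diag_mx d.
    have eD : diag_mx d = P *m (H x0 *m invmx P).
      by rewrite HE -!mulmxA mulmxV// mulmx1 mulmxA mulmxV// mul1mx.
    rewrite eD -!mulmxA (mulmxA (invmx P)) mulVmx// mul1mx (mulmxA (H x0)) hh.
    by rewrite -scalemxAl -scalemxAr.
  move=> /matrixP/(_ i i); rewrite mulmx_diag !mxE eqxx !mulr1n.
  have [->|dn0] := eqVneq (d 0 i) 0; first by rewrite !mul0r.
  by rewrite mul1r => /(mulIf dn0).
pose m := #|[pred i | d 0 i != 0]|.
have trm : \tr (H x0) = m%:R * a x0.
  rewrite mxtrace_H (eq_bigr _ (fun i _ => da i)) -mulr_suml; congr (_ * _).
  rewrite -natr_sum /m -sum1_card [in RHS]big_mkcond /=; congr (_%:R).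
have m0 : (0 < m)%N.
  by rewrite lt0n; apply: contraTneq tpos => m0; rewrite trm m0 mul0r ltxx.
(* The unit vector [nu x0] lies in the kernel of [H x0], so 0 is an eigenvalue. *)
have mn : (m < n.+1)%N.
  rewrite ltn_neqAle -[X in (m <= X)%N]card_ord max_card andbT; apply/eqP => mE.
  have Hu : H x0 \in unitmx.
    rewrite HE !unitmx_mul unitmx_inv Pu andbT /= unitmxE det_diag unitfE.
    apply/prodf_neq0 => i _.
    have := cardC [pred i | d 0 i != 0]; rewrite -/m mE card_ord => /eqP.
    rewrite -[X in _ == X]addn0 eqn_add2l => /eqP/card0_eq/(_ i).
    by rewrite !inE => /negbFE.
  have := congr1 (mulmx (invmx (H x0))) (hessian_nu eik Ox0).
  rewrite mulKmx// mulmx0 => nu0; have := eik_unit eik Ox0.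
  rewrite nu0 mulmx0 => /matrixP/(_ 0 0); rewrite !mxE eqxx => /eqP.
  by rewrite eq_sym oner_eq0.
exists m.+1; split.
- by rewrite ltnS m0.
- by rewrite normal_projection_trace// trm /rad /focal_radius -/(a x0) mulrCA mulVf// mulr1 -natr1 addrC.
- have mn0 : (m%:R : R) != 0 by rewrite pnatr_eq0 -lt0n.
  by rewrite -natr1 addrK trm invfM [RHS]mulrA divff// mul1r.
Qed.

End Positive.
End GlobalStructure.

(** * Lifting along gradient lines and primitives *)

Section OneVariable.
Variable R : realType.

(** The intermediate value theorem on a small symmetric interval. The linear bound on the preimage
    [s] is what difference quotients need in [lift_derive]. *)
Lemma local_surjection (phi : R -> R) (c : R) : 0 < c ->
  sdiff (phi : R^o -> R^o) 0 (fun h => h * c) ->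
  forall eta : R, 0 < eta -> exists2 d : R, 0 < d & forall t, `|t - phi 0| < d ->
    exists s, [/\ `|s| < eta, c / 2 * `|s| <= `|t - phi 0| & phi s = t].
Proof.
move=> c0 h eta eta0; have c2 : 0 < c / 2 by rewrite divr_gt0.
have [d0 d00 {}h] := h _ c2.
have hb (s s' : R) : `|s| < d0 -> `|s'| < d0 -> `|phi s - phi s' - (s - s') * c| <= c / 2 * `|s - s'|.
  by move=> hs hs'; apply: h; rewrite subr0.
pose m := Num.min d0 eta / 2.
have M0 : 0 < Num.min d0 eta by rewrite lt_min d00.
have m0 : 0 < m by rewrite divr_gt0.
have : m < Num.min d0 eta by rewrite /m; lra.
rewrite lt_min => /andP[md0 meta].
have n0 : `|0 : R| < d0 by rewrite normr0.
have up : phi 0 + c / 2 * m <= phi m.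
  by have := hb m 0; rewrite normr0 subr0 gtr0_norm// ler_norml => /(_ md0 d00)/andP[]; lra.
have dn : phi (- m) <= phi 0 - c / 2 * m.
  have := hb (- m) 0; rewrite normr0 subr0 normrN gtr0_norm// ler_norml => /(_ md0 d00)/andP[]; lra.
exists (c / 2 * m) => [|t ht]; first by rewrite mulr_gt0.
have [|||s sm phis] := @IVT R phi (- m) m t.
- by rewrite ge0_cp// ltW.
- apply: continuous_in_subspaceT => s; rewrite inE /= in_itv /= => /andP[s1 s2].
  have sd : `|s| < d0 by apply: le_lt_trans md0; rewrite ler_norml s1.
  apply/(@continuousE_dist R R^o R^o) => e e0.
  exists (Num.min (d0 - `|s|) (e / (c * 2))).
    by rewrite lt_min subr_gt0 sd divr_gt0// mulr_gt0.
  move=> y; rewrite lt_min => /andP[y1 y2].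
  have yd : `|y| < d0.
    rewrite -[y](subrK s); apply: le_lt_trans (ler_normD _ _) _; lra.
  have := hb y s yd sd => k.
  rewrite -[X in `|X| <= _](subrK ((y - s) * c)); apply: le_trans (ler_normD _ _) _.
  rewrite normrM (gtr0_norm c0).
  have : `|y - s| * (c * 2) <= e by rewrite -ler_pdivlMr ?mulr_gt0// ltW.
  have := normr_ge0 (y - s); nra.
- have pm : phi (- m) <= phi m by have := mulr_gt0 c2 m0; lra.
  rewrite (min_idPl pm) (max_idPr pm); move: ht; rewrite ltr_norml => /andP[]; lra.
exists s; rewrite -phis; move: sm; rewrite in_itv /= -ler_norml => sm.
split => //; first exact: le_lt_trans meta.
have := hb s 0 (le_lt_trans sm md0) n0; rewrite subr0 => k.
have : `|s * c| <= `|phi s - phi 0| + `|phi s - phi 0 - s * c|.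
  by rewrite -[X in `|X| <= _](subKr (phi s - phi 0)); exact: ler_normB.
rewrite normrM (gtr0_norm c0); lra.
Qed.

(** The regularity of [f] and [g] has to be recovered from that of their composites with [u]. Here
    [phi] is [u] along a gradient line, and every value near [phi 0] is attained at a small
    parameter. *)
Lemma lift_continuous (phi psi F : R -> R) (c : R) : 0 < c ->
  sdiff (phi : R^o -> R^o) 0 (fun h => h * c) -> {for 0, continuous psi} ->
  (exists2 eta : R, 0 < eta & forall s, `|s| < eta -> F (phi s) = psi s) ->
  {for phi 0, continuous F}.
Proof.
move=> c0 hphi /(@continuousE_dist R R^o R^o) cpsi [eta eta0 hF].
apply/(@continuousE_dist R R^o R^o) => e /cpsi[d d0 h].
have m0 : 0 < Num.min d eta by rewrite lt_min d0.
have [d1 d10 hs] := local_surjection c0 hphi m0.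
exists d1 => // t /hs[s [+ _ <-]]; rewrite lt_min => /andP[sd se].
by rewrite !hF// ?normr0//; apply: h; rewrite subr0.
Qed.

Lemma lift_derive (phi psi F : R -> R) (c m : R) : 0 < c ->
  sdiff (phi : R^o -> R^o) 0 (fun h => h * c) ->
  sdiff (psi : R^o -> R^o) 0 (fun h => h * m) ->
  (exists2 eta : R, 0 < eta & forall s, `|s| < eta -> F (phi s) = psi s) ->
  is_derive (phi 0) (1 : R) F (m / c).
Proof.
move=> c0 hphi hpsi [eta eta0 hF].
have : h^-1 *: ((F \o shift (phi 0)) (h *: (1:R)) - F (phi 0)) @[h --> 0^'] --> (m / c : R).
  apply/cvgrPdist_le => e e0.
  have c2 : 0 < c / 2 by rewrite divr_gt0.
  pose k := `|m / c|; have k0 : 0 <= k by exact: normr_ge0.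
  have k1 : 0 < 1 + k by lra.
  have e1 : 0 < e * (c / 2) / 2 by apply: divr_gt0 => //; exact: mulr_gt0.
  have e2 : 0 < e * (c / 2) / 2 / (1 + k) by rewrite divr_gt0.
  have [d1 d10 h1] := hpsi _ e1; have [d2 d20 h2] := hphi _ e2.
  have m0 : 0 < Num.min eta (Num.min d1 d2) by rewrite !lt_min eta0 d10.
  have [d d0 hs] := local_surjection c0 hphi m0.
  near=> t; have t0 : t != 0 by near: t; exact: nbhs_dnbhs_neq.
  have td : `|t| < d by near: t; exact: dnbhs0_lt.
  have := hs (t + phi 0); rewrite addrK => /(_ td)[s [sm st phis]].
  move: sm; rewrite !lt_min => /and3P[se s1 s2].
  rewrite /= [t *: 1]mulr1 -phis !hF ?normr0//.
  have n0 : `|0 - 0 : R| < d1 by rewrite subrr normr0.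
  have n0' : `|0 - 0 : R| < d2 by rewrite subrr normr0.
  have := h1 s 0; rewrite subr0 => /(_ s1 n0) k1'.
  have := h2 s 0; rewrite subr0 => /(_ s2 n0').
  have -> : phi s - phi 0 = t by rewrite phis addrK.
  move=> k2'; rewrite distrC -[_^-1 *: _]/(_ * _).
  rewrite -(ler_pM2l (_ : 0 < `|t|)) ?normr_gt0// -normrM mulrBr mulVKf//.
  have -> : psi s - psi 0 - t * (m / c) =
     (psi s - psi 0 - s * m) - (m / c) * (t - s * c).
    by rewrite mulrBr [m / c * (s * c)]mulrCA divfK ?gt_eqF//; ring.
  apply: le_trans (ler_normB _ _) _; rewrite normrM -/k.
  apply: (@le_trans _ _ (e * (c / 2 * `|s|))); last first.
    by rewrite mulrC ler_wpM2r// ltW.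
  have : k * `|t - s * c| <= (1 + k) * `|t - s * c| by rewrite ler_wpM2r// lerDr.
  have : (1 + k) * `|t - s * c| <= e * (c / 2) / 2 * `|s|.
    rewrite mulrC -ler_pdivlMr//; apply: le_trans k2' _.
    by rewrite le_eqVlt; apply/orP; left; apply/eqP; rewrite mulrAC.
  lra.
move=> k; apply: DeriveDef; first by apply/cvg_ex; exists (m / c).
exact: (cvg_lim _ k).
Unshelve. all: by end_near. Qed.

(** Rebasing the integral at a point [al] of [I] below both [a] and [t] merges the two sign cases
    into one difference of primitives. *)
Lemma oriented_integral_derive (I : set R) (h : R -> R) a t :
  open I -> is_interval I -> (forall s, I s -> {for s, continuous h}) -> I a -> I t ->
  is_derive t (1 : R) (fun t => oriented_integral a t h) (h t).
Proof.
move=> Io Ii hc Ia It.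
have shrink s : I s -> exists2 d : R, 0 < d & I (s - d) /\ I (s + d).
  move=> Is; have [d d0 hd] := @open_dist R R^o I s Io Is.
  exists (d / 2); first by rewrite divr_gt0.
  have d2 : d / 2 < d by lra.
  split; apply: hd; rewrite addrAC subrr add0r ?normrN gtr0_norm ?divr_gt0//.
have [da da0 [Ia1 Ia2]] := shrink a Ia; have [dt dt0 [It1 It2]] := shrink t It.
pose al := Num.min (a - da) (t - dt); pose be := Num.max (a + da) (t + dt).
have Ial : I al by rewrite /al minEle; case: ifP.
have Ibe : I be by rewrite /be maxEle; case: ifP.
have [ala alt_] : al < a /\ al < t by rewrite /al !gt_min; split; apply/orP; [left|right]; lra.
have [abe tbe] : a < be /\ t < be by rewrite /be !lt_max; split; apply/orP; [left|right]; lra.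
clearbody al be.
have hint : (@lebesgue_measure R).-integrable `[al, be] (EFin \o h).
  apply: continuous_compact_integrable; first exact: segment_compact.
  apply: continuous_in_subspaceT => s; rewrite inE /= in_itv /= => /andP[s1 s2].
  by apply: hc; apply: (Ii al be) => //; rewrite s1.
pose G s := \int[@lebesgue_measure R]_(y in `[al, s]) h y.
have [dG G'] := continuous_FTC1_closed tbe hint alt_ (hc t It).
have Gd : is_derive t (1 : R) G (h t).
  by apply: DeriveDef; [exact: dG|rewrite -derive1E; exact: G'].
have split_ s s' : al <= s -> s <= s' -> s' <= be ->
    \int[@lebesgue_measure R]_(y in `[s, s']) h y = G s' - G s.
  move=> als ss' s'be; rewrite /G.
  have hi : (@lebesgue_measure R).-integrable `[al, s'] (EFin \o h).
    by apply: integrableS hint => //; apply: subset_itvl; rewrite bnd_simp.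
  rewrite Rintegral_itvB ?bnd_simp//.
  rewrite Rintegral_itv_obnd_cbnd//.
  by apply: integrableS hi => //; apply: subset_itvr; rewrite bnd_simp.
have FE s : al < s < be -> oriented_integral a s h = G s - G a.
  move=> /andP[s1 s2]; rewrite /oriented_integral; case: ifP => [as_|/negbT].
    by apply: split_ => //; exact: ltW.
  by rewrite -ltNge => sa; rewrite split_ ?opprB// ltW.
have GG : is_derive t (1 : R) (fun s => G s - G a) (h t).
  have := is_deriveB Gd (is_derive_cst (G a) t (1:R)); rewrite subr0; exact.
apply: near_eq_is_derive GG.
apply/(@nearE_dist R R^o); exists (Num.min (t - al) (be - t)).
  by rewrite lt_min !subr_gt0 alt_.
move=> s; rewrite lt_min !ltr_norml => /andP[/andP[a1 a2] /andP[a3 a4]].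
by rewrite FE//; apply/andP; split; lra.
Qed.

End OneVariable.

(** * Symmetry of second derivatives *)

Section Schwarz.
Variables (R : realType) (n : nat).

(** One mean value step on [u (z + s *: b) - u z] leaves an increment of the gradient between two
    moving points. Strict differentiability of [p] at the single point [x] controls it. *)
Lemma second_difference (u : 'cV[R]_n -> R) (p : 'cV[R]_n -> 'cV[R]_n) (A : 'M[R]_n) x (d0 : R) :
  0 < d0 -> (forall y, `|y - x| < d0 -> sdiff (u : 'cV[R]_n -> R^o) y (rowlin (p y)^T)) ->
  sdiff p x (mulmx A) -> forall (a b : 'cV[R]_n) (e : R), 0 < e ->
  exists2 d : R, 0 < d & forall s, 0 < s < d ->
   `|u (x + s *: a + s *: b) - u (x + s *: a) - u (x + s *: b) + u x
     - s ^+ 2 * (a^T *m A *m b) 0 0| <= e * s ^+ 2.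
Proof.
move=> d00 hu hp a b e e0.
pose Ca := 1 + `|a|; pose Cb := 1 + `|b|.
have Ca0 : 0 < Ca by rewrite ltr_pwDl.
have Cb0 : 0 < Cb by rewrite ltr_pwDl.
have n1 : 0 < n.+1%:R :> R by [].
pose e1 := e / (n.+1%:R * Ca * Cb).
have e10 : 0 < e1 by rewrite divr_gt0// !mulr_gt0.
have [d1 d10 h1] := hp _ e10.
pose m := Num.min d0 d1.
have m0 : 0 < m by rewrite lt_min d00.
exists (m / (Ca + Cb)) => [|s /andP[s0 sd]]; first by rewrite divr_gt0// addr_gt0.
have sm : s * (Ca + Cb) < m by rewrite -ltr_pdivlMr// addr_gt0.
have near (th k : R) : 0 <= th <= 1 -> 0 <= k <= 1 -> `|x + k *: (s *: b) + th *: (s *: a) - x| < m.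
  move=> /andP[t0 t1] /andP[k0 k1].
  have -> : x + k *: (s *: b) + th *: (s *: a) - x = k *: (s *: b) + th *: (s *: a).
    by apply/matrixP => i j; rewrite !mxE; ring.
  apply: le_lt_trans (ler_normD _ _) _; apply: le_lt_trans sm.
  rewrite !normrZ !ger0_norm ?(ltW s0)//.
  have h2 : k * (s * `|b|) <= 1 * (s * Cb).
    by apply: ler_pM => //; rewrite ?mulr_ge0 ?(ltW s0)// ler_pM2l// lerDr.
  have h3 : th * (s * `|a|) <= 1 * (s * Ca).
    by apply: ler_pM => //; rewrite ?mulr_ge0 ?(ltW s0)// ler_pM2l// lerDr.
  by rewrite mulrDr; lra.
pose F (z : 'cV[R]_n) := u (z + s *: b) - u z.
have k01 : 0 <= (1 : R) <= 1 by rewrite ler01 lexx.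
have k00 : 0 <= (0 : R) <= 1 by rewrite ler01 lexx.
have nearb (th : R) : 0 <= th <= 1 -> `|x + th *: (s *: a) + s *: b - x| < m.
  by move=> ht; have := near th 1 ht k01; rewrite scale1r [x + _ + _]addrAC.
have neara (th : R) : 0 <= th <= 1 -> `|x + th *: (s *: a) - x| < m.
  by move=> ht; have := near th 0 ht k00; rewrite scale0r addr0.
have [|th ht Fth] := @mvt_line R _ F x (s *: a)
   (fun th => rowlin ((p (x + th *: (s *: a) + s *: b))^T - (p (x + th *: (s *: a)))^T) (s *: a)).
  move=> th ht; exists (rowlin ((p (x + th *: (s *: a) + s *: b))^T - (p (x + th *: (s *: a)))^T)).
  split => //; first exact: lbounded_rowlin.
  have z1 := nearb _ ht; have z2 := neara _ ht.
  rewrite lt_min in z1; rewrite lt_min in z2; case/andP: z1 => z1 _; case/andP: z2 => z2 _.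
  have := sdiffB (sdiff_comp (lbounded_mulmx 1 1%:M) (lbounded_rowlin _)
     (sdiff_translate (s *: b) (x + th *: (s *: a))) (hu _ z1)) (hu _ z2).
  by apply: sdiff_eqL => v; rewrite /= mul1mx /rowlin mulmxBl !mxE.
have -> : u (x + s *: a + s *: b) - u (x + s *: a) - u (x + s *: b) + u x = F (x + s *: a) - F x.
  by rewrite /F; ring.
rewrite Fth /rowlin.
set z1 := x + _ + _; set z0 := x + _.
have hz1 : `|z1 - x| < d1 by have := nearb _ ht; rewrite lt_min => /andP[].
have hz0 : `|z0 - x| < d1 by have := neara _ ht; rewrite lt_min => /andP[].
have zz : z1 - z0 = s *: b by rewrite /z1 addrAC subrr add0r.
have := h1 _ _ hz1 hz0; rewrite zz => E.
have -> : (((p z1)^T - (p z0)^T) *m (s *: a)) 0 0 = s * (a^T *m (p z1 - p z0)) 0 0.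
  rewrite -linearB -scalemxAr mxE; congr (_ * _).
  by rewrite -[in RHS](trmxK (p z1 - p z0)) -trmx_mul [RHS]mxE.
have -> : s * (a^T *m (p z1 - p z0)) 0 0 - s ^+ 2 * (a^T *m A *m b) 0 0 =
   s * (a^T *m (p z1 - p z0 - A *m (s *: b))) 0 0.
  move: (p z1 - p z0) => X; rewrite mulmxBr -[A *m _]scalemxAr -scalemxAr mulmxA.
  have -> : (a^T *m X - s *: (a^T *m A *m b)) 0 0 = (a^T *m X) 0 0 - s * (a^T *m A *m b) 0 0.
    by rewrite mxE; congr (_ + _); rewrite mxE; congr (- _); rewrite mxE.
  by move: ((a^T *m X) 0 0) ((a^T *m A *m b) 0 0) => c1 c2; ring.
rewrite normrM (gtr0_norm s0) expr2 mulrCA ler_pM2l//.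
apply: le_trans (le_mx_norm _ _ _) _; apply: le_trans (mx_normM _ _) _.
have aT : `|a^T| <= Ca.
  apply: mx_norm_le => [|i j]; first exact: ltW.
  by rewrite mxE; apply: le_trans (le_mx_norm _ _ _) _; rewrite lerDr.
have -> : e * s = n.+1%:R * Ca * (e1 * (s * Cb)).
  by rewrite /e1; field; rewrite ?gt_eqF// ?pnatr_eq0.
apply: ler_pM => //.
  by apply: ler_pM => //; rewrite ler_nat.
apply: le_trans E _; rewrite ler_pM2l// normrZ (gtr0_norm s0) ler_pM2l// lerDr//.
Qed.

(** The second difference is symmetric in [a] and [b], hence so is its limit after division by
    [s ^+ 2]. *)
Lemma jacobian_of_gradient_sym (u : 'cV[R]_n -> R) (p : 'cV[R]_n -> 'cV[R]_n) (A : 'M[R]_n) x (d0 : R) :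
  0 < d0 -> (forall y, `|y - x| < d0 -> sdiff (u : 'cV[R]_n -> R^o) y (rowlin (p y)^T)) ->
  sdiff p x (mulmx A) -> A^T = A.
Proof.
move=> d00 hu hp; have key := second_difference d00 hu hp.
have sw (a b : 'cV[R]_n) : (a^T *m A *m b) 0 0 = (b^T *m A *m a) 0 0.
  apply/eqP; rewrite -subr_eq0 -normr_le0; apply/ler_addgt0Pl => e e0; rewrite addr0.
  have e2 : 0 < e / 2 by rewrite divr_gt0.
  have [d1 d10 h1] := key a b _ e2; have [d2 d20 h2] := key b a _ e2.
  have m0 : 0 < Num.min d1 d2 by rewrite lt_min d10.
  pose s := Num.min d1 d2 / 2; have s0 : 0 < s by rewrite divr_gt0.
  have : s < Num.min d1 d2 by rewrite /s; lra.
  rewrite lt_min => /andP[s1 s2].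
  have := h1 s; have := h2 s; rewrite s0 s1 s2 => /(_ isT) k2 /(_ isT) k1.
  have p2 : 0 < s ^+ 2 by rewrite exprn_gt0.
  rewrite -(ler_pM2l p2) -{1}(gtr0_norm p2) -normrM.
  rewrite [x + s *: b + s *: a]addrAC in k2.
  move: k1 k2; rewrite !ler_norml; move: (u (_ + _ + _)) (u (x + s *: a)) (u (x + s *: b)) (u x) (s ^+ 2) ((a^T *m A *m b) 0 0) ((b^T *m A *m a) 0 0).
  by move=> u1 u2 u3 u4 S X Y /andP[? ?] /andP[? ?]; apply/andP; split; lra.
apply/matrixP => i j; rewrite mxE.
have := sw (delta_mx i 0) (delta_mx j 0).
by rewrite !trmx_delta -!rowE -!colE !mxE => ->.
Qed.

End Schwarz.

(** * From an isoparametric function to a unit gradient field *)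

Section Isoparametric.
Variables (R : realType) (n : nat) (Omega : set 'cV[R]_n.+1).
Hypotheses (Omega_open : open Omega) (Omega_conn : connected Omega).
Variables (u : 'cV[R]_n.+1 -> R) (f g : R -> R).
Hypothesis hu : C2_on Omega u.
Hypothesis f_gt0 : forall t, (u @` Omega) t -> 0 < f t.
Hypothesis hgrad : forall x, Omega x -> enorm (grad u x) = f (u x).
Hypothesis hlap : forall x, Omega x -> laplacian u x = g (u x).

Let I : set R := u @` Omega.
Let p y : 'cV[R]_n.+1 := (grad u y)^T.
(** Indexed so as to be the Jacobian of [p], hence the transpose of [hessian u y]; the two are
    identified through [Hs_symmetric]. *)
Let Hs y : 'M[R]_n.+1 := \matrix_(i, j) partial j (partial i u) y.

Lemma sdiff_u x : Omega x -> sdiff (u : 'cV[R]_n.+1 -> R^o) x (rowlin (p x)^T).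
Proof. by move=> Ox; rewrite /p trmxK; exact: (C1_sdiff Omega_open hu.1 Ox). Qed.

Lemma sdiff_gradient x : Omega x -> sdiff p x (mulmx (Hs x)).
Proof.
move=> Ox; apply: sdiff_mxP => i j; rewrite (ord1 j).
have := C1_sdiff Omega_open (hu.2 i) Ox.
move=> h; have : sdiff (partial i u : 'cV[R]_n.+1 -> R^o) x (fun v => (Hs x *m v) i 0).
  apply: sdiff_eqL h => v; rewrite /rowlin !mxE.
  by apply: eq_bigr => k _; rewrite !mxE.
by apply: sdiff_near; exists 1 => // y _; rewrite !mxE.
Qed.

Lemma Hs_symmetric x : Omega x -> (Hs x)^T = Hs x.
Proof.
move=> Ox; have [d d0 hd] := open_dist Omega_open Ox.
by apply: (jacobian_of_gradient_sym d0 _ (sdiff_gradient Ox)) => y /hd; exact: sdiff_u.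
Qed.

Lemma f_pos x : Omega x -> 0 < f (u x).
Proof. by move=> Ox; apply: f_gt0; exists x. Qed.

Lemma enorm_grad y : enorm (grad u y) = Num.sqrt (\sum_i p y i 0 ^+ 2).
Proof.
rewrite /enorm big_ord1; congr Num.sqrt; apply: eq_bigr => i _.
by rewrite /p !mxE.
Qed.

Lemma gradient_sqr x : Omega x -> \sum_i p x i 0 ^+ 2 = f (u x) ^+ 2.
Proof.
move=> Ox; rewrite -hgrad// enorm_grad sqr_sqrtr//.
by apply: sumr_ge0 => i _; exact: sqr_ge0.
Qed.

Lemma gradient_dot x : Omega x -> (p x)^T *m p x = (f (u x) ^+ 2)%:M.
Proof.
move=> Ox; apply/matrixP => i j; rewrite (ord1 i) (ord1 j) !mxE eqxx mulr1n -gradient_sqr//.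
by apply: eq_bigr => k _; rewrite !mxE expr2.
Qed.

(** At this stage [f] is not known to be differentiable; its composite with [u] is, being the
    Euclidean norm of a nonvanishing C^1 field. *)
Lemma sdiff_normgrad x : Omega x -> sdiff ((fun y => f (u y)) : 'cV[R]_n.+1 -> R^o) x
  (rowlin ((f (u x))^-1 *: ((p x)^T *m Hs x))).
Proof.
move=> Ox; have q0 : 0 < f (u x) ^+ 2 by rewrite exprn_gt0// f_pos.
have hs : sdiff (Num.sqrt : R^o -> R^o) (f (u x) ^+ 2) (fun h => h * (2 * Num.sqrt (f (u x) ^+ 2))^-1).
  apply: (@sdiff_C1 _ _ (fun t => (2 * Num.sqrt t)^-1) _ (f (u x) ^+ 2)) => //.
    move=> s hs; have s0 : 0 < s by move: hs; rewrite ltr_norml => /andP[]; lra.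
    exact: is_derive1_sqrt.
  apply: cvgV; first by rewrite mulf_neq0// sqrtr_eq0 -ltNge.
  by apply: cvgM; [exact: cvg_cst|exact: sqrt_continuous].
have hq := sdiff_sqnorm (sdiff_gradient Ox).
rewrite -gradient_sqr// in hs.
have := sdiff_comp (lbounded_rowlin _) (lbounded_scale _) hq hs.
move=> h; have [d d0 hd] := open_dist Omega_open Ox.
apply: sdiff_near; last first.
  apply: sdiff_eqL h => v /=; rewrite gradient_sqr// sqrtr_sqr gtr0_norm ?f_pos//.
  rewrite /rowlin mulr2n mulmxDl -scalemxAl [RHS]mxE.
  move: ((p x)^T *m Hs x *m v) => M.
  have -> : (M + M) 0 0 = M 0 0 + M 0 0 by rewrite mxE.
  rewrite -[LHS]/(_ * _); move: (M 0 0) => X.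
  have := f_pos Ox; move: (f _) => c c0; field.
  by rewrite gt_eqF.
by exists d => // y /hd Oy /=; rewrite gradient_sqr// sqrtr_sqr gtr0_norm// f_pos.
Qed.

Lemma near_along_gradient x : Omega x -> exists2 eta : R, 0 < eta & forall s, `|s| < eta -> Omega (x + s *: p x).
Proof.
move=> Ox; have [d d0 hd] := open_dist Omega_open Ox.
have k0 : 0 < 1 + `|p x| by rewrite ltr_pwDl.
exists (d / (1 + `|p x|)) => [|s]; first by rewrite divr_gt0.
rewrite ltr_pdivlMr// => hs; apply: hd; rewrite addrAC subrr add0r normrZ.
by apply: le_lt_trans hs; rewrite ler_wpM2l// lerDr.
Qed.

Lemma sdiff_along_gradient (a : 'cV[R]_n.+1 -> R) x (q : 'rV[R]_n.+1) :
  sdiff (a : 'cV[R]_n.+1 -> R^o) x (rowlin q) ->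
  sdiff ((fun s => a (x + s *: p x)) : R^o -> R^o) 0 (fun h => h * (q *m p x) 0 0).
Proof.
rewrite -{1}[x]addr0 -(scale0r (p x)) => /(sdiff_line (lbounded_rowlin _)).
by apply: sdiff_eqL => h; rewrite /rowlin -scalemxAr mxE.
Qed.

Lemma sdiff_u_along_gradient x : Omega x ->
  sdiff ((fun s => u (x + s *: p x)) : R^o -> R^o) 0 (fun h => h * f (u x) ^+ 2).
Proof.
move=> Ox; have := sdiff_along_gradient (sdiff_u Ox); apply: sdiff_eqL => h.
by rewrite gradient_dot// mxE eqxx mulr1n.
Qed.

Lemma f2_pos x : Omega x -> 0 < f (u x) ^+ 2.
Proof. by move=> Ox; rewrite exprn_gt0// f_pos. Qed.

(** Along its gradient line [u] moves at the nonzero speed [f (u x) ^+ 2], so it covers a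
    neighbourhood of [u x]. *)
Lemma I_open : open I.
Proof.
rewrite openE => _ [x Ox <-]; have [eta eta0 h] := near_along_gradient Ox.
have [d d0 hs] := local_surjection (f2_pos Ox) (sdiff_u_along_gradient Ox) eta0.
apply/(@nearE_dist R R^o); exists d => // t ht.
have := hs t; rewrite scale0r addr0 => /(_ ht)[s [/h Os _ <-]].
by exists (x + s *: p x).
Qed.

Lemma I_interval : is_interval I.
Proof.
apply/connected_intervalP; apply: connected_continuous_connected => //.
by have [[]] := hu.
Qed.

Let kk x := infty_laplacian u x / f (u x).

Lemma infty_laplacianE x : Omega x ->
  infty_laplacian u x = (f (u x)) ^- 2 * ((p x)^T *m Hs x *m p x) 0 0.
Proof.
move=> Ox; have hE : hessian u x = Hs x.
  by rewrite -(Hs_symmetric Ox); apply/matrixP => i j; rewrite !mxE.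
by rewrite /infty_laplacian (hgrad Ox) hE /p trmxK.
Qed.

(** Quotient of the derivatives of [|grad u|] and of [u] along the gradient line. It follows that
    the 1-Laplacian equals [g / f - f'] at [u x]. *)
Lemma f_derive x : Omega x -> is_derive (u x) (1 : R) f (kk x).
Proof.
move=> Ox; have := lift_derive (f2_pos Ox) (sdiff_u_along_gradient Ox) (sdiff_along_gradient (sdiff_normgrad Ox)).
move=> /(_ f); rewrite scale0r addr0 => h.
have -> : kk x = (((f (u x))^-1 *: ((p x)^T *m Hs x)) *m p x) 0 0 / f (u x) ^+ 2.
  rewrite /kk infty_laplacianE// -scalemxAl [in RHS]mxE.
  move: (((p x)^T *m Hs x *m p x) 0 0) => X.
  by have := f_pos Ox; move: (f _) => c c0; field; rewrite gt_eqF.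
by apply: h; exists 1.
Qed.

Lemma derive1_f x : Omega x -> derive1 f (u x) = kk x.
Proof. by move=> /f_derive[_ <-]; rewrite derive1E. Qed.

Lemma continuous_along_gradient (a : 'cV[R]_n.+1 -> R) x :
  {for x, continuous a} -> {for 0, continuous (fun s : R => a (x + s *: p x))}.
Proof.
move=> /(@continuousE_dist R _ R^o) ca; apply/(@continuousE_dist R R^o R^o) => e /ca[d d0 h].
have k0 : 0 < 1 + `|p x| by rewrite ltr_pwDl.
exists (d / (1 + `|p x|)); first by rewrite divr_gt0.
move=> s; rewrite subr0 ltr_pdivlMr// scale0r addr0 => hs; apply: h.
rewrite addrAC subrr add0r normrZ.
by apply: le_lt_trans hs; rewrite ler_wpM2l// lerDr.
Qed.

Lemma lift_along (a : 'cV[R]_n.+1 -> R) (F : R -> R) x : Omega x ->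
  {for x, continuous a} -> (forall y, Omega y -> F (u y) = a y) ->
  {for u x, continuous F}.
Proof.
move=> Ox ca h; have [eta eta0 hO] := near_along_gradient Ox.
have := lift_continuous (f2_pos Ox) (sdiff_u_along_gradient Ox) (continuous_along_gradient ca).
move=> /(_ F); rewrite scale0r addr0; apply.
by exists eta => // s /hO /h.
Qed.

Lemma p_continuous x : Omega x -> {for x, continuous p}.
Proof. by move=> Ox; exact: (sdiff_continuous (lbounded_mulmx 1 (Hs x)) (sdiff_gradient Ox)). Qed.

Lemma Hs_continuous x : Omega x -> {for x, continuous Hs}.
Proof.
move=> Ox; have [d d0 h] := open_dist Omega_open Ox.
by apply: (@jacobian_continuous _ _ _ p); exists d => // y /h /sdiff_gradient.
Qed.

Lemma laplacianE x : laplacian u x = \tr (Hs x).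
Proof. by apply: eq_bigr => i _; rewrite mxE. Qed.

Lemma g_continuous x : Omega x -> {for u x, continuous g}.
Proof.
move=> Ox; apply: (lift_along Ox (a := fun y => \tr (Hs y))); last first.
  by move=> y Oy; rewrite -laplacianE hlap.
have /continuousE_dist c := Hs_continuous Ox.
apply/(@continuousE_dist R _ R^o) => e e0; have e'0 : 0 < e / n.+1%:R by rewrite divr_gt0.
have [d d0 h] := c _ e'0; exists d => // y /h hy.
rewrite -linearB /=; apply: le_trans (mxtrace_norm _) _.
by rewrite mulrC -ler_pdivlMr.
Qed.

Lemma f_continuous x : Omega x -> {for u x, continuous f}.
Proof.
move=> Ox; apply: (lift_along Ox (a := fun y => f (u y))) => //.
exact: (sdiff_continuous (lbounded_rowlin _) (sdiff_normgrad Ox)).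
Qed.

Lemma df_continuous x : Omega x -> {for u x, continuous (derive1 f)}.
Proof.
move=> Ox.
pose q y := ((p y)^T *m Hs y *m p y) 0 0.
have cq : {for x, continuous q}.
  exact: (continuous_entry (i := 0) (j := 0) (continuous_mulmx (continuous_mulmx
    (continuous_trmx (p_continuous Ox)) (Hs_continuous Ox)) (p_continuous Ox))).
have cf : {for x, continuous (fun y => f (u y))}.
  exact: (sdiff_continuous (lbounded_rowlin _) (sdiff_normgrad Ox)).
have cfV : {for x, continuous (fun y => (f (u y))^-1)}.
  have fn0 : f (u x) != 0 by rewrite gt_eqF// f_pos.
  exact: (cvgV fn0 cf).
apply: (lift_along Ox (a := fun y => (f (u y))^-1 * ((f (u y))^-1 * (q y * (f (u y))^-1)))).
  exact: (cvgM cfV (cvgM cfV (cvgM cq cfV))).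
by move=> y Oy; rewrite derive1_f// /kk infty_laplacianE// /q -exprVn expr2 !mulrA.
Qed.


Lemma C1_real_f : C1_real I f.
Proof.
split=> [_ [x Ox <-]|]; first by have [] := f_derive Ox.
apply: continuous_in_subspaceT => _ /[1!inE] -[x Ox <-]; exact: df_continuous.
Qed.

Lemma continuous_within_g : {within I, continuous g}.
Proof.
apply: continuous_in_subspaceT => _ /[1!inE] -[x Ox <-]; exact: g_continuous.
Qed.

(** * The function [w = F o u] and the two cases *)

Section Distance.
Variables (x0 : 'cV[R]_n.+1) (Ox0 : Omega x0).
Let F t := oriented_integral (u x0) t (fun s => (f s)^-1).
Let w y := F (u y).
Let nu y := (f (u y))^-1 *: p y.
Let dh t := - (f t) ^- 2 * derive1 f t.
(** The product rule for [nu], with [dh] the derivative of [1 / f]. *)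
Let H y := p y *m (dh (u y) *: (p y)^T) + (f (u y))^-1 *: Hs y.

Lemma inv_f_continuous x : Omega x -> {for u x, continuous (fun s => (f s)^-1)}.
Proof. by move=> Ox; apply: cvgV; [rewrite gt_eqF// f_pos|exact: f_continuous]. Qed.

Lemma F_derive x : Omega x -> is_derive (u x) (1 : R) F (f (u x))^-1.
Proof.
move=> Ox; apply: (oriented_integral_derive I_open I_interval) => //.
- by move=> _ [y Oy <-]; exact: inv_f_continuous.
- by exists x0.
- by exists x.
Qed.

Lemma F_increasing t t' : I t -> I t' -> t < t' -> F t < F t'.
Proof.
move=> It It' tt'; have [|s] := @mvt_between R F (fun s => (f s)^-1) t t'.
  move=> s; rewrite (min_idPl (ltW tt')) (max_idPr (ltW tt')) => hs.
  have [y Oy <-] : I s by exact: (I_interval It It').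
  exact: F_derive.
rewrite (min_idPl (ltW tt')) (max_idPr (ltW tt')) => hs e.
have [y Oy ys] : I s by exact: (I_interval It It').
rewrite -subr_gt0 e mulr_gt0// ?subr_gt0// invr_gt0 -ys; exact: f_pos.
Qed.

Lemma F_injective t t' : I t -> I t' -> F t = F t' -> t = t'.
Proof.
move=> It It' e; have [tt'|t't|//] := ltgtP t t'.
  by have := F_increasing It It' tt'; rewrite e ltxx.
by have := F_increasing It' It t't; rewrite e ltxx.
Qed.

Lemma F_x0 : F (u x0) = 0.
Proof. by rewrite /F /oriented_integral lexx set_itv1 Rintegral_set1. Qed.

Lemma sdiff_w x : Omega x -> sdiff (w : 'cV[R]_n.+1 -> R^o) x (rowlin (nu x)^T).
Proof.
move=> Ox; have Iux : I (u x) by exists x.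
have [d d0 hd] := @open_dist R R^o I (u x) I_open Iux.
have hF : sdiff (F : R^o -> R^o) (u x) (fun h => h * (f (u x))^-1).
  apply: (@sdiff_C1 _ _ (fun t => (f t)^-1) _ d) => //; last exact: inv_f_continuous.
  by move=> s /hd[y Oy <-]; exact: F_derive.
have := sdiff_comp (lbounded_rowlin _) (lbounded_scale _) (sdiff_u Ox) hF.
apply: sdiff_eqL => v; rewrite /= /rowlin /nu.
have -> : ((f (u x))^-1 *: p x)^T = (f (u x))^-1 *: (p x)^T by rewrite linearZ.
by rewrite -scalemxAl [RHS]mxE mulrC.
Qed.

Lemma sdiff_nu x : Omega x -> sdiff nu x (mulmx (H x)).
Proof.
move=> Ox; have Iux : I (u x) by exists x.
have [d d0 hd] := @open_dist R R^o I (u x) I_open Iux.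
have hh : sdiff ((fun t => (f t)^-1) : R^o -> R^o) (u x) (fun h => h * dh (u x)).
  apply: (@sdiff_C1 _ _ dh _ d) => //.
    move=> s /hd[y Oy <-]; have f0 : f (u y) != 0 by rewrite gt_eqF// f_pos.
    by have := is_deriveV f0 (f_derive Oy); rewrite -derive1_f.
  apply: cvgM; last exact: df_continuous.
  apply: cvgN; rewrite -exprVn.
  have c := inv_f_continuous Ox.
  have -> : (fun t => (f t) ^- 2) = (fun t => (f t)^-1 * (f t)^-1).
    by apply/funext => t; rewrite -exprVn expr2.
  by rewrite expr2; apply: cvgM.
have h2 := sdiff_comp (lbounded_rowlin _) (lbounded_scale _) (sdiff_u Ox) hh.
have h3 : sdiff ((fun y => (f (u y))^-1) : 'cV[R]_n.+1 -> R^o) x (rowlin (dh (u x) *: (p x)^T)).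
  by apply: sdiff_eqL h2 => v; rewrite /= /rowlin -scalemxAl [RHS]mxE mulrC.
exact: (sdiff_scale h3 (sdiff_gradient Ox)).
Qed.

(** Only the value [u x] enters; together with the injectivity of [F] this makes the trace constant
    on the levels of [w]. *)
Lemma mxtrace_H x : Omega x -> \tr (H x) = g (u x) / f (u x) - derive1 f (u x).
Proof.
move=> Ox; rewrite /H mxtraceD mxtraceZ -laplacianE hlap// -scalemxAr mxtraceZ.
rewrite mxtrace_mulC gradient_dot// mxtrace_scalar mulr1n /dh.
by have := f_pos Ox; move: (f _) (derive1 f _) => c d c0; field; rewrite gt_eqF.
Qed.

Lemma mxtrace_H_one_laplacian x : Omega x -> \tr (H x) = one_laplacian u x.
Proof.
by move=> Ox; rewrite (mxtrace_H Ox) /one_laplacian hgrad// hlap// mulrBl derive1_f.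
Qed.

Lemma eikonal_of_isoparametric : eikonal Omega w nu H.
Proof.
split.
- exact: Omega_open.
- exact: sdiff_w.
- exact: sdiff_nu.
- move=> x Ox; have -> : H x = dh (u x) *: (p x *m (p x)^T) + (f (u x))^-1 *: Hs x.
    by rewrite /H -scalemxAr.
  by rewrite linearD /= !linearZ /= (Hs_symmetric Ox) trmx_mul trmxK.
- move=> x Ox; have -> : (nu x)^T = (f (u x))^-1 *: (p x)^T by rewrite linearZ.
  rewrite /nu -scalemxAl -scalemxAr (gradient_dot Ox) scalerA -scalemx1 scalerA -expr2 exprVn mulVf ?scale1r//.
  by rewrite gt_eqF// f2_pos.
- move=> x y Ox Oy wxy; have uu : u x = u y by apply: F_injective => //; [exists x|exists y].
  apply: (etrans (mxtrace_H Ox)); rewrite uu.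
  exact: (esym (mxtrace_H Oy)).
Qed.

Lemma inverse_exists (c : R) : exists U : R -> R, inverse_on I (fun t => c + F t) U.
Proof.
(* The default 0 is taken only off the image, where [inverse_on] leaves [U] free. *)
pose U s := xget 0 [set t | I t /\ c + F t = s].
have UF t : I t -> U (c + F t) = t.
  move=> It; rewrite /U; case: xgetP => [t' _ [It' e]|]; last by move=> /(_ t) [].
  by apply: F_injective => //; apply: (addrI c).
exists U; split=> [t|s]; rewrite inE; first exact: UF.
by move=> [t It <-]; rewrite UF.
Qed.

Lemma enorm_cV (q : 'cV[R]_n.+1) : enorm q = Num.sqrt ((q^T *m q) 0 0).
Proof.
rewrite /enorm mxE; congr Num.sqrt; apply: eq_bigr => i _.
by rewrite big_ord1 mxE expr2.
Qed.

Lemma flat_case : one_laplacian u x0 = 0 ->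
  (forall t, I t -> g t = f t * derive1 f t) /\
  exists (q : 'cV[R]_n.+1) (U : R -> R),
    [/\ enorm q = 1, inverse_on I F U &
      forall x, Omega x -> let s := (q^T *m (x - x0)) 0 0 in (F @` I) s /\ u x = U s].
Proof.
move=> D0; have eik := eikonal_of_isoparametric.
have t0 : \tr (H x0) = 0 by rewrite mxtrace_H_one_laplacian.
have key := affine_case eik Omega_conn Ox0 t0; split.
  move=> _ [x Ox <-]; have [_ Hx] := key x Ox.
  have := mxtrace_H Ox; rewrite Hx linear0 => /esym/eqP; rewrite subr_eq0 => /eqP <-.
  by rewrite mulrC divfK// gt_eqF// f_pos.
have [U hU] := inverse_exists 0.
have FE : (fun t => 0 + F t) = F by apply/funext => t; rewrite add0r.
(* The direction [q] is the constant unit normal. *)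
rewrite FE in hU; exists (nu x0), U; split; last 2 first.
- exact: hU.
- move=> x Ox s; have [e _] := key x Ox.
  have sE : s = F (u x) by rewrite /s -e /w F_x0 subr0.
  rewrite sE; split; first by exists (u x) => //; exists x.
  by rewrite hU.1// inE; exists x.
by rewrite enorm_cV (eik_unit eik Ox0) mxE eqxx sqrtr1.
Qed.

(** Three quantities coincide with the focal radius at [x]: [Fk (u x)], since both grow with [w]
    from the same value at [x0]; the length of [rad *: nu]; and [|R0 (x - xs)|]. The formula for [g]
    is the trace of the constant projection, [k = 1 + rad * \tr (H x)], solved for [g]. *)
Lemma round_case : 0 < one_laplacian u x0 ->
  exists k : nat,
    let Fk := fun t : R => ((k%:R - 1) / one_laplacian u x0 + F t : R) in
    [/\ (2 <= k <= n.+1)%N,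
        (forall t, I t -> 0 < Fk t /\ g t = f t * (derive1 f t + (k%:R - 1) / Fk t)) &
        exists (R0 : 'M[R]_n.+1) (xs : 'cV[R]_n.+1) (Uk : R -> R),
          [/\ Pr k R0, (forall x, Omega x -> R0 *m (x - xs) <> 0), inverse_on I Fk Uk &
              forall x, Omega x -> let r := enorm (R0 *m (x - xs)) in
                (Fk @` I) r /\ u x = Uk r]].
Proof.
move=> Dpos; have eik := eikonal_of_isoparametric.
rewrite -(mxtrace_H_one_laplacian Ox0) in Dpos *.
have t0 : \tr (H x0) != 0 by rewrite gt_eqF.
have [k [hk trQ rad0]] := normal_projection_rank eik Omega_conn Ox0 t0 Dpos.
have radE := focal_radius_global eik Omega_conn Ox0 t0.
have Qglob := normal_projection_global eik Omega_conn Ox0 t0.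
have Qtr := normal_projection_trace eik.
have [xs psi] := focal_vector_affine eik Omega_conn Ox0 t0.
have Qs := normal_projection_sym eik Ox0; have Qi := normal_projection_idem eik Omega_conn Ox0 t0 Ox0.
have k1 : (1 : R) < k%:R by rewrite ltr1n; case/andP: hk.
have radpos x : Omega x -> 0 < focal_radius H x.
  apply: (focal_radius_gt0 eik Omega_conn Ox0 t0).
  by rewrite rad0 divr_gt0// subr_gt0.
have FkE x : Omega x -> (k%:R - 1) / \tr (H x0) + F (u x) = focal_radius H x.
  by move=> Ox; rewrite radE// -rad0 /w F_x0 subr0.
have normE x : Omega x -> enorm (normal_projection nu H x0 *m (x - xs)) = focal_radius H x.
  move=> Ox; rewrite -psi// enorm_cV.
  have -> : (focal_radius H x *: nu x)^T = focal_radius H x *: (nu x)^T by rewrite linearZ.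
  rewrite -scalemxAl -scalemxAr (eik_unit eik Ox) scalerA -expr2 mxE mxE eqxx mulr1n mulr1.
  by rewrite sqrtr_sqr gtr0_norm// radpos.
exists k => Fk; split => //.
  move=> _ [x Ox <-]; rewrite /Fk FkE//; split; first exact: radpos.
  have := mxtrace_H Ox; have := Qtr x Ox; rewrite Qglob// trQ => -> trHx.
  rewrite trHx; have := radpos x Ox; have := f_pos Ox.
  move: (f _) (derive1 f _) (g _) (focal_radius H x) => c d b r c0 r0.
  by field; rewrite !gt_eqF.
have [U [UF FU]] := inverse_exists ((k%:R - 1) / \tr (H x0)).
exists (normal_projection nu H x0), xs, U; split => //.
- move=> x Ox e; have := normE x Ox; rewrite e enorm_cV trmx0 mul0mx mxE sqrtr0.
  by move=> r0; have := radpos x Ox; rewrite -r0 ltxx.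
- move=> x Ox r; rewrite /r normE// -FkE//; split; first by exists (u x) => //; exists x.
  by rewrite UF// inE; exists x.
Qed.

End Distance.
End Isoparametric.

Set Strict Implicit.
Unset Implicit Arguments.

Theorem mainTheorem1 (R : realType) (n : nat) (hn : (2 <= n)%N)
    (Omega : set 'cV[R]_n) (Omega_open : open Omega)
    (Omega_conn : connected Omega)
    (u : 'cV[R]_n -> R) (hu : C2_on Omega u) (f g : R -> R)
    (f_gt0 : forall t, (u @` Omega) t -> 0 < f t)
    (hgrad : forall x, Omega x -> enorm (grad u x) = f (u x))
    (hlap : forall x, Omega x -> laplacian u x = g (u x)) :
  let I : set R := u @` Omega in
  [/\ (open I /\ is_interval I),
      C1_real I f,
      {within I, continuous g},
      (forall x0 : 'cV[R]_n, Omega x0 -> one_laplacian u x0 = 0 ->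
        let F := fun t : R => oriented_integral (u x0) t (fun s => (f s)^-1) in
        (forall t, I t -> g t = f t * derive1 f t) /\
        exists (q : 'cV[R]_n) (U : R -> R),
          [/\ enorm q = 1,
              inverse_on I F U &
              forall x, Omega x ->
                let s := (q^T *m (x - x0)) 0 0 in
                (F @` I) s /\ u x = U s]) &
      (forall x0 : 'cV[R]_n, Omega x0 ->
        let C1 := one_laplacian u x0 in
        0 < C1 ->
        let F := fun t : R => oriented_integral (u x0) t (fun s => (f s)^-1) in
        exists k : nat,
          let Fk := fun t : R => ((k%:R - 1) / C1 + F t : R) in
          [/\ (2 <= k <= n)%N,
              (forall t, I t ->
                0 < Fk t /\ g t = f t * (derive1 f t + (k%:R - 1) / Fk t)) &
              exists (R0 : 'M[R]_n) (xs : 'cV[R]_n) (Uk : R -> R),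
                [/\ Pr k R0,
                    (forall x, Omega x -> R0 *m (x - xs) <> 0),
                    inverse_on I Fk Uk &
                    forall x, Omega x ->
                      let r := enorm (R0 *m (x - xs)) in
                      (Fk @` I) r /\ u x = Uk r]])].
Proof.
case: n hn Omega Omega_open Omega_conn u hu hgrad hlap f_gt0 => [//|m] hn Omega Omega_open
  Omega_conn u hu hgrad hlap f_gt0 I.
split.
- split; first exact: (I_open Omega_open hu f_gt0 hgrad).
  exact: (I_interval Omega_conn hu).
- exact: (C1_real_f Omega_open hu f_gt0 hgrad).
- exact: (continuous_within_g Omega_open hu f_gt0 hgrad hlap).
- move=> x0 Ox0 D0.
  exact: (flat_case Omega_open Omega_conn hu f_gt0 hgrad hlap Ox0 D0).
- move=> x0 Ox0 C1 D0.
  exact: (round_case Omega_open Omega_conn hu f_gt0 hgrad hlap Ox0 D0).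
Qed.
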